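(* Let $u$ be an interpolating Blaschke product with (simple) zeros $\{z_n\}_{n\ge 1}$, and let $A_\phi$ be a truncated Toeplitz operator on $K_u$ with analytic symbol $\phi\in H^2$. (a) For $1\le p\le\infty$, $A_\phi\in S_p$ if and only if $\{\phi(z_n)\}\in \ell^p$. (b) $A_\phi$ is compact if and only if $\{\phi(z_n)\}$ tends to zero.
   Context: $\mathbb D$ is the open unit disk, $H^2$ is the Hardy space of $\mathbb D$, identified with its boundary values in $L^2=L^2(\partial\mathbb D)$. For an inner function $u$, $K_u=H^2\ominus uH^2$ and $P_u$ is the orthogonal projection of $L^2$ onto $K_u$. For $\phi\in L^2$, the truncated Toeplitz operator $A_\phi$ on $K_u$ is $A_\phi f=P_u(\phi f)$; it is defined at least on the dense subspace $K_u\cap H^\infty$, and it is said to be bounded, compact, or in $S_p$ if it extends to such an operator on $K_u$. An interpolating Blaschke product is an infinite Blaschke product with simple zeros forming an interpolating sequence for $H^\infty$. For $p<\infty$, an operator $T$ is in the Schatten class $S_p$ if its sequence of singular values (the eigenvalues of $\sqrt{T^*T}$) is in $\ell^p$; in part (a), $S_\infty$ means the bounded operators. *)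

(* Defs.v *)
From HB Require Import structures.
From mathcomp Require Import all_boot all_order all_algebra.
From mathcomp Require Import complex.
From mathcomp Require Import all_classical all_reals all_analysis.

Set Implicit Arguments.
Unset Strict Implicit.
Unset Printing Implicit Defensive.

Import Order.TTheory GRing.Theory Num.Theory.
Import numFieldNormedType.Exports.
Import ComplexField.Normc.

Local Open Scope classical_set_scope.
Local Open Scope complex_scope.
Local Open Scope ring_scope.

(** A function on the unit circle is written as a function [f : R -> R[i]] of
    the angle [t], only its values on [0, 2 pi] being relevant; it represents
    a class modulo equality almost everywhere.  Integrals are taken with
    respect to the normalized measure dt / (2 pi). *)

Definition angles (R : realType) : set R := `[0, 2 * pi]%classic.
Arguments angles : clear implicits.

Definition expi (R : realType) (t : R) : R[i] := cos t +i* sin t.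

Definition ae_on_circle (R : realType) (P : R -> Prop) : Prop :=
  {ae (@lebesgue_measure R), forall t : R, angles R t -> P t}.

Definition aeeq (R : realType) (f g : R -> R[i]) : Prop :=
  ae_on_circle (fun t => f t = g t).

Definition mean (R : realType) (f : R -> R[i]) : R[i] :=
  ((2 * pi)^-1 * \int[@lebesgue_measure R]_(t in angles R) complex.Re (f t))
  +i*
  ((2 * pi)^-1 * \int[@lebesgue_measure R]_(t in angles R) complex.Im (f t)).

Definition L2 (R : realType) (f : R -> R[i]) : Prop :=
  [/\ measurable_fun (angles R) (fun t => complex.Re (f t)),
      measurable_fun (angles R) (fun t => complex.Im (f t)) &
      (\int[@lebesgue_measure R]_(t in angles R) (normc (f t) ^+ 2)%:E
         < +oo)%E].

Definition inner (R : realType) (f g : R -> R[i]) : R[i] :=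
  mean (fun t => f t * conjc (g t)).

Definition norm2 (R : realType) (f : R -> R[i]) : R :=
  Num.sqrt (complex.Re (inner f f)).

Definition fourier (R : realType) (f : R -> R[i]) (n : int) : R[i] :=
  mean (fun t => f t * expi (- (n%:~R * t))).

(** The boundary values of the Hardy space of the disk: the function
    [sum_n a_n z^n], with [(a_n)] square summable, is identified with the
    element of L^2 whose n-th Fourier coefficient is [a_n] for [0 <= n] and
    [0] for [n < 0]. *)
Definition H2 (R : realType) (f : R -> R[i]) : Prop :=
  L2 f /\ forall n : nat, fourier f (Negz n) = 0.

(** The value at [z], for [`|z| < 1], of the analytic function with boundary
    values [f] in H^2. *)
Definition disk_ext (R : realType) (f : R -> R[i]) (z : R[i]) : R[i] :=
  limn (series (fun n : nat => fourier f n%:Z * z ^+ n : (R[i])^o)).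

Definition Hinfty (R : realType) (f : R -> R[i]) : Prop :=
  H2 f /\ exists M : R, ae_on_circle (fun t => normc (f t) <= M).

(** [K_u = H^2 (-) u H^2] for [u] inner. *)
Definition model_space (R : realType) (u : R -> R[i]) : set (R -> R[i]) :=
  [set f | H2 f /\ forall h, H2 h -> inner f (fun t => u t * h t) = 0].

(** [g] represents the orthogonal projection of [f] onto the subspace [K]. *)
Definition is_proj (R : realType) (K : set (R -> R[i])) (f g : R -> R[i]) :
    Prop :=
  K g /\ forall h, K h -> inner (fun t => f t - g t) h = 0.

(** In the next definitions [K] is a closed subspace of L^2, and an operator on
    [K] is given by its action on representatives: linearity and boundedness
    imply that it is compatible with equality almost everywhere. *)
Definition bounded_op (R : realType) (K : set (R -> R[i]))
    (T : (R -> R[i]) -> (R -> R[i])) : Prop :=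
  [/\ forall f, K f -> K (T f),
      forall (a : R[i]) f g, K f -> K g ->
        aeeq (T (fun t => a * f t + g t)) (fun t => a * T f t + T g t) &
      exists M : R, forall f, K f -> norm2 (T f) <= M * norm2 f].

Definition compact_op (R : realType) (K : set (R -> R[i]))
    (T : (R -> R[i]) -> (R -> R[i])) : Prop :=
  bounded_op K T /\
  forall f : nat -> R -> R[i],
    (forall n, K (f n)) -> (exists M : R, forall n, norm2 (f n) <= M) ->
    exists (k : nat -> nat) (g : R -> R[i]),
      [/\ {homo k : m n / (m < n)%N}, K g &
          (fun n => norm2 (fun t => T (f (k n)) t - g t)) @ \oo --> (0 : R)].

Definition is_adjoint (R : realType) (K : set (R -> R[i]))
    (T S : (R -> R[i]) -> (R -> R[i])) : Prop :=
  bounded_op K S /\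
  forall f g, K f -> K g -> inner (T f) g = inner f (S g).

(** [A = sqrt (T^* T)]; [0 <= z] on complex numbers says that [z] is real and
    nonnegative. *)
Definition is_abs_op (R : realType) (K : set (R -> R[i]))
    (T A : (R -> R[i]) -> (R -> R[i])) : Prop :=
  [/\ bounded_op K A,
      forall f, K f -> 0 <= inner (A f) f &
      exists2 S, is_adjoint K T S & forall f, K f -> aeeq (A (A f)) (S (T f))].

Definition op_eigenspace (R : realType) (K : set (R -> R[i]))
    (A : (R -> R[i]) -> (R -> R[i])) (l : R[i]) : set (R -> R[i]) :=
  [set f | K f /\ aeeq (A f) (fun t => l * f t)].

(** The dimension of [V] modulo equality almost everywhere is [d]. *)
Definition has_dim (R : realType) (V : set (R -> R[i])) (d : nat) : Prop :=
  exists e : 'I_d -> R -> R[i],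
    [/\ forall i, V (e i),
        forall c : 'I_d -> R[i],
          aeeq (fun t => \sum_(i < d) c i * e i t) (fun=> 0) ->
          forall i, c i = 0 &
        forall f, V f -> exists c : 'I_d -> R[i],
          aeeq f (fun t => \sum_(i < d) c i * e i t)].

(** [s] lists the eigenvalues of [sqrt (T^* T)], the nonzero ones being repeated
    according to multiplicity.  The order and the number of zero terms are left
    free, as they do not affect membership in l^p. *)
Definition singular_values (R : realType) (K : set (R -> R[i]))
    (T : (R -> R[i]) -> (R -> R[i])) (s : nat -> R) : Prop :=
  (forall n, 0 <= s n) /\
  exists2 A, is_abs_op K T A &
    forall l : R, 0 < l -> exists2 d : nat,
      has_dim (op_eigenspace K A l%:C) d & ([set n | s n = l] #= `I_d)%card.

Definition ellp (R : realType) (p : \bar R) (a : nat -> R) : Prop :=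
  match p with
  | r%:E => (\sum_(0 <= n <oo) (`|a n| `^ r)%:E < +oo)%E
  | +oo%E => exists M : R, forall n, `|a n| <= M
  | -oo%E => False
  end.

Definition schatten (R : realType) (p : \bar R) (K : set (R -> R[i]))
    (T : (R -> R[i]) -> (R -> R[i])) : Prop :=
  match p with
  | +oo%E => bounded_op K T
  | _ => compact_op K T /\ exists2 s, singular_values K T s & ellp p s
  end.

(** [T] extends the truncated Toeplitz operator [A_phi], given on the dense
    subspace [K_u] intersected with H^oo by [A_phi f = P_u (phi f)]. *)
Definition extends_tto (R : realType) (u phi : R -> R[i])
    (T : (R -> R[i]) -> (R -> R[i])) : Prop :=
  forall f, model_space u f -> Hinfty f ->
    is_proj (model_space u) (fun t => phi t * f t) (T f).

Definition tto_in_schatten (R : realType) (p : \bar R) (u phi : R -> R[i]) :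
    Prop :=
  exists2 T, extends_tto u phi T & schatten p (model_space u) T.

Definition tto_compact (R : realType) (u phi : R -> R[i]) : Prop :=
  exists2 T, extends_tto u phi T & compact_op (model_space u) T.

Definition blaschke_factor (R : realType) (a z : R[i]) : R[i] :=
  if a == 0 then z else `|a| / a * ((a - z) / (1 - conjc a * z)).

(** [u] is (the boundary function of) the Blaschke product with zeros [z n]. *)
Definition is_blaschke_product (R : realType) (u : R -> R[i])
    (z : nat -> R[i]) : Prop :=
  [/\ forall n, normc (z n) < 1,
      (\sum_(0 <= n <oo) (1 - normc (z n))%:E < +oo)%E,
      H2 u &
      forall w : R[i], normc w < 1 ->
        (fun N : nat => \prod_(0 <= n < N) blaschke_factor (z n) w : (R[i])^o)
          @ \oo --> (disk_ext u w : (R[i])^o)].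

Definition interpolating_seq (R : realType) (z : nat -> R[i]) : Prop :=
  (forall n, normc (z n) < 1) /\
  forall w : nat -> R[i], (exists M : R, forall n, normc (w n) <= M) ->
    exists2 f, Hinfty f & forall n, disk_ext f (z n) = w n.

Definition interpolating_blaschke (R : realType) (u : R -> R[i])
    (z : nat -> R[i]) : Prop :=
  [/\ is_blaschke_product u z, injective z & interpolating_seq z].

(* Main.v *)
(** Write [k_n] for the normalized reproducing kernel of [H^2] at [z_n].  By the
    reproducing property a bounded extension [T] of [A_phi] satisfies
    [<T f, k_n> = phi(z_n) <f, k_n>], so everything follows once the map
    [f |-> (<f, k_n>)_n] is an isomorphism of [K_u] onto [l^2].  It is injective
    because an [f] in [K_u] vanishing at all [z_n] is divisible by the partial
    products of [u], hence by [u] itself, which is unimodular since these partial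
    products converge to it in [L^2].  Interpolation by [psi] in [H^oo] shows that
    the diagonal operator with entries [conj (psi (z_n))] is bounded on the span
    of the [k_n]; by uniform boundedness, [(k_n)] is an unconditional basic
    sequence, and averaging over signs with the parallelogram identity gives both
    Riesz inequalities.

    In Riesz coordinates [T] is diagonal, which settles boundedness and
    compactness.  For the Schatten classes, singular values of [T] and the moduli
    [|phi(z_n)|] dominate each other up to a constant in the following sense: if
    [m] terms of one sequence are at least [l], then outside any [m - 1] indices
    the other one has a term at least [c l]. *)

Require Import Defs.
From HB Require Import structures.
From mathcomp Require Import all_boot all_order all_algebra.
From mathcomp Require Import complex.
From mathcomp Require Import all_classical all_reals all_analysis.
From mathcomp Require Import measurable_realfun ring lra.
Set Implicit Arguments.
Unset Strict Implicit.
Unset Printing Implicit Defensive.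
Import Order.TTheory GRing.Theory Num.Theory.
Import numFieldNormedType.Exports.
Import ComplexField.Normc.
Local Open Scope classical_set_scope.
Local Open Scope complex_scope.
Local Open Scope ring_scope.

(** Operators act on functions rather than on classes, so the Hilbert space arguments are carried
    out in a complete space with a possibly degenerate form, where an identity between vectors reads
    [hnorm ip (x - y) = 0]. Since [phi] may be unbounded, [A_phi] is prescribed only on the bounded
    elements of [K_u]. The kernels at the points [z n] are bounded and their span is dense, so a
    bounded extension is determined by its values on them; conversely an extension is built as a
    diagonal operator and then checked against [extends_tto]. Membership in a Schatten class
    involves a listing of the eigenvalues of the absolute value of [T]. When membership is assumed,
    the listing comes in no particular order, hence the comparison by counting; its constant
    [1 / (2 * K ^+ 2)] takes one factor [K] from each Riesz inequality, and the [2] makes an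
    inequality strict. When membership is to be proved, the absolute value and a listing have to be
    produced, which takes the spectral theorem for compact positive operators. *)

Lemma normr_normcE (R : realType) (x : R[i]) : `|x| = (normc x)%:C.
Proof. by []. Qed.

Lemma normc_ge0 (R : realType) (x : R[i]) : 0 <= normc x.
Proof. by case: x => a b; exact: sqrtr_ge0. Qed.

Lemma normc_conj (R : realType) (x : R[i]) : normc (conjc x) = normc x.
Proof. by case: x => a b /=; rewrite sqrrN. Qed.

Lemma sqr_normcE (R : realType) (x : R[i]) :
  normc x ^+ 2 = complex.Re x ^+ 2 + complex.Im x ^+ 2.
Proof. by case: x => a b /=; rewrite sqr_sqrtr // addr_ge0 // sqr_ge0. Qed.

Lemma mul_conjcE (R : realType) (x : R[i]) : x * conjc x = (normc x ^+ 2)%:C.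
Proof.
rewrite sqr_normcE; case: x => a b; apply/eqP; rewrite eq_complex /=.
by apply/andP; split; apply/eqP; ring.
Qed.

Lemma normc_real (R : realType) (a : R) : normc (a%:C) = `|a|.
Proof. by rewrite /= expr0n /= addr0 sqrtr_sqr. Qed.

Lemma normcX (R : realType) (x : R[i]) n : normc (x ^+ n) = normc x ^+ n.
Proof.
by elim: n => [|n IH]; [rewrite !expr0 normc1 | rewrite !exprS normcM IH].
Qed.

Lemma normc_eq0 (R : realType) (x : R[i]) : (normc x == 0) = (x == 0).
Proof.
by apply/eqP/eqP => [/eq0_normc|->] //; rewrite normc0.
Qed.

Lemma normc_gt0 (R : realType) (x : R[i]) : (0 < normc x) = (x != 0).
Proof. by rewrite lt_def normc_ge0 andbT normc_eq0. Qed.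

Lemma normc_distC (R : realType) (x y : R[i]) : normc (x - y) = normc (y - x).
Proof. by rewrite -normcN opprB. Qed.

Lemma Re_le_normc (R : realType) (x : R[i]) : complex.Re x <= normc x.
Proof.
have := sqr_normcE x; have := normc_ge0 x.
have := sqr_ge0 (complex.Im x).
move: (normc x) (complex.Re x) (complex.Im x) => n a b; nra.
Qed.

(** * Semi-inner product spaces *)

(* The form may be degenerate: functions that agree almost everywhere are not
   identified, so a vector of norm [0] need not vanish. *)
Record semi_ip (R : realType) (H : lmodType R[i]) (ip : H -> H -> R[i]) : Prop
  := SemiIp {
  ip_lin : forall (a : R[i]) f g h, ip (a *: f + g) h = a * ip f h + ip g h;
  ip_conj : forall f g, ip g f = conjc (ip f g);
  ip_pos : forall f, 0 <= ip f f }.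

Definition hnorm (R : realType) (H : lmodType R[i]) (ip : H -> H -> R[i]) (f : H)
  : R := Num.sqrt (complex.Re (ip f f)).

Definition hcvg (R : realType) (H : lmodType R[i]) (ip : H -> H -> R[i])
  (f : nat -> H) (g : H) :=
  forall e : R, 0 < e -> exists N, forall n, (N <= n)%N -> hnorm ip (f n - g) < e.

Definition hcauchy (R : realType) (H : lmodType R[i]) (ip : H -> H -> R[i])
  (f : nat -> H) :=
  forall e : R, 0 < e -> exists N, forall m n, (N <= m)%N -> (N <= n)%N ->
     hnorm ip (f m - f n) < e.

Definition hcomplete (R : realType) (H : lmodType R[i]) (ip : H -> H -> R[i])
  := forall f, hcauchy ip f -> exists g, hcvg ip f g.

Section SemiIp.
Variables (R : realType) (H : lmodType R[i]) (ip : H -> H -> R[i]).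
Hypothesis ipH : semi_ip ip.
Local Notation nrm := (hnorm ip).
Implicit Types (a : R[i]) (f g h : H).

Lemma ip0l h : ip 0 h = 0.
Proof.
by have := ip_lin ipH (-1) 0 0 h; rewrite scaler0 addr0 mulN1r addNr.
Qed.

Lemma ipDl f g h : ip (f + g) h = ip f h + ip g h.
Proof. by have := ip_lin ipH 1 f g h; rewrite scale1r mul1r. Qed.

Lemma ipZl a f h : ip (a *: f) h = a * ip f h.
Proof. by have := ip_lin ipH a f 0 h; rewrite !addr0 ip0l addr0. Qed.

Lemma ipNl f h : ip (- f) h = - ip f h.
Proof. by rewrite -scaleN1r ipZl mulN1r. Qed.

Lemma ipBl f g h : ip (f - g) h = ip f h - ip g h.
Proof. by rewrite ipDl ipNl. Qed.

Lemma ip0r h : ip h 0 = 0.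
Proof. by rewrite (ip_conj ipH) ip0l conjc0. Qed.

Lemma ipDr f g h : ip h (f + g) = ip h f + ip h g.
Proof. by rewrite (ip_conj ipH) ipDl rmorphD /= -!(ip_conj ipH). Qed.

Lemma ipZr a f h : ip h (a *: f) = conjc a * ip h f.
Proof. by rewrite (ip_conj ipH) ipZl rmorphM /= -!(ip_conj ipH). Qed.

Lemma ipNr f h : ip h (- f) = - ip h f.
Proof. by rewrite (ip_conj ipH) ipNl rmorphN /= -!(ip_conj ipH). Qed.

Lemma ipBr f g h : ip h (f - g) = ip h f - ip h g.
Proof. by rewrite ipDr ipNr. Qed.

Lemma ip_suml (I : Type) (s : seq I) (P : pred I) (F : I -> H) h :
  ip (\sum_(i <- s | P i) F i) h = \sum_(i <- s | P i) ip (F i) h.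
Proof.
by elim/big_rec2: _ => [|i x y _ <-]; rewrite ?ip0l ?ipDl.
Qed.

Lemma ip_sumr (I : Type) (s : seq I) (P : pred I) (F : I -> H) h :
  ip h (\sum_(i <- s | P i) F i) = \sum_(i <- s | P i) ip h (F i).
Proof.
by elim/big_rec2: _ => [|i x y _ <-]; rewrite ?ip0r ?ipDr.
Qed.

Lemma nrm_ge0 f : 0 <= nrm f.
Proof. exact: sqrtr_ge0. Qed.

Lemma ip_self f : ip f f = (nrm f ^+ 2)%:C.
Proof.
have := ip_pos ipH f; case E: (ip f f) => [a b]; rewrite lecE /= => /andP[/eqP -> a0].
by rewrite /hnorm E /= sqr_sqrtr.
Qed.

Lemma nrm_sqr f : nrm f ^+ 2 = complex.Re (ip f f).
Proof. by rewrite ip_self. Qed.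

Lemma nrm0 : nrm 0 = 0.
Proof. by rewrite /hnorm ip0l sqrtr0. Qed.

Lemma nrmZ a f : nrm (a *: f) = normc a * nrm f.
Proof.
apply/eqP; rewrite -(@eqrXn2 _ 2) ?mulr_ge0 ?nrm_ge0 ?normc_ge0 //.
rewrite nrm_sqr ipZl ipZr mulrA mul_conjcE ip_self exprMn /=; apply/eqP.
by ring.
Qed.

Lemma nrmN f : nrm (- f) = nrm f.
Proof. by rewrite -scaleN1r nrmZ normcN normc1 mul1r. Qed.

Lemma nrmC f g : nrm (f - g) = nrm (g - f).
Proof. by rewrite -nrmN opprB. Qed.

Lemma nrm_sqrD f g :
  nrm (f + g) ^+ 2 = nrm f ^+ 2 + nrm g ^+ 2 + 2 * complex.Re (ip f g).
Proof.
rewrite nrm_sqr ipDl !ipDr (ip_conj ipH f g) !ip_self.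
by case: (ip f g) => a b /=; ring.
Qed.

Lemma nrm_sqrB f g :
  nrm (f - g) ^+ 2 = nrm f ^+ 2 + nrm g ^+ 2 - 2 * complex.Re (ip f g).
Proof.
by rewrite nrm_sqrD nrmN ipNr; case: (ip f g) => a b /=; ring.
Qed.

Lemma parallelogram f g :
  nrm (f + g) ^+ 2 + nrm (f - g) ^+ 2 = 2 * nrm f ^+ 2 + 2 * nrm g ^+ 2.
Proof. by rewrite nrm_sqrD nrm_sqrB; ring. Qed.

Lemma Re_ip_le f g : complex.Re (ip f g) <= nrm f * nrm g.
Proof.
have nf := nrm_ge0 f; have ng := nrm_ge0 g.
have key : forall s t : R, 0 <= s ^+ 2 * nrm f ^+ 2 + t ^+ 2 * nrm g ^+ 2
    - 2 * (s * t * complex.Re (ip f g)).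
  move=> s t; have := sqr_ge0 (nrm (s%:C *: f - t%:C *: g)).
  rewrite nrm_sqrB !nrmZ !normc_real !exprMn !real_normK ?num_real // ipZl ipZr.
  by case: (ip f g) => a b /=; rewrite !(oppr0, mul0r, mulr0, subr0, addr0) !mulrA.
have [f0|f0] := eqVneq (nrm f) 0.
  rewrite f0 mul0r leNgt; apply/negP => p.
  (* A null [f] can be rescaled at no cost: for this [s] the inequality reads
     [0 <= |g|^2 - 2 |g|^2], so [g] is null too, and then [key 1 1] contradicts the positivity of
     the real part. *)
  have := key (nrm g ^+ 2 / complex.Re (ip f g)) 1; rewrite f0.
  have -> : nrm g ^+ 2 / complex.Re (ip f g) * 1 * complex.Re (ip f g) = nrm g ^+2.
    by field; rewrite gt_eqF.
  move=> h; have g0 : nrm g ^+ 2 = 0 by apply/eqP; rewrite eq_le sqr_ge0 andbT; lra.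
  by have := key 1 1; rewrite f0 g0; lra.
have fp : 0 < nrm f by rewrite lt_def f0.
have [g0|g0] := eqVneq (nrm g) 0.
  rewrite g0 mulr0 leNgt; apply/negP => p.
  have := key 1 (nrm f ^+ 2 / complex.Re (ip f g)); rewrite g0.
  have -> : 1 * (nrm f ^+ 2 / complex.Re (ip f g)) * complex.Re (ip f g) = nrm f ^+2.
    by field; rewrite gt_eqF.
  move=> h; have : 0 < nrm f ^+ 2 by rewrite exprn_gt0.
  by lra.
have gp : 0 < nrm g by rewrite lt_def g0.
have := key (nrm g) (nrm f); have p := mulr_gt0 fp gp.
have -> : nrm g ^+ 2 * nrm f ^+ 2 + nrm f ^+ 2 * nrm g ^+ 2
   - 2 * (nrm g * nrm f * complex.Re (ip f g))
  = 2 * ((nrm f * nrm g) * (nrm f * nrm g - complex.Re (ip f g))) by ring.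
by rewrite pmulr_rge0 // pmulr_rge0 // subr_ge0.
Qed.

(** Multiplying [f] by the conjugate of [ip f g] makes the inner product real and equal to its
    squared modulus, which reduces the claim to real parts. *)
Lemma cauchy_schwarz f g : normc (ip f g) <= nrm f * nrm g.
Proof.
have [e|e] := eqVneq (ip f g) 0.
  by rewrite e normc0 mulr_ge0 ?nrm_ge0.
have n0 : 0 < normc (ip f g) by rewrite normc_gt0.
have := Re_ip_le (conjc (ip f g) *: f) g.
rewrite ipZl mulrC mul_conjcE nrmZ normc_conj /= => h.
by rewrite -(ler_pM2l n0) -expr2 mulrA.
Qed.

Lemma nrmD f g : nrm (f + g) <= nrm f + nrm g.
Proof.
rewrite -(@ler_pXn2r _ 2) ?nnegrE ?addr_ge0 ?nrm_ge0 // nrm_sqrD sqrrD.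
have := Re_ip_le f g; lra.
Qed.

Lemma nrm_tri h f g : nrm (f - g) <= nrm (f - h) + nrm (h - g).
Proof. by apply: le_trans (nrmD _ _); rewrite addrA subrK. Qed.

Lemma nrm_leB f g : nrm f <= nrm g + nrm (f - g).
Proof. by have := nrmD g (f - g); rewrite addrCA subrr addr0. Qed.

Lemma ip_null f g : nrm f = 0 -> ip f g = 0.
Proof.
move=> f0; apply/eqP; rewrite -normc_eq0 eq_le normc_ge0 andbT.
by apply: le_trans (cauchy_schwarz _ _) _; rewrite f0 mul0r.
Qed.

Lemma nrm_null f : (forall g, ip f g = 0) -> nrm f = 0.
Proof. by move=> h; rewrite /hnorm h sqrtr0. Qed.

Lemma nrm_eq0_eq f g h : nrm (f - g) = 0 -> ip f h = ip g h.
Proof. by move=> /(ip_null h); rewrite ipBl => /eqP; rewrite subr_eq0 => /eqP. Qed.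

Lemma nrm_eq0_nrm f g : nrm (f - g) = 0 -> nrm f = nrm g.
Proof.
move=> e; apply/eqP; rewrite eq_le; apply/andP; split.
  by have := nrm_leB f g; rewrite e addr0.
by have := nrm_leB g f; rewrite nrmC e addr0.
Qed.

Lemma nrm_le_small f (M : R) : (forall e : R, 0 < e -> nrm f <= M + e) -> nrm f <= M.
Proof. by move=> h; apply/ler_addgt0Pr. Qed.

Lemma hcvg_ip f (u : nat -> H) g (e : R) : hcvg ip u f -> 0 < e ->
  exists N, forall n, (N <= n)%N -> normc (ip (u n) g - ip f g) < e.
Proof.
move=> uf e0; have g1 : 0 < nrm g + 1 by rewrite ltr_wpDl ?nrm_ge0.
have [N hN] := uf _ (divr_gt0 e0 g1); exists N => n /hN.
rewrite ltr_pdivlMr // -ipBl => h; apply: le_lt_trans (cauchy_schwarz _ _) _.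
by apply: le_lt_trans h; rewrite ler_wpM2l ?nrm_ge0 // lerDl.
Qed.

Lemma hcvg_cauchy (u : nat -> H) f : hcvg ip u f -> hcauchy ip u.
Proof.
move=> h e e0; have [N hN] := h (e / 2) (divr_gt0 e0 (ltr0Sn R 1)).
exists N => m n /hN a /hN b; apply: le_lt_trans (nrm_tri f _ _) _.
by rewrite (nrmC f); lra.
Qed.

Lemma hcvg_uniq (u : nat -> H) f g : hcvg ip u f -> hcvg ip u g -> nrm (f - g) = 0.
Proof.
move=> uf ug; apply/eqP; rewrite eq_le nrm_ge0 andbT.
apply: nrm_le_small => e e0; rewrite add0r.
have [N hN] := uf (e / 2) (divr_gt0 e0 (ltr0Sn R 1)).
have [M hM] := ug (e / 2) (divr_gt0 e0 (ltr0Sn R 1)).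
have a := hN _ (leq_maxl N M); have b := hM _ (leq_maxr N M).
apply: le_trans (nrm_tri (u (maxn N M)) _ _) _.
by rewrite (nrmC f); lra.
Qed.

Lemma hcvg_nrm (u : nat -> H) f (M : R) : hcvg ip u f ->
  (forall n, nrm (u n) <= M) -> nrm f <= M.
Proof.
move=> uf uM; apply: nrm_le_small => e e0; have [N hN] := uf _ e0.
have := hN _ (leqnn N); rewrite nrmC => a; have := nrm_leB f (u N).
by have := uM N; lra.
Qed.

End SemiIp.

(** * Convergence of real and complex sequences, with real radii *)

Definition ccvg (R : realType) (u : nat -> R[i]) (l : R[i]) :=
  forall e : R, 0 < e -> exists N, forall n, (N <= n)%N -> normc (u n - l) < e.

Definition rcvg (R : realType) (u : nat -> R) (l : R) :=
  forall e : R, 0 < e -> exists N, forall n, (N <= n)%N -> `|u n - l| < e.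

Lemma normc_le_ReIm (R : realType) (x : R[i]) :
  normc x <= `|complex.Re x| + `|complex.Im x|.
Proof.
rewrite -(@ler_pXn2r _ 2) ?nnegrE ?addr_ge0 ?normc_ge0 // sqr_normcE sqrrD.
rewrite !real_normK ?num_real //.
have : 0 <= `|complex.Re x| * `|complex.Im x| by rewrite mulr_ge0.
by move: (complex.Re x) (complex.Im x) => a b; lra.
Qed.

Lemma normr_Re_le (R : realType) (x : R[i]) : `|complex.Re x| <= normc x.
Proof.
rewrite -(@ler_pXn2r _ 2) ?nnegrE ?normc_ge0 // sqr_normcE.
by rewrite real_normK ?num_real // lerDl sqr_ge0.
Qed.

Lemma normr_Im_le (R : realType) (x : R[i]) : `|complex.Im x| <= normc x.
Proof.
rewrite -(@ler_pXn2r _ 2) ?nnegrE ?normc_ge0 // sqr_normcE.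
by rewrite real_normK ?num_real // lerDr sqr_ge0.
Qed.

Lemma rcvgP (R : realType) (u : nat -> R) (l : R) :
  (u @ \oo --> l) <-> rcvg u l.
Proof.
split=> [/cvgrPdist_lt h e e0|h].
  by have [N _ hN] := h e e0; exists N => n Nn; rewrite distrC; exact: hN.
apply/cvgrPdist_lt => e e0; have [N hN] := h e e0; exists N => // n Nn.
by rewrite distrC; exact: hN.
Qed.

Lemma ccvgP (R : realType) (u : nat -> R[i]) (l : R[i]) :
  ((u : nat -> (R[i])^o) @ \oo --> (l : (R[i])^o)) <-> ccvg u l.
Proof.
split=> [/cvgrPdist_lt h e e0|h].
  have e0' : 0 < e%:C :> R[i] by rewrite ltcR.
  have [N _ hN] := h _ e0'; exists N => n Nn; rewrite normc_distC.
  by have := hN n Nn; rewrite /= -[X in X < _]/((normc (l - u n))%:C) ltcR.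
apply/cvgrPdist_lt => -[e e']; rewrite ltcE /= => /andP[/eqP -> e0].
have [N hN] := h e e0; exists N => // n Nn /=.
rewrite -[X in X < _]/((normc (l - u n))%:C) ltcR normc_distC; exact: hN.
Qed.

Lemma real_cauchy_cvg (R : realType) (u : nat -> R) :
  (forall e : R, 0 < e -> exists N, forall m n, (N <= m)%N -> (N <= n)%N ->
     `|u m - u n| < e) ->
  exists l, rcvg u l.
Proof.
move=> h; have cu : cvg (u @ \oo).
  apply/cauchy_cvgP; apply: cauchy_exP => e e0; have [N hN] := h e e0.
  by exists (u N), N => // n Nn /=; apply: hN.
by exists (limn u); apply/rcvgP.
Qed.

Lemma complex_cauchy_cvg (R : realType) (u : nat -> R[i]) :
  (forall e : R, 0 < e -> exists N, forall m n, (N <= m)%N -> (N <= n)%N ->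
     normc (u m - u n) < e) ->
  exists l, ccvg u l.
Proof.
move=> h.
have [a ha] : exists l, rcvg (fun n => complex.Re (u n)) l.
  apply: real_cauchy_cvg => e e0; have [N hN] := h e e0; exists N => m n Nm Nn.
  apply: le_lt_trans (hN m n Nm Nn); rewrite -raddfB /=; exact: normr_Re_le.
have [b hb] : exists l, rcvg (fun n => complex.Im (u n)) l.
  apply: real_cauchy_cvg => e e0; have [N hN] := h e e0; exists N => m n Nm Nn.
  apply: le_lt_trans (hN m n Nm Nn); rewrite -raddfB /=; exact: normr_Im_le.
exists (a +i* b) => e e0; have e2 : 0 < e / 2 by lra.
have [N hN] := ha _ e2; have [M hM] := hb _ e2.
exists (maxn N M) => n; rewrite geq_max => /andP[/hN a1 /hM b1].
apply: le_lt_trans (normc_le_ReIm _) _; move: a1 b1.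
by case: (u n) => x y /=; lra.
Qed.

Lemma ccvg_normc_le (R : realType) (u : nat -> R[i]) (l a : R[i]) (M : R) N :
  ccvg u l -> (forall n, (N <= n)%N -> normc (u n - a) <= M) ->
  normc (l - a) <= M.
Proof.
move=> ul h; apply/ler_addgt0Pr => e e0; have [K hK] := ul e e0.
have h1 := hK _ (leq_maxl K N); have h2 := h _ (leq_maxr K N).
have -> : l - a = - (u (maxn K N) - l) + (u (maxn K N) - a) by ring.
by apply: le_trans (le_normcD _ _) _; rewrite normcN; lra.
Qed.

Lemma ccvg_uniq (R : realType) (u : nat -> R[i]) l m :
  ccvg u l -> ccvg u m -> l = m.
Proof.
by move=> /ccvgP ul /ccvgP um; exact: (cvg_unique _ ul um).
Qed.

(* [p] stands for the finitely supported sequence of its coefficients. *)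
Definition lincomb (R : realType) (H : lmodType R[i]) (e : nat -> H)
  (p : {poly R[i]}) : H := \sum_(i < size p) p`_i *: e i.

Section Lincomb.
Variables (R : realType) (H : lmodType R[i]).
Implicit Types (e : nat -> H) (p q : {poly R[i]}).

Lemma lincomb_widen n e p : (size p <= n)%N ->
  lincomb e p = \sum_(i < n) p`_i *: e i.
Proof.
move=> pn; rewrite /lincomb (big_ord_widen _ (fun i => p`_i *: e i) pn).
rewrite big_mkcond; apply: eq_bigr => i _; case: ifPn => //.
by rewrite -leqNgt => h; rewrite nth_default // scale0r.
Qed.

Lemma lincomb_lin e (a : R[i]) p q :
  lincomb e (a *: p + q) = a *: lincomb e p + lincomb e q.
Proof.
pose n := maxn (size (a *: p + q)) (maxn (size p) (size q)).
rewrite !(@lincomb_widen n) ?leq_max ?leqnn ?orbT // scaler_sumr -big_split /=.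
by apply: eq_bigr => i _; rewrite coefD coefZ scalerDl scalerA.
Qed.

End Lincomb.

Lemma inv_succ_small (R : realType) (e : R) : 0 < e ->
  exists N, forall n, (N <= n)%N -> n.+1%:R^-1 < e.
Proof.
by move=> e0; have [N _ hN] := near_infty_natSinv_lt (PosNum e0); exists N.
Qed.

(** * Riesz representation *)

Section Riesz.
Variables (R : realType) (H : lmodType R[i]) (ip : H -> H -> R[i]).
Hypotheses (ipH : semi_ip ip) (Hc : hcomplete ip).
Local Notation nrm := (hnorm ip).

(** For the vector [g] sought, [Q w = |J w|^2 - 2 Re (L w)] is [|J w - g|^2 - |g|^2], so a
    minimizing sequence of [Q] should converge to [g]. It is Cauchy by the parallelogram identity,
    and the first variation of [Q] at its limit shows that the limit represents [L]. The space [W]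
    is kept apart from [H] so that [L] can be given on a parametrization of a subspace, such as
    polynomials standing for finite linear combinations; the bound on [L] makes it independent of
    the parametrization, and [g] comes out as a limit of elements of the range of [J]. *)
Lemma riesz (W : lmodType R[i]) (J : W -> H) (L : W -> R[i]) (B : R) :
  (forall a v w, J (a *: v + w) = a *: J v + J w) ->
  (forall a v w, L (a *: v + w) = a * L v + L w) ->
  0 <= B -> (forall w, normc (L w) <= B * nrm (J w)) ->
  exists g, [/\ forall w, L w = ip (J w) g, nrm g <= B &
    exists w : nat -> W, hcvg ip (J \o w) g].
Proof.
move=> Jl Ll B0 LB.
pose Q w := nrm (J w) ^+ 2 - 2 * complex.Re (L w).
have Qge w : - B ^+ 2 <= Q w.
  rewrite /Q; have := Re_le_normc (L w); have := LB w.
  have := sqr_ge0 (nrm (J w) - B); nra.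
have hi : has_inf (range Q).
  split; first by exists (Q 0), 0.
  by exists (- B ^+ 2) => _ [w _ <-].
pose m := inf (range Q).
have mQ w : m <= Q w by apply: ge_inf; [case: hi | exists w].
have [w hw] : exists w : nat -> W, forall n, Q (w n) < m + n.+1%:R^-1.
  suff /choice[w hw] : forall n, exists v, Q v < m + n.+1%:R^-1 by exists w.
  move=> n; have n0 : 0 < (n.+1%:R^-1 : R) by rewrite invr_gt0 ltr0n.
  by have [_ [v _ <-] hv] := inf_adherent n0 hi; exists v.
have JD v w' : J (v + w') = J v + J w' by have := Jl 1 v w'; rewrite !scale1r.
have J0 : J 0 = 0 by apply: (addrI (J 0)); rewrite -JD !addr0.
have JZ a v : J (a *: v) = a *: J v by have := Jl a v 0; rewrite J0 !addr0.
have LD v w' : L (v + w') = L v + L w' by have := Ll 1 v w'; rewrite scale1r mul1r.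
have L0 : L 0 = 0 by apply: (addrI (L 0)); rewrite -LD !addr0.
have LZ a v : L (a *: v) = a * L v by have := Ll a v 0; rewrite L0 !addr0.
have JwC : hcauchy ip (J \o w).
  move=> e e0; have e40 : 0 < e ^+ 2 / 4 by rewrite divr_gt0 // exprn_gt0.
  have [N hN] := inv_succ_small e40; exists N => i j Ni Nj /=.
  rewrite -(@ltr_pXn2r _ 2) ?nnegrE ?nrm_ge0 ?(ltW e0) //.
  have := parallelogram ipH (J (w i)) (J (w j)).
  (* The midpoint cannot do better than the infimum [m], while both ends are within [1 / (n + 1)] of
     it; the parallelogram identity then bounds their distance. *)
  have := mQ ((2^-1 : R)%:C *: (w i + w j)).
  rewrite /Q JZ LZ (nrmZ ipH) normc_real JD LD exprMn real_normK ?num_real //.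
  have := hw i; have := hw j; have := hN i Ni; have := hN j Nj; rewrite /Q.
  have -> : (2^-1 : R) ^+ 2 = 4^-1 by field.
  move: (nrm (J (w i) + _) ^+ 2) (nrm (J (w i) - _) ^+ 2) => S1 S2.
  move: (i.+1%:R^-1) (j.+1%:R^-1) (e ^+ 2) => x y z.
  by case: (L (w i)) (L (w j)) => a b [c d] /=; rewrite ?mul0r; lra.
have [g Jwg] := Hc JwC.
have LRe v : complex.Re (L v) = complex.Re (ip (J v) g).
  pose D := complex.Re (ip (J v) g) - complex.Re (L v).
  have key (t : R) : 0 <= 2 * (t * D) + t ^+ 2 * nrm (J v) ^+ 2.
    apply/ler_addgt0Pr => e e0; have e2 : 0 < e / 2 by lra.
    have t0 : 0 < 2 * (`|t| + 1) by rewrite mulr_gt0 // ltr_wpDl.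
    have [N hN] := inv_succ_small e2.
    have [M hM] := hcvg_ip ipH (J v) Jwg (divr_gt0 e2 t0).
    pose n := maxn N M; have {}hN := hN n (leq_maxl _ _).
    have {}hM := hM n (leq_maxr _ _).
    have := mQ (w n + t%:C *: v); have := hw n.
    rewrite /Q JD JZ LD LZ (nrm_sqrD ipH) (nrmZ ipH) normc_real exprMn.
    rewrite real_normK ?num_real // (ipZr ipH) conjc_real.
    have hR : `|t * (complex.Re (ip (J (w n)) (J v)) - complex.Re (ip g (J v)))|
        <= e / 4.
      rewrite normrM -raddfB /=; have := normr_Re_le (ip (J (w n)) (J v) - ip g (J v)).
      move: hM; rewrite ltr_pdivlMr // /=.
      have := normr_ge0 t.
      have := normr_ge0 (complex.Re (ip (J (w n)) (J v) - ip g (J v))).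
      by nra.
    move: hR; rewrite ler_norml => /andP[hR1 hR2].
    rewrite /D (ip_conj ipH g) => h1 h2; move: hR1 hR2 h1 h2 hN.
    case: (L v) (L (w n)) (ip (J (w n)) (J v)) (ip g (J v)) => a b [c d] [a' b'] [c' d'] /=.
    move: (n.+1%:R^-1) (nrm (J (w n)) ^+ 2) (nrm (J v) ^+ 2) => x y z.
    rewrite !mul0r !subr0 !mulrBr !mulrDr => *.
    lra.
  have N0 := sqr_ge0 (nrm (J v)); set N := nrm (J v) ^+ 2 in key N0.
  have N1 : 0 < N + 1 by lra.
  (* A nonnegative quadratic in [t] without constant term has no linear term. Dividing by [N + 1]
     rather than [N] keeps the test point meaningful when [J v] is null. *)
  have := key (- D / (N + 1)).
  have -> : 2 * (- D / (N + 1) * D) + (- D / (N + 1)) ^+ 2 * N =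
      - (D ^+ 2 * ((N + 2) / (N + 1) ^+ 2)) by field; rewrite gt_eqF.
  rewrite oppr_ge0 pmulr_lle0; last first.
    by rewrite divr_gt0 ?exprn_gt0 //; lra.
  move=> h; have /eqP : D ^+ 2 = 0 by apply/eqP; rewrite eq_le h sqr_ge0.
  by rewrite sqrf_eq0 /D subr_eq0 => /eqP ->.
have LE v : L v = ip (J v) g.
  apply/eqP; rewrite eq_complex LRe eqxx /=; apply/eqP.
  have := LRe ('i *: v); rewrite LZ JZ (ipZl ipH).
  by case: (L v) (ip (J v) g) => a b [c d] /=; lra.
exists g; split => //; last by exists w.
have [->|g0] := eqVneq (nrm g) 0; first by [].
have gp : 0 < nrm g by rewrite lt_def g0 nrm_ge0.
(* [|g|^2] is compared with [ip (J (w N)) g], which is [L (w N)] and hence at most [B |J (w N)|],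
   for [J (w N)] close to [g]; dividing by [|g|] gives the bound up to [e]. *)
apply/ler_addgt0Pr => e e0.
have e1 : 0 < e * nrm g / (B + nrm g) by rewrite divr_gt0 ?mulr_gt0 // ltr_wpDl.
have [N hN] := Jwg _ e1; have {}hN := hN N (leqnn N).
rewrite -(ler_pM2r gp) -expr2 (nrm_sqr ipH).
have h1 := Re_le_normc (ip (J (w N)) g); have h2 := LB (w N).
rewrite LE in h2; have h3 := nrm_leB ipH (J (w N)) g.
have h4 : complex.Re (ip (g - J (w N)) g) <= nrm (J (w N) - g) * nrm g.
  by rewrite (nrmC ipH); exact: Re_ip_le.
have h5 : complex.Re (ip g g) = complex.Re (ip (g - J (w N)) g) + complex.Re (ip (J (w N)) g).
  by rewrite (ipBl ipH) -raddfD /= subrK.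
have h6 : nrm (J (w N) - g) * (B + nrm g) <= e * nrm g.
  by move: hN; rewrite /= ltr_pdivlMr ?ltr_wpDl // => /ltW.
rewrite h5 mulrDl; move: h1 h2 h3 h4 h6 => /=.
by nra.
Qed.

End Riesz.

(** * Riesz sequences *)

Section UniformBoundedness.
Variables (R : realType) (J : Type) (q : J -> (nat -> R[i]) -> R).
Hypothesis qD : forall j w v, q j (fun n => w n + v n) <= q j w + q j v.
Hypothesis qZ : forall j (r : R) w, q j (fun n => r%:C * w n) = `|r| * q j w.
Hypothesis qB : forall j, exists B : R, forall w,
  (forall n, normc (w n) <= 1) -> q j w <= B.
Hypothesis q_pointwise : forall w, (exists M : R, forall n, normc (w n) <= M) ->
  exists B : R, forall j, q j w <= B.

(* Sokal's short proof of the uniform boundedness principle. *)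
Lemma uniform_boundedness : exists M : R, forall j w,
  (forall n, normc (w n) <= 1) -> q j w <= M.
Proof.
apply: contrapT => /forallNP nb.
have q0 j w : 0 <= q j w.
  have := qD j w (fun n => (-1)%:C * w n); rewrite qZ normrN1 mul1r.
  have -> : (fun n => w n + (-1)%:C * w n) = (fun n => 0%:C * w n).
    by apply/funext => n; rewrite rmorphN1 mulN1r subrr mul0r.
  by rewrite qZ normr0 mul0r; lra.
pose S j := sup [set q j w | w in [set w | forall n, normc (w n) <= 1]].
have hS j : has_sup [set q j w | w in [set w | forall n, normc (w n) <= 1]].
  split; first by exists (q j (fun=> 0)), (fun=> 0) => // n; rewrite normc0.
  by have [B hB] := qB j; exists B => _ [w hw <-]; exact: hB.
have qS j w (r : R) : 0 < r -> (forall n, normc (w n) <= r) -> q j w <= r * S j.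
  move=> r0 hw; have -> : w = (fun n => r%:C * ((r^-1)%:C * w n)).
    by apply/funext => n; rewrite mulrA -rmorphM /= divff ?gt_eqF // mul1r.
  rewrite qZ gtr0_norm // ler_pM2l //; apply: ub_le_sup; first by case: (hS j).
  exists (fun n => r^-1%:C * w n) => //= n.
  by rewrite normcM normc_real gtr0_norm ?invr_gt0 // mulrC ler_pdivrMr // mul1r.
have /choice[jv hjv] : forall n : nat, exists jv : J * (nat -> R[i]),
    [/\ forall i, normc (jv.2 i) <= 1, n%:R * 3 ^+ n <= S jv.1 &
        2 / 3 * S jv.1 <= q jv.1 jv.2].
  move=> n; have /existsNP[j /existsNP[w /not_implyP[hw /negP]]] := nb (n.+1%:R * 3 ^+ n).
  rewrite -ltNge => hq; have Sj : n.+1%:R * 3 ^+ n < S j.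
    by apply: lt_le_trans hq _; apply: ub_le_sup; [case: (hS j)|exists w].
  have n3 : 0 <= 3 ^+ n :> R by rewrite exprn_ge0.
  have S0 : 0 < S j by apply: le_lt_trans Sj; rewrite mulr_ge0.
  have S3 : 0 < S j / 3 by rewrite divr_gt0.
  have [_ [v hv <-] hlt] := sup_adherent S3 (hS j).
  exists (j, v); split => //=; last by rewrite -/(S j) in hlt; lra.
  by apply: ltW; apply: le_lt_trans Sj; rewrite ler_wpM2r // ler_nat.
pose t n : R := 3^-1 ^+ n.
have t0 n : 0 < t n by rewrite exprn_gt0 // invr_gt0.
pose sg n (x : nat -> R[i]) (s : R) := fun i => x i + (s * t n)%:C * (jv n).2 i.
(* Since [2 y] is the difference of [x + y] and [x - y], one of the two signs satisfies
   [q y <= q (x + s y)]. The sign is recorded as a function of the pair [(n, x)] so that the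
   sequence can be defined by recursion. *)
have /choice[f hf] : forall nx : nat * (nat -> R[i]), exists s : R,
    `|s| = 1 /\ t nx.1 * q (jv nx.1).1 (jv nx.1).2 <= q (jv nx.1).1 (sg nx.1 nx.2 s).
  move=> [n x] /=; set j := (jv n).1; set v := (jv n).2.
  have : 2 * (t n * q j v) <= q j (sg n x 1) + q j (sg n x (-1)).
    have := qD j (sg n x 1) (fun i => (-1)%:C * sg n x (-1) i).
    have -> : (fun i => sg n x 1 i + (-1)%:C * sg n x (-1) i) =
              (fun i => (2 * t n)%:C * v i).
      apply/funext => i; rewrite /sg -/v mulN1r !rmorphM /= rmorphN1 mul1r.
      rewrite rmorph_nat; ring.
    by rewrite !qZ normrN1 mul1r normrM !ger0_norm // ?(ltW (t0 n)) // mulrA.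
  have [h1 h2|h1 h2] := leP (t n * q j v) (q j (sg n x 1)).
    by exists 1; rewrite normr1.
  by exists (-1); rewrite normrN1; split => //; lra.
pose x := fix x n := if n is m.+1 then sg m (x m) (f (m, x m)) else (fun=> 0 : R[i]).
have xS n i : normc (x n.+1 i - x n i) <= t n.
  rewrite /= /sg addrC addKr normcM normc_real normrM (hf (n, x n)).1 mul1r.
  rewrite gtr0_norm // -[leRHS]mulr1 ler_pM2l //; by case: (hjv n) => + _ _; exact.
have xB n m i : (n <= m)%N -> normc (x m i - x n i) <= 3 / 2 * t n.
  move=> nm; suff : normc (x m i - x n i) <= 3 / 2 * (t n - t m).
    by move=> h; apply: le_trans h _; have := t0 m; lra.
  rewrite -(subnKC nm); elim: (m - n)%N => [|k IH].
    by rewrite addn0 !subrr normc0 mulr0.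
  rewrite addnS; have := xS (n + k)%N i;
  have := le_normcD (x (n + k).+1 i - x (n + k)%N i) (x (n + k)%N i - x n i).
  rewrite addrA subrK => h1 h2; have -> : t (n + k).+1 = 3^-1 * t (n + k)%N.
    by rewrite /t exprS.
  by lra.
have /choice[xl hxl] : forall i, exists l, ccvg (fun n => x n i) l.
  move=> i; apply: complex_cauchy_cvg => e e0.
  have e3 : 0 < e / 3 by rewrite divr_gt0.
  have [N hN] : exists N, t N < e / 3.
    have /rcvgP/(_ _ e3)[N hN] : t @ \oo --> (0 : R).
      by apply: cvg_expr; rewrite gtr0_norm ?invr_gt0 // invf_lt1 // ltr1n.
    by exists N; have := hN N (leqnn N); rewrite subr0 gtr0_norm.
  exists N => m n Nm Nn; have := xB N m i Nm; have := xB N n i Nn.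
  have := le_normcD (x m i - x N i) (x N i - x n i); rewrite addrA subrK.
  by rewrite (normc_distC (x N i)); lra.
have hlt n i : normc (xl i - x n i) <= 3 / 2 * t n.
  by apply: (ccvg_normc_le (hxl i)) => m; exact: xB.
have [B hB] : exists B : R, forall j, q j xl <= B.
  apply: q_pointwise; exists (3 / 2) => i; have := hlt 0 i.
  by rewrite /t expr0 mulr1 /= subr0.
(* The [n]-th increment contributes at least [2/3 * t n * S], and all later ones together take away
   at most [3/2 * t n.+1 * S = 1/2 * t n * S]. What remains is [t n * S / 6], and
   [n * 3 ^+ n <= S]. *)
have key n : n%:R / 6 <= B.
  apply: le_trans (hB (jv n).1); have [_ h1 h2] := hjv n.
  have := (hf (n, x n)).2; rewrite -[sg _ _ _]/(x n.+1) /= -/(x n.+1) => h3.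
  have := qD (jv n).1 xl (fun i => (-1)%:C * (xl i - x n.+1 i)).
  have -> : (fun i => xl i + (-1)%:C * (xl i - x n.+1 i)) = x n.+1.
    by apply/funext => i; rewrite rmorphN1; ring.
  rewrite qZ normrN1 mul1r => h4.
  have := qS (jv n).1 (fun i => xl i - x n.+1 i) (3 / 2 * t n.+1).
  move=> /(_ _ (hlt n.+1)) h5; have {h5} : q (jv n).1 (fun i => xl i - x n.+1 i) <=
      3 / 2 * t n.+1 * S (jv n).1 by apply: h5; rewrite mulr_gt0 // divr_gt0.
  have -> : t n.+1 = 3^-1 * t n by rewrite /t exprS.
  have -> : 3 / 2 * (3^-1 * t n) * S (jv n).1 = 2^-1 * (t n * S (jv n).1) by field.
  move=> h5; have t3 : t n * 3 ^+ n = 1 by rewrite /t -exprMn mulVf // expr1n.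
  have h6 : t n * (n%:R * 3 ^+ n) <= t n * S (jv n).1 by rewrite ler_pM2l.
  have h7 : 2 / 3 * (t n * S (jv n).1) <= t n * q (jv n).1 (jv n).2.
    by rewrite mulrCA ler_pM2l.
  have h8 : t n * (n%:R * 3 ^+ n) = n%:R by rewrite mulrCA t3 mulr1.
  rewrite h8 in h6; move: h3 h4 h5 h6 h7.
  move: (q _ _) (q _ _) (q _ _) (q _ _) (n%:R) => a b c d e.
  lra.
have [N hN] : exists N, (N.+1%:R : R)^-1 < (6 * (`|B| + 1))^-1.
  have h : 0 < (6 * (`|B| + 1))^-1 by rewrite invr_gt0 mulr_gt0 // ltr_wpDl.
  by have [N hN] := inv_succ_small h; exists N; exact: hN.
have := key N.+1; move: hN; rewrite ltf_pV2 ?posrE ?ltr0n ?mulr_gt0 ?ltr_wpDl //.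
by have := ler_norm B; move: (N.+1%:R) => y; lra.
Qed.

End UniformBoundedness.

Section FiniteCauchySchwarz.
Variables (R : realType) (n : nat).

(** Entries from [n] on are ignored: the form is degenerate, as semi-inner products may be, and
    Cauchy-Schwarz for finite sums becomes an instance of the general one. *)
Lemma semi_ip_prefix : semi_ip (H := (nat -> R[i]))
  (fun v w => \sum_(i < n) v i * conjc (w i)).
Proof.
split=> [a f g h|f g|f].
- rewrite mulr_sumr -big_split /=; apply: eq_bigr => i _.
  by have -> : (a *: f + g) i = a * f i + g i by []; ring.
- rewrite rmorph_sum; apply: eq_bigr => i _.
  by rewrite rmorphM /= conjcK mulrC.
- by apply: sumr_ge0 => i _; exact: mulcJ_ge0.
Qed.

Lemma cauchy_schwarz_sum (v w : nat -> R[i]) :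
  normc (\sum_(i < n) v i * conjc (w i)) <=
  Num.sqrt (\sum_(i < n) normc (v i) ^+ 2) *
  Num.sqrt (\sum_(i < n) normc (w i) ^+ 2).
Proof.
have E (x : nat -> R[i]) : complex.Re (\sum_(i < n) x i * conjc (x i)) =
    \sum_(i < n) normc (x i) ^+ 2.
  by rewrite raddf_sum; apply: eq_bigr => i _; rewrite mul_conjcE.
by have := cauchy_schwarz semi_ip_prefix v w; rewrite /hnorm !E.
Qed.

End FiniteCauchySchwarz.

Section RieszSequence.
Variables (R : realType) (H : lmodType R[i]) (ip : H -> H -> R[i]).
Hypotheses (ipH : semi_ip ip) (Hc : hcomplete ip).
Local Notation nrm := (hnorm ip).
Variable e : nat -> H.

Section Unconditional.
Hypothesis e1 : forall n, nrm (e n) = 1.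
Variable M : R.
Hypothesis hM : forall n (c w : nat -> R[i]), (forall i, normc (w i) <= 1) ->
  nrm (\sum_(i < n) (w i * c i) *: e i) <= M * nrm (\sum_(i < n) c i *: e i).

(** The signs are chosen one at a time: of [|x + y|^2] and [|x - y|^2], one is at most their mean
    [|x|^2 + |y|^2], and the other, used in [signs_ge], is at least that mean. *)
Lemma signs_le n (c : nat -> R[i]) : exists2 s : nat -> R[i],
  (forall i, s i = 1 \/ s i = -1) &
  nrm (\sum_(i < n) (s i * c i) *: e i) ^+ 2 <= \sum_(i < n) normc (c i) ^+ 2.
Proof.
elim: n => [|n [s hs IH]].
  by exists (fun=> 1); [left | rewrite !big_ord0 (nrm0 ipH) expr0n].
set x := \sum_(i < n) _ *: _ in IH.
have hx (b : R[i]) : b = 1 \/ b = -1 -> exists2 s' : nat -> R[i],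
  (forall i, s' i = 1 \/ s' i = -1) &
    \sum_(i < n.+1) (s' i * c i) *: e i = x + (b * c n) *: e n.
  move=> hb; exists (fun i => if (i < n)%N then s i else b).
    by move=> i; case: ifP.
  rewrite big_ord_recr /= ltnn; congr (_ + _).
  by apply: eq_bigr => i _; rewrite ltn_ord.
have := parallelogram ipH x (c n *: e n).
rewrite (nrmZ ipH) e1 mulr1 big_ord_recr /= => hp.
have [h|h] := leP (nrm (x + c n *: e n) ^+ 2) (nrm x ^+ 2 + normc (c n) ^+ 2).
  have [s' s'1 es'] := hx 1 (or_introl erefl); exists s' => //.
  by rewrite es' mul1r; move: h IH; rewrite -/x; lra.
have [s' s'1 es'] := hx (-1) (or_intror erefl); exists s' => //.
rewrite es' mulN1r scaleNr; move: h IH; rewrite -/x; lra.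
Qed.

Lemma signs_ge n (c : nat -> R[i]) : exists2 s : nat -> R[i],
  (forall i, s i = 1 \/ s i = -1) &
  \sum_(i < n) normc (c i) ^+ 2 <= nrm (\sum_(i < n) (s i * c i) *: e i) ^+ 2.
Proof.
elim: n => [|n [s hs IH]].
  by exists (fun=> 1); [left | rewrite !big_ord0 (nrm0 ipH) expr0n].
set x := \sum_(i < n) _ *: _ in IH.
have hx (b : R[i]) : b = 1 \/ b = -1 -> exists2 s' : nat -> R[i],
  (forall i, s' i = 1 \/ s' i = -1) &
    \sum_(i < n.+1) (s' i * c i) *: e i = x + (b * c n) *: e n.
  move=> hb; exists (fun i => if (i < n)%N then s i else b).
    by move=> i; case: ifP.
  rewrite big_ord_recr /= ltnn; congr (_ + _).
  by apply: eq_bigr => i _; rewrite ltn_ord.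
have := parallelogram ipH x (c n *: e n).
rewrite (nrmZ ipH) e1 mulr1 big_ord_recr /= => hp.
have [h|h] := leP (nrm x ^+ 2 + normc (c n) ^+ 2) (nrm (x + c n *: e n) ^+ 2).
  have [s' s'1 es'] := hx 1 (or_introl erefl); exists s' => //.
  by rewrite es' mul1r; move: h IH; rewrite -/x; lra.
have [s' s'1 es'] := hx (-1) (or_intror erefl); exists s' => //.
rewrite es' mulN1r scaleNr; move: h IH; rewrite -/x; lra.
Qed.

Let sign_norm (s : nat -> R[i]) : (forall i, s i = 1 \/ s i = -1) ->
  (forall i, normc (s i) <= 1) /\ (forall i, s i * s i = 1).
Proof.
move=> hs; split=> i; case: (hs i) => ->.
- by rewrite normc1.
- by rewrite normcN normc1.
- by rewrite mulr1.
- by rewrite mulrNN mulr1.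
Qed.

(** Signs are their own inverses, so multiplying by them once more leads from the signed sum of
    [signs_le] back to the original one at the cost of a factor [M]. The lower bound goes the other
    way, from the original sum to the signed sum of [signs_ge]. *)
Lemma unconditional_upper n (c : nat -> R[i]) :
  nrm (\sum_(i < n) c i *: e i) ^+ 2 <= M ^+ 2 * \sum_(i < n) normc (c i) ^+ 2.
Proof.
have [s hs hle] := signs_le n c; have [s1 ss] := sign_norm hs.
apply: le_trans (_ : M ^+ 2 * nrm (\sum_(i < n) (s i * c i) *: e i) ^+ 2 <= _); last first.
  by rewrite ler_wpM2l // sqr_ge0.
rewrite -exprMn; have := hM n (fun i => s i * c i) s1.
have -> : \sum_(i < n) (s i * (s i * c i)) *: e i = \sum_(i < n) c i *: e i.
  by apply: eq_bigr => i _; rewrite mulrA ss mul1r.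
move=> h; have nn := nrm_ge0 ip (\sum_(i < n) c i *: e i).
by rewrite ler_pXn2r // nnegrE // (le_trans nn).
Qed.

Lemma unconditional_lower n (c : nat -> R[i]) :
  \sum_(i < n) normc (c i) ^+ 2 <= M ^+ 2 * nrm (\sum_(i < n) c i *: e i) ^+ 2.
Proof.
have [s hs hle] := signs_ge n c; have [s1 ss] := sign_norm hs.
apply: le_trans hle _.
rewrite -exprMn; have h := hM n c s1.
have nn := nrm_ge0 ip (\sum_(i < n) (s i * c i) *: e i).
by rewrite ler_pXn2r // nnegrE // (le_trans nn).
Qed.

End Unconditional.

Variable K : R.
Hypothesis K0 : 0 < K.
Hypothesis upper : forall n (c : nat -> R[i]),
  nrm (\sum_(i < n) c i *: e i) ^+ 2 <= K ^+ 2 * \sum_(i < n) normc (c i) ^+ 2.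
Hypothesis lower : forall n (c : nat -> R[i]),
  \sum_(i < n) normc (c i) ^+ 2 <= K ^+ 2 * nrm (\sum_(i < n) c i *: e i) ^+ 2.
Hypothesis total : forall f, (forall n, ip f (e n) = 0) -> nrm f = 0.

(** This is the dual form of the upper inequality. For [g] the sum of the [ip f (e i) *: e i], the
    left-hand side [S] equals [ip f g], so [S <= |f| |g|], while [|g|^2 <= K ^+ 2 * S]. *)
Lemma coord_bessel f N :
  \sum_(i < N) normc (ip f (e i)) ^+ 2 <= K ^+ 2 * nrm f ^+ 2.
Proof.
set S := \sum_(i < N) _.
have S0 : 0 <= S by apply: sumr_ge0 => i _; exact: sqr_ge0.
pose g := \sum_(i < N) ip f (e i) *: e i.
have fg : ip f g = S%:C.
  rewrite (ip_sumr ipH) rmorph_sum; apply: eq_bigr => i _.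
  by rewrite (ipZr ipH) mulrC mul_conjcE.
have h1 : S <= nrm f * nrm g by have := Re_ip_le ipH f g; rewrite fg.
have h2 := upper N (fun i => ip f (e i)); rewrite -/g -/S in h2.
have [->|Sn0] := eqVneq S 0; first by rewrite mulr_ge0 // sqr_ge0.
have Sp : 0 < S by rewrite lt_def Sn0.
rewrite -(ler_pM2r Sp); apply: le_trans (_ : nrm f ^+ 2 * nrm g ^+ 2 <= _).
  by rewrite -exprMn -expr2 ler_pXn2r // nnegrE ?mulr_ge0 ?nrm_ge0.
have -> : K ^+ 2 * nrm f ^+ 2 * S = nrm f ^+ 2 * (K ^+ 2 * S) by ring.
by apply: ler_wpM2l; rewrite ?sqr_ge0.
Qed.

(** A moment problem: the functional sending [e i] to the conjugate of [c i] is bounded on finite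
    combinations by Cauchy-Schwarz and the lower inequality, and the vector representing it has the
    prescribed coordinates. *)
Lemma coord_surj (c : nat -> R[i]) (B : R) : 0 <= B ->
  (forall N, \sum_(i < N) normc (c i) ^+ 2 <= B ^+ 2) ->
  exists g, [/\ forall n, ip g (e n) = c n, nrm g <= K * B &
    exists p : nat -> {poly R[i]}, hcvg ip (fun n => lincomb e (p n)) g].
Proof.
move=> B0 hB; pose L := lincomb (H := R[i]) (fun i => conjc (c i)).
have LJ p : normc (L p) <= K * B * nrm (lincomb e p).
  apply: le_trans (cauchy_schwarz_sum (size p) (fun i => p`_i) c) _.
  rewrite mulrAC; apply: ler_pM; rewrite ?sqrtr_ge0 //.
    apply: le_trans (ler_wsqrtr (lower _ _)) _.
    by rewrite -exprMn sqrtr_sqr ger0_norm // mulr_ge0 ?nrm_ge0 // ltW.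
  by apply: le_trans (ler_wsqrtr (hB _)) _; rewrite sqrtr_sqr ger0_norm.
have [g [h1 h2 h3]] := riesz ipH Hc (lincomb_lin e)
  (lincomb_lin (H := R[i]) (fun i => conjc (c i))) (mulr_ge0 (ltW K0) B0) LJ.
exists g; split => // n; rewrite (ip_conj ipH).
have := h1 'X^n; rewrite /L.
have l1 (V : lmodType R[i]) (v : nat -> V) : lincomb v 'X^n = v n.
  rewrite (@lincomb_widen _ _ n.+1) ?size_polyXn // big_ord_recr /= big1 => [|i _].
    by rewrite coefXn eqxx scale1r add0r.
  by rewrite coefXn (ltn_eqF (ltn_ord i)) scale0r.
by rewrite !l1 => <-; rewrite conjcK.
Qed.

(** The moment problem is solved for the coordinates of [f] itself; by totality the solution differs
    from [f] by a null vector, so [f] inherits its norm bound and its approximation by finite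
    combinations. *)
Lemma coord_lower_dense f (B : R) : 0 <= B ->
  (forall N, \sum_(i < N) normc (ip f (e i)) ^+ 2 <= B ^+ 2) ->
  nrm f <= K * B /\
  exists p : nat -> {poly R[i]}, hcvg ip (fun n => lincomb e (p n)) f.
Proof.
move=> B0 hB; have [g [h1 h2 [p hp]]] := @coord_surj (fun i => ip f (e i)) B B0 hB.
have fg : nrm (f - g) = 0 by apply: total => n; rewrite (ipBl ipH) h1 subrr.
split; first by rewrite (nrm_eq0_nrm ipH fg).
exists p => d d0; have [N hN] := hp d d0; exists N => n Nn.
apply: le_lt_trans (nrm_tri ipH g _ _) _.
by rewrite (nrmC ipH g) fg addr0; exact: hN.
Qed.

Lemma coord_dense f :
  exists p : nat -> {poly R[i]}, hcvg ip (fun n => lincomb e (p n)) f.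
Proof.
have KB : 0 <= K * nrm f by rewrite mulr_ge0 ?nrm_ge0 // ltW.
have [] // := coord_lower_dense (f := f) KB => N; rewrite exprMn.
exact: coord_bessel.
Qed.

End RieszSequence.

(** * Diagonal operators in Riesz coordinates *)

Definition hcompact (R : realType) (H : lmodType R[i]) (ip : H -> H -> R[i])
    (T : H -> H) :=
  forall f : nat -> H, (exists M : R, forall n, hnorm ip (f n) <= M) ->
  exists (k : nat -> nat) (g : H),
    {homo k : m n / (m < n)%N} /\ hcvg ip (fun n => T (f (k n))) g.

Section RieszCoordinates.
Variables (R : realType) (H : lmodType R[i]) (ip : H -> H -> R[i]).
Hypotheses (ipH : semi_ip ip) (Hc : hcomplete ip).
Local Notation nrm := (hnorm ip).
Variables (e : nat -> H) (K : R).
Hypothesis K0 : 0 < K.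
Hypothesis coord_le : forall f N,
  \sum_(i < N) normc (ip f (e i)) ^+ 2 <= K ^+ 2 * nrm f ^+ 2.
Hypothesis coord_ge : forall f (B : R), 0 <= B ->
  (forall N, \sum_(i < N) normc (ip f (e i)) ^+ 2 <= B ^+ 2) -> nrm f <= K * B.
Hypothesis coord_ex : forall (c : nat -> R[i]) (B : R), 0 <= B ->
  (forall N, \sum_(i < N) normc (c i) ^+ 2 <= B ^+ 2) ->
  exists g, forall n, ip g (e n) = c n.

Lemma coord_null f : (forall n, ip f (e n) = 0) -> nrm f = 0.
Proof.
move=> h; apply/eqP; rewrite eq_le nrm_ge0 andbT -(mulr0 K).
apply: coord_ge => // N; rewrite big1 ?expr0n // => i _.
by rewrite h normc0 expr0n.
Qed.

Lemma coord1_le f n : normc (ip f (e n)) <= K * nrm f.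
Proof.
have h := coord_le f n.+1; rewrite big_ord_recr /= in h.
rewrite -(@ler_pXn2r _ 2) ?nnegrE ?normc_ge0 ?mulr_ge0 ?nrm_ge0 ?(ltW K0) //.
rewrite exprMn; apply: le_trans h; rewrite lerDr.
by apply: sumr_ge0 => i _; exact: sqr_ge0.
Qed.

(** These biorthogonal vectors are bounded uniformly in [n], which makes them the test vectors that
    read off single diagonal entries. *)
Lemma dual_vector n : exists f, [/\ nrm f <= K, ip f (e n) = 1 &
  forall m, m != n -> ip f (e m) = 0].
Proof.
pose c m : R[i] := if m == n then 1 else 0.
have hc N : \sum_(i < N) normc (c i) ^+ 2 <= 1 ^+ 2.
  rewrite expr1n; apply: le_trans (_ : \sum_(i < N) (i == n :> nat)%:R <= _).
    apply: ler_sum => i _; rewrite /c; case: eqP => _; rewrite ?normc1 ?normc0.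
      by rewrite expr1n.
    by rewrite expr0n.
  have [nN|Nn] := ltnP n N.
    rewrite (bigD1 (Ordinal nN)) //= eqxx big1 ?addr0 // => i.
    by rewrite -val_eqE /= => /negPf ->.
  rewrite big1 // => i _; rewrite ltn_eqF //; exact: leq_trans (ltn_ord i) Nn.
have [g hg] := coord_ex ler01 hc; exists g; split.
- by rewrite -(mulr1 K); apply: coord_ge => // N; under eq_bigr do rewrite hg.
- by rewrite hg /c eqxx.
- by move=> m /negPf mn; rewrite hg /c mn.
Qed.

Variable d : nat -> R[i].

Lemma multiplier_ex (M : R) : (forall n, normc (d n) <= M) ->
  exists T : H -> H, forall f n, ip (T f) (e n) = d n * ip f (e n).
Proof.
move=> dM; have M0 : 0 <= M := le_trans (normc_ge0 _) (dM 0%N).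
suff /choice[T hT] : forall f, exists g, forall n, ip g (e n) = d n * ip f (e n).
  by exists T.
move=> f; apply: (coord_ex (B := M * (K * nrm f))).
  by rewrite !mulr_ge0 ?nrm_ge0 // ltW.
move=> N; rewrite exprMn; apply: le_trans (_ : M ^+ 2 * \sum_(i < N) normc (ip f (e i)) ^+ 2 <= _).
  rewrite mulr_sumr; apply: ler_sum => i _; rewrite normcM exprMn.
  by rewrite ler_wpM2r ?sqr_ge0 // ler_pXn2r // nnegrE // normc_ge0.
by rewrite ler_wpM2l ?sqr_ge0 // exprMn.
Qed.

Variable T : H -> H.
Hypothesis hT : forall f n, ip (T f) (e n) = d n * ip f (e n).

Lemma multiplier_lin (a : R[i]) f g : nrm (T (a *: f + g) - (a *: T f + T g)) = 0.
Proof.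
apply: coord_null => n; rewrite (ipBl ipH) (ip_lin ipH) !hT (ip_lin ipH).
by ring.
Qed.

(** The coordinates before [m] and those from [m] on are bounded separately. With [m = 0] this gives
    boundedness; with [m] large and small heads it gives compactness. *)
Lemma multiplier_tail_le f (B M : R) m : 0 <= B -> 0 <= M ->
  (forall n, (m <= n)%N -> normc (d n) <= B) ->
  (forall n, (n < m)%N -> normc (d n * ip f (e n)) <= M) ->
  nrm (T f) ^+ 2 <= K ^+ 2 * (m%:R * M ^+ 2 + (B * K * nrm f) ^+ 2).
Proof.
move=> B0 M0 dB hM; set X := _ + _.
have X0 : 0 <= X by rewrite addr_ge0 ?sqr_ge0 // mulr_ge0 ?sqr_ge0.
suff h : nrm (T f) <= K * Num.sqrt X.
  rewrite -(sqr_sqrtr X0) -exprMn ler_pXn2r // nnegrE ?nrm_ge0 //.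
  by rewrite mulr_ge0 ?sqrtr_ge0 // ltW.
apply: coord_ge; rewrite ?sqrtr_ge0 // => N; rewrite sqr_sqrtr // /X.
have -> : m%:R * M ^+ 2 = \sum_(i < m) M ^+ 2.
  by rewrite big_const_ord iter_addr addr0 mulr_natl.
apply: le_trans (_ : \sum_(i < N) (if (i < m)%N then M ^+ 2 else 0) +
   B ^+ 2 * \sum_(i < N) normc (ip f (e i)) ^+ 2 <= _).
  rewrite mulr_sumr -big_split /=; apply: ler_sum => i _; rewrite hT.
  case: ifPn => im.
    apply: ler_wpDr; first by rewrite mulr_ge0 ?sqr_ge0.
    by rewrite ler_pXn2r ?nnegrE ?normc_ge0 // hM.
  rewrite add0r normcM exprMn ler_wpM2r ?sqr_ge0 //.
  by rewrite ler_pXn2r ?nnegrE ?normc_ge0 // dB // leqNgt.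
apply: lerD; last first.
  by rewrite -mulrA exprMn ler_wpM2l ?sqr_ge0 // exprMn.
have [Nm|mN] := leqP N m.
  rewrite (big_ord_widen m (fun i => if (i < m)%N then M ^+ 2 else 0) Nm).
  rewrite big_mkcond; apply: ler_sum => i _; rewrite ltn_ord.
  by case: ifP; rewrite ?sqr_ge0.
rewrite (big_ord_widen N (fun=> M ^+ 2) (ltnW mN)).
by rewrite [leRHS]big_mkcond.
Qed.

Lemma multiplier_bounded (M : R) : 0 <= M -> (forall n, normc (d n) <= M) ->
  forall f, nrm (T f) <= K * M * K * nrm f.
Proof.
move=> M0 dM f; have h := multiplier_tail_le (f := f) (m := 0) M0 M0.
rewrite -(@ler_pXn2r _ 2) ?nnegrE ?mulr_ge0 ?nrm_ge0 ?(ltW K0) //.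
apply: le_trans (h _ _) _ => //.
by rewrite mul0r add0r -exprMn !mulrA.
Qed.

Lemma bounded_multiplier (M : R) : (forall f, nrm (T f) <= M * nrm f) ->
  exists B, forall n, normc (d n) <= B.
Proof.
move=> hM; exists (K * (`|M| * K)) => n; have [f [f1 f2 _]] := dual_vector n.
have := coord1_le (T f) n; rewrite hT f2 mulr1 => h; apply: le_trans h _.
rewrite ler_wpM2l ?(ltW K0) //; apply: le_trans (hM f) _.
apply: le_trans (_ : `|M| * nrm f <= _).
  by rewrite ler_wpM2r ?nrm_ge0 // ler_norm.
by rewrite ler_wpM2l.
Qed.

(** If [eps <= |d n|] for infinitely many [n], the images of the dual vectors at these indices stay
    at distance at least [eps / K] from each other. *)
Lemma compact_multiplier : hcompact ip T -> ccvg d 0.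
Proof.
move=> Tc; apply: contrapT => /existsNP[eps /not_implyP[eps0 /forallNP hd]].
have /choice[ph hph] : forall N, exists n, (N <= n)%N /\ eps <= normc (d n).
  move=> N; have /existsNP[n /not_implyP[Nn /negP]] := hd N.
  by rewrite subr0 -leNgt => h; exists n.
have /choice[f hf] := fun j => dual_vector (ph j).
have [|k [g [kh kg]]] := Tc f; first by exists K => n; case: (hf n).
have eK : 0 < eps / K by rewrite divr_gt0.
have [N hN] := hcvg_cauchy ipH kg eK.
have kge n : (n <= k n)%N.
  by elim: n => // n IH; apply: leq_ltn_trans IH _; apply: kh.
(* Far enough for the index [ph (k j)] to exceed [ph (k N)], so that the dual vector at [ph (k j)]
   has zero coordinate at [ph (k N)]. *)
pose j := maxn N (ph (k N)).+1.
have jN : (ph (k N) < ph (k j))%N.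
  apply: leq_trans (hph _).1; apply: leq_trans (kge _); exact: leq_maxr.
have := hN N j (leqnn N) (leq_maxl _ _); rewrite ltr_pdivlMr // => hlt.
have := coord1_le (T (f (k N)) - T (f (k j))) (ph (k N)).
rewrite (ipBl ipH) !hT; case: (hf (k N)) => _ -> _; case: (hf (k j)) => _ _ ->.
  by rewrite mulr0 subr0 mulr1 => h; have := (hph (k N)).2; lra.
by rewrite ltn_eqF.
Qed.

End RieszCoordinates.

(** * Extraction of subsequences along an ultrafilter *)

Section UltraExtraction.
Variables (R : realType) (U : set_system nat).
Hypotheses (UU : UltraFilter U) (Uoo : \oo `<=` U).

Lemma ultra_real_cvg (u : nat -> R) (M : R) : (forall n, `|u n| <= M) ->
  exists l, forall e : R, 0 < e -> U [set n | `|u n - l| < e].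
Proof.
move=> uM; have UP : ProperFilter U by exact: ultra_proper.
have UF : Filter U by exact: filter_filter.
have hU : U [set n | u n \in `[- M, M]].
  apply: (@filterS _ U UF setT) (@filterT _ U UF) => n _ /=.
  by rewrite in_itv /= -ler_norml.
have PF : ProperFilter (u @ U) by exact: fmap_proper_filter.
have [l [_ cl]] := @segment_compact R (- M) M (u @ U) PF hU; exists l => e e0.
have [//|/=] := in_ultra_setVsetC [set n | `|u n - l| < e] UU.
move=> h; have : (u @ U) [set x | ~ `|x - l| < e] by exact: (@filterS _ U UF _ _ _ h).
move=> /cl/(_ (nbhsx_ballx l e e0))[x [/= h1]].
by rewrite -ball_normE /= distrC.
Qed.

Lemma ultra_complex_cvg (u : nat -> R[i]) (M : R) : (forall n, normc (u n) <= M) ->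
  exists l, forall e : R, 0 < e -> U [set n | normc (u n - l) < e].
Proof.
move=> uM.
have [a ha] := ultra_real_cvg (fun n => le_trans (normr_Re_le _) (uM n)).
have [b hb] := ultra_real_cvg (fun n => le_trans (normr_Im_le _) (uM n)).
exists (a +i* b) => e e0; have e2 : 0 < e / 2 by lra.
apply: filterS (filterI (ha _ e2) (hb _ e2)) => n [/= h1 h2].
apply: le_lt_trans (normc_le_ReIm _) _; move: h1 h2.
by case: (u n) => x y /=; lra.
Qed.

(** Finite intersections of the [S i] belong to [U], hence meet every tail of the integers, and
    points can be picked in increasing order. This replaces a diagonal argument. *)
Lemma ultra_extraction (S : nat -> set nat) : (forall m, U (S m)) ->
  exists k : nat -> nat, {homo k : m n / (m < n)%N} /\
    forall m i, (i <= m)%N -> S i (k m).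
Proof.
move=> US; have US' m : U [set n | forall i, (i <= m)%N -> S i n].
  elim: m => [|m IH].
    by apply: filterS (US 0%N) => n Sn i; rewrite leqn0 => /eqP ->.
  apply: filterS (filterI IH (US m.+1)) => n [h1 h2] i.
  by rewrite leq_eqVlt => /orP[/eqP -> //|]; rewrite ltnS; exact: h1.
have /choice[p hp] : forall mk : nat * nat, exists n,
    (mk.2 < n)%N /\ forall i, (i <= mk.1)%N -> S i n.
  move=> [m k] /=; have Uk : U [set n | (k < n)%N] by apply: Uoo; exists k.+1.
  by have [n [h1 h2]] := filter_ex (filterI Uk (US' m)); exists n.
pose k := fix k m := if m is m'.+1 then p (m, k m') else p (0, 0)%N.
exists k; split; last by case=> [|m]; exact: (hp (_, _)).2.
by apply: homo_ltn; [exact: ltn_trans | move=> m; exact: (hp (_, _)).1].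
Qed.

End UltraExtraction.

Section CompactMultiplier.
Variables (R : realType) (H : lmodType R[i]) (ip : H -> H -> R[i]).
Hypotheses (ipH : semi_ip ip) (Hc : hcomplete ip).
Local Notation nrm := (hnorm ip).
Variables (e : nat -> H) (K : R).
Hypothesis K0 : 0 < K.
Hypothesis coord_le : forall f N,
  \sum_(i < N) normc (ip f (e i)) ^+ 2 <= K ^+ 2 * nrm f ^+ 2.
Hypothesis coord_ge : forall f (B : R), 0 <= B ->
  (forall N, \sum_(i < N) normc (ip f (e i)) ^+ 2 <= B ^+ 2) -> nrm f <= K * B.
Variables (d : nat -> R[i]) (T : H -> H).
Hypothesis hT : forall f n, ip (T f) (e n) = d n * ip f (e n).

Lemma multiplier_sub f g : nrm (T f - T g) = nrm (T (f - g)).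
Proof.
apply: (nrm_eq0_nrm ipH); apply: (coord_null coord_ge) => n.
by rewrite !(ipBl ipH) !hT (ipBl ipH); ring.
Qed.

(** Along an ultrafilter all coordinates of the bounded sequence converge at once. On a suitable
    member of the ultrafilter the finitely many coordinates with large [|d n|] are nearly constant,
    and the others are damped by [d], so the images there lie within [eps] of each other. *)
Lemma multiplier_compact : ccvg d 0 -> hcompact ip T.
Proof.
move=> d0 f [M0 hM0]; pose M := `|M0| + 1.
have Mp : 0 < M by rewrite ltr_wpDl.
have hM n : nrm (f n) <= M.
  by apply: le_trans (hM0 n) _; apply: le_trans (ler_norm _) _; rewrite lerDl.
have [U [UU Uoo]] := ultraFilterLemma (F := \oo).
have /choice[c hc] : forall n, exists l, forall e' : R, 0 < e' ->
    U [set j | normc (ip (f j) (e n) - l) < e'].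
  move=> n; apply: (ultra_complex_cvg UU (M := K * M)) => j.
  by apply: le_trans (coord1_le K0 coord_le _ _) _; rewrite ler_wpM2l // ltW.
suff key (eps : R) : 0 < eps -> exists2 S, U S &
    forall i j, S i -> S j -> nrm (T (f i) - T (f j)) < eps.
  have /choice[S hS] : forall m : nat, exists S, U S /\
      forall i j, S i -> S j -> nrm (T (f i) - T (f j)) < m.+1%:R^-1.
    move=> m; have [|S US hS] := key m.+1%:R^-1; last by exists S.
    by rewrite invr_gt0 ltr0n.
  have [k [kh kS]] := ultra_extraction UU Uoo (fun m => (hS m).1).
  have [g hg] : exists g, hcvg ip (fun n => T (f (k n))) g.
    apply: Hc => eps eps0; have [N hN] := inv_succ_small eps0.
    exists N => m n Nm Nn; apply: lt_trans (hN N (leqnn N)).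
    by apply: (hS N).2; apply: kS.
  by exists k, g.
(* [B] and [M'] are chosen so that tail and head each contribute at most [(eps / (2 * K)) ^+ 2];
   times [K ^+ 2] they add up to [eps ^+ 2 / 2]. *)
move=> eps0; pose B := eps / (2 * K * K * (2 * M)).
have Bp : 0 < B by rewrite divr_gt0 // !mulr_gt0.
have [m hm] := d0 B Bp.
pose M' := eps / (2 * K * m.+1%:R).
have M'p : 0 < M' by rewrite divr_gt0 // !mulr_gt0 // ltr0n.
pose D := \sum_(i < m) normc (d i).
have D0 : 0 <= D by apply: sumr_ge0 => i _; exact: normc_ge0.
pose dl := M' / (2 * (D + 1)).
have dlp : 0 < dl by rewrite divr_gt0 // mulr_gt0 // ltr_wpDl.
exists [set j | forall n : 'I_m, normc (ip (f j) (e n) - c n) < dl].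
  by apply: filter_forall => n; exact: hc.
move=> i j Si Sj; rewrite multiplier_sub.
have tail n : (m <= n)%N -> normc (d n) <= B.
  by move=> mn; have := hm n mn; rewrite subr0 => /ltW.
have head n : (n < m)%N -> normc (d n * ip (f i - f j) (e n)) <= M'.
  move=> nm.
  rewrite normcM (ipBl ipH).
  have dD : normc (d n) <= D.
    rewrite /D (bigD1 (Ordinal nm)) //= lerDl.
    by apply: sumr_ge0 => l _; exact: normc_ge0.
  have -> : ip (f i) (e n) - ip (f j) (e n) =
    (ip (f i) (e n) - c n) - (ip (f j) (e n) - c n) by ring.
  apply: le_trans (_ : D * (dl + dl) <= _).
    apply: ler_pM; rewrite ?normc_ge0 //.
    apply: le_trans (le_normcD _ _) _; rewrite normcN.
    by apply: ltW; apply: ltrD; [exact: (Si (Ordinal nm)) | exact: (Sj (Ordinal nm))].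
  have -> : dl + dl = M' / (D + 1) by rewrite /dl; field; rewrite gt_eqF // ltr_wpDl.
  rewrite mulrCA ler_piMr ?(ltW M'p) // ler_pdivrMr ?ltr_wpDl //.
  by rewrite mul1r lerDl.
have h := multiplier_tail_le K0 coord_le coord_ge hT (ltW Bp) (ltW M'p) tail head.
rewrite -(@ltr_pXn2r _ 2) ?nnegrE ?nrm_ge0 ?(ltW eps0) //.
apply: le_lt_trans h _.
have hf : nrm (f i - f j) <= 2 * M.
  by have := nrmD ipH (f i) (- f j); rewrite (nrmN ipH); have := hM i; have := hM j; lra.
have h1 : (B * K * nrm (f i - f j)) ^+ 2 <= (eps / (2 * K)) ^+ 2.
  rewrite ler_pXn2r ?nnegrE ?mulr_ge0 ?nrm_ge0 ?invr_ge0 ?mulr_ge0 ?(ltW Bp)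
    ?(ltW K0) ?(ltW eps0) ?(ltW Mp) //.
  apply: le_trans (_ : B * K * (2 * M) <= _).
    by rewrite ler_wpM2l // mulr_ge0 ?(ltW Bp) ?(ltW K0).
  rewrite le_eqVlt; apply/orP; left; apply/eqP; rewrite /B; field.
  by rewrite !gt_eqF.
have h2 : m%:R * M' ^+ 2 <= (eps / (2 * K)) ^+ 2.
  have -> : M' ^+ 2 = (eps / (2 * K)) ^+ 2 * (m.+1%:R^-1) ^+ 2.
    rewrite -exprMn /M'; congr (_ ^+ 2).
    have r0 : 0 < (m.+1%:R : R) by rewrite ltr0n.
    by move: (m.+1%:R) r0 => r r0; field; rewrite !gt_eqF.
  rewrite mulrCA ler_piMr ?sqr_ge0 //.
  rewrite expr2 mulrA; apply: mulr_ile1; rewrite ?invr_ge0 ?ler0n ?mulr_ge0 ?invr_ge0 ?ler0n //.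
    by rewrite ler_pdivrMr ?ltr0n // mul1r ler_nat.
  by rewrite invf_le1 ?ltr0n // ler1n.
have -> : eps ^+ 2 = K ^+ 2 * (4 * (eps / (2 * K)) ^+ 2) by field; rewrite gt_eqF.
rewrite ltr_pM2l ?exprn_gt0 //.
have : 0 < (eps / (2 * K)) ^+ 2 by rewrite exprn_gt0 // divr_gt0 // mulr_gt0.
by lra.
Qed.

End CompactMultiplier.

(** * The space L^2 of the circle *)

Definition subspace (R : realType) (V : lmodType R[i]) (K : set V) :=
  K 0 /\ forall (a : R[i]) f g, K f -> K g -> K (a *: f + g).

Section Subspace.
Variables (R : realType) (V : lmodType R[i]) (K : set V) (hK : subspace K).

(* [hK] is kept as a parameter so that the module structure can be inferred. *)
Definition subspace_type : Type := let _ := hK in {f : V | K f}.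

HB.instance Definition _ := gen_eqMixin subspace_type.
HB.instance Definition _ := gen_choiceMixin subspace_type.

Definition subspace_val (x : subspace_type) : V := proj1_sig x.

Lemma subspace_valP (x : subspace_type) : K (subspace_val x).
Proof. exact: (proj2_sig x). Qed.

Lemma subspace_val_inj (x y : subspace_type) :
  subspace_val x = subspace_val y -> x = y.
Proof.
case: x y => [x hx] [y hy] /= xy; case: _ / xy in hy *.
by congr exist; exact: Prop_irrelevance.
Qed.

Let K0 : K 0. Proof. by case: hK. Qed.
Let KD f g : K f -> K g -> K (f + g).
Proof. by move=> Kf Kg; case: hK => _ /(_ 1 f g Kf Kg); rewrite scale1r. Qed.
Let KZ a f : K f -> K (a *: f).
Proof. by move=> Kf; case: hK => _ /(_ a f 0 Kf K0); rewrite addr0. Qed.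
Let KN f : K f -> K (- f).
Proof. by move=> Kf; rewrite -scaleN1r; exact: KZ. Qed.

Definition subspace_zero : subspace_type := exist _ 0 K0.
Definition subspace_add (x y : subspace_type) : subspace_type :=
  exist _ (subspace_val x + subspace_val y)
    (KD (subspace_valP x) (subspace_valP y)).
Definition subspace_opp (x : subspace_type) : subspace_type :=
  exist _ (- subspace_val x) (KN (subspace_valP x)).
Definition subspace_scale (a : R[i]) (x : subspace_type) : subspace_type :=
  exist _ (a *: subspace_val x) (KZ a (subspace_valP x)).

Let addA : associative subspace_add.
Proof. by move=> x y z; apply: subspace_val_inj; exact: addrA. Qed.
Let addC : commutative subspace_add.
Proof. by move=> x y; apply: subspace_val_inj; exact: addrC. Qed.
Let add0 : left_id subspace_zero subspace_add.
Proof. by move=> x; apply: subspace_val_inj; exact: add0r. Qed.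
Let addN : left_inverse subspace_zero subspace_opp subspace_add.
Proof. by move=> x; apply: subspace_val_inj; exact: addNr. Qed.

HB.instance Definition _ :=
  GRing.isZmodule.Build subspace_type addA addC add0 addN.

Let scaleA a b x : subspace_scale a (subspace_scale b x) = subspace_scale (a * b) x.
Proof. by apply: subspace_val_inj; exact: scalerA. Qed.
Let scale1 : left_id 1 subspace_scale.
Proof. by move=> x; apply: subspace_val_inj; exact: scale1r. Qed.
Let scaleDr : right_distributive subspace_scale +%R.
Proof. by move=> a x y; apply: subspace_val_inj; exact: scalerDr. Qed.
Let scaleDl x : {morph subspace_scale^~ x : a b / a + b}.
Proof. by move=> a b; apply: subspace_val_inj; exact: scalerDl. Qed.

HB.instance Definition _ := GRing.Zmodule_isLmodule.Build R[i] subspace_type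
  scaleA scale1 scaleDr scaleDl.

Lemma subspace_valD (x y : subspace_type) :
  subspace_val (x + y) = subspace_val x + subspace_val y.
Proof. by []. Qed.

Lemma subspace_valZ a (x : subspace_type) :
  subspace_val (a *: x) = a *: subspace_val x.
Proof. by []. Qed.

Definition subspace_ip (ip : V -> V -> R[i]) (x y : subspace_type) : R[i] :=
  ip (subspace_val x) (subspace_val y).

End Subspace.

(** * Integrals of complex functions of the angle *)

Section ComplexIntegral.
Variable R : realType.
Local Notation mu := (@lebesgue_measure R).
Local Notation A := (angles R : set (measurableTypeR R)).
Implicit Types (f g h : R -> R[i]).

Lemma measurable_angles : measurable A.
Proof. exact: measurable_itv. Qed.

Definition cmeas f := measurable_fun A (fun t => complex.Re (f t)) /\
  measurable_fun A (fun t => complex.Im (f t)).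

Definition cint f :=
  mu.-integrable A (fun t => (complex.Re (f t))%:E) /\
  mu.-integrable A (fun t => (complex.Im (f t))%:E).

Lemma complex_ReD (x y : R[i]) : complex.Re (x + y) = complex.Re x + complex.Re y.
Proof. by case: x y => a b [c d]. Qed.
Lemma complex_ImD (x y : R[i]) : complex.Im (x + y) = complex.Im x + complex.Im y.
Proof. by case: x y => a b [c d]. Qed.
Lemma complex_ReM (x y : R[i]) : complex.Re (x * y) =
  complex.Re x * complex.Re y - complex.Im x * complex.Im y.
Proof. by case: x y => a b [c d]. Qed.
Lemma complex_ImM (x y : R[i]) : complex.Im (x * y) =
  complex.Re x * complex.Im y + complex.Im x * complex.Re y.
Proof. by case: x y => a b [c d]. Qed.
Lemma Re_conj (x : R[i]) : complex.Re (conjc x) = complex.Re x.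
Proof. by case: x. Qed.
Lemma Im_conj (x : R[i]) : complex.Im (conjc x) = - complex.Im x.
Proof. by case: x. Qed.

Lemma cmeasD f g : cmeas f -> cmeas g -> cmeas (fun t => f t + g t).
Proof.
move=> [f1 f2] [g1 g2]; split.
  by under eq_fun do rewrite complex_ReD; exact: measurable_funD.
by under eq_fun do rewrite complex_ImD; exact: measurable_funD.
Qed.

Lemma cmeasM f g : cmeas f -> cmeas g -> cmeas (fun t => f t * g t).
Proof.
move=> [f1 f2] [g1 g2]; split.
  under eq_fun do rewrite complex_ReM.
  by apply: measurable_funB; exact: measurable_funM.
under eq_fun do rewrite complex_ImM.
by apply: measurable_funD; exact: measurable_funM.
Qed.

Lemma cmeas_cst (a : R[i]) : cmeas (fun=> a).
Proof. by split; exact: measurable_cst. Qed.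

Lemma cmeas_conj f : cmeas f -> cmeas (fun t => conjc (f t)).
Proof.
move=> [f1 f2]; split; first by under eq_fun do rewrite Re_conj.
by under eq_fun do rewrite Im_conj; exact: measurableT_comp.
Qed.

Lemma cmeas_normc_sqr f : cmeas f -> measurable_fun A (fun t => normc (f t) ^+ 2).
Proof.
move=> [f1 f2]; under eq_fun do rewrite sqr_normcE.
by apply: measurable_funD; exact: measurable_funX.
Qed.

Lemma cint_dominated f (g : R -> R) : cmeas f ->
  mu.-integrable A (EFin \o g) -> (forall t, A t -> normc (f t) <= g t) -> cint f.
Proof.
move=> [f1 f2] ig fg; split; apply: (le_integrable measurable_angles _ _ ig).
- exact/measurable_EFinP.
- move=> t At /=; rewrite lee_fin; apply: le_trans (normr_Re_le _) _.
  by apply: le_trans (fg t At) _; exact: ler_norm.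
- exact/measurable_EFinP.
- move=> t At /=; rewrite lee_fin; apply: le_trans (normr_Im_le _) _.
  by apply: le_trans (fg t At) _; exact: ler_norm.
Qed.

Lemma meanD f g : cint f -> cint g ->
  mean (fun t => f t + g t) = mean f + mean g.
Proof.
move=> [f1 f2] [g1 g2]; apply/eqP; rewrite eq_complex /= -!mulrDr.
apply/andP; split; apply/eqP; congr (_ * _).
  under eq_Rintegral do rewrite complex_ReD.
  exact: (RintegralD measurable_angles f1 g1).
under eq_Rintegral do rewrite complex_ImD.
exact: (RintegralD measurable_angles f2 g2).
Qed.

Lemma cintZ (a : R[i]) f : cint f -> cint (fun t => a * f t).
Proof.
move=> [f1 f2]; split.
  under eq_fun do rewrite complex_ReM EFinB !EFinM.
  by apply: (integrableB measurable_angles); exact: (integrableZl measurable_angles).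
under eq_fun do rewrite complex_ImM EFinD !EFinM.
by apply: (integrableD measurable_angles); exact: (integrableZl measurable_angles).
Qed.

Lemma meanZ (a : R[i]) f : cint f -> mean (fun t => a * f t) = a * mean f.
Proof.
move=> [f1 f2]; have mA := @measurable_angles.
have i1 (r : R) : mu.-integrable A (EFin \o (fun t => r * complex.Re (f t))).
  by apply: (integrableZl mA r f1).
have i2 (r : R) : mu.-integrable A (EFin \o (fun t => r * complex.Im (f t))).
  by apply: (integrableZl mA r f2).
case: a => a b; apply/eqP; rewrite eq_complex /=; apply/andP; split; apply/eqP.
  under eq_Rintegral do rewrite complex_ReM.
  by rewrite (RintegralB mA (i1 _) (i2 _)) !RintegralZl //=; ring.
under eq_Rintegral do rewrite complex_ImM.
by rewrite (RintegralD mA (i2 _) (i1 _)) !RintegralZl //=; ring.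
Qed.

Lemma mean_conj f : cint f -> mean (fun t => conjc (f t)) = conjc (mean f).
Proof.
move=> [f1 f2]; apply/eqP; rewrite eq_complex /=; apply/andP; split; apply/eqP.
  by under eq_Rintegral do rewrite Re_conj.
under eq_Rintegral do rewrite Im_conj -mulN1r.
by rewrite (RintegralZl _ measurable_angles f2) mulN1r mulrN.
Qed.

Lemma ae_on_circleW (P : R -> Prop) : (forall t, P t) -> ae_on_circle P.
Proof. by move=> h; apply: aeW => t _. Qed.

Let ae_filter : Filter (almost_everywhere mu).
Proof. exact: ae_filter_ringOfSetsType. Qed.

Lemma ae_on_circleS (P Q : R -> Prop) : (forall t, P t -> Q t) ->
  ae_on_circle P -> ae_on_circle Q.
Proof.
by move=> PQ; apply: (@filterS _ _ ae_filter) => t h At; exact: PQ (h At).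
Qed.

Lemma ae_on_circleI (P Q : R -> Prop) : ae_on_circle P -> ae_on_circle Q ->
  ae_on_circle (fun t => P t /\ Q t).
Proof.
move=> hP hQ; apply: (@filterS2 _ _ ae_filter _ _ _ _ hP hQ) => t h1 h2 At.
by split; [exact: h1 | exact: h2].
Qed.

Lemma mean_ae f g : cmeas f -> cmeas g -> aeeq f g -> mean f = mean g.
Proof.
move=> [f1 f2] [g1 g2] fg; rewrite /mean /Rintegral; congr ((_ * fine _) +i* (_ * fine _)).
  apply: ae_eq_integral measurable_angles _ _ _; try exact/measurable_EFinP.
  by apply: (@filterS _ _ ae_filter _ _ _ fg) => t h At; rewrite h.
apply: ae_eq_integral measurable_angles _ _ _; try exact/measurable_EFinP.
by apply: (@filterS _ _ ae_filter _ _ _ fg) => t h At; rewrite h.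
Qed.

End ComplexIntegral.

Section L2Space.
Variable R : realType.
Local Notation mu := (@lebesgue_measure R).
Local Notation A := (angles R : set (measurableTypeR R)).
Implicit Types (f g h : R -> R[i]).

Lemma L2_cmeas f : L2 f -> cmeas f.
Proof. by case. Qed.

Lemma L2P f : L2 f <->
  cmeas f /\ mu.-integrable A (fun t => (normc (f t) ^+ 2)%:E).
Proof.
split=> [[f1 f2 f3]|[[f1 f2] /integrableP[f3 f4]]].
  split=> //; apply/integrableP; split.
    by apply/measurable_EFinP; exact: cmeas_normc_sqr.
  by under eq_integral do rewrite gee0_abs ?lee_fin ?sqr_ge0 //.
split=> //; move: f4.
by under eq_integral do rewrite gee0_abs ?lee_fin ?sqr_ge0 //.
Qed.

Lemma L2_dominated f (g : R -> R) : cmeas f -> mu.-integrable A (EFin \o g) ->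
  (forall t, A t -> normc (f t) ^+ 2 <= g t) -> L2 f.
Proof.
move=> mf ig fg; apply/L2P; split => //.
apply: (le_integrable (@measurable_angles R) _ _ ig).
  by apply/measurable_EFinP; exact: cmeas_normc_sqr.
move=> t At /=; rewrite lee_fin ger0_norm ?sqr_ge0 //.
by apply: le_trans (fg t At) _; exact: ler_norm.
Qed.

Lemma L2_lin (a : R[i]) f g : L2 f -> L2 g -> L2 (fun t => a * f t + g t).
Proof.
move=> /L2P[mf if2] /L2P[mg ig2].
have mA := (@measurable_angles R).
apply: (@L2_dominated _ (fun t => (2 * normc a ^+ 2) * normc (f t) ^+ 2
   + 2 * normc (g t) ^+ 2)).
- by apply: cmeasD => //; apply: cmeasM => //; exact: cmeas_cst.
- exact: (integrableD mA (integrableZl mA (2 * normc a ^+ 2) if2) (integrableZl mA 2 ig2)).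
- move=> t _; have := le_normcD (a * f t) (g t); rewrite normcM.
  have := normc_ge0 (a * f t + g t).
  have -> : 2 * normc a ^+ 2 * normc (f t) ^+ 2 = 2 * (normc a * normc (f t)) ^+ 2.
    by ring.
  by have := sqr_ge0 (normc a * normc (f t) - normc (g t)); nra.
Qed.

Lemma L2_0 : L2 (fun=> 0 : R[i]).
Proof.
apply: (@L2_dominated _ (fun=> 0)); first exact: cmeas_cst.
  exact: integrable0.
by move=> t _; rewrite normc0 expr0n.
Qed.

Lemma subspace_L2 : subspace (@L2 R : set (R -> R[i])).
Proof. by split; [exact: L2_0 | exact: L2_lin]. Qed.

Lemma L2_conj f : L2 f -> L2 (fun t => conjc (f t)).
Proof.
move=> /L2P[mf if2]; apply/L2P; split; first exact: cmeas_conj.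
by under eq_fun do rewrite normc_conj.
Qed.

Lemma L2_mul_bounded (M : R) f g : L2 f -> cmeas g ->
  (forall t, normc (g t) <= M) -> L2 (fun t => f t * g t).
Proof.
move=> /L2P[mf if2] mg gM.
apply: (@L2_dominated _ (fun t => M ^+ 2 * normc (f t) ^+ 2)).
- exact: cmeasM.
- exact: (integrableZl (@measurable_angles R) (M ^+ 2) if2).
- move=> t _; rewrite normcM exprMn mulrC ler_wpM2r ?sqr_ge0 //.
  by rewrite ler_pXn2r ?nnegrE ?normc_ge0 // (le_trans (normc_ge0 (g t))).
Qed.

Lemma L2_ae f g : cmeas f -> aeeq f g -> L2 g -> L2 f.
Proof.
move=> mf fg Lg; have mg := L2_cmeas Lg; case: Lg => g1 g2 g3; split; try by case: mf.
apply: le_lt_trans g3; rewrite le_eqVlt; apply/orP; left; apply/eqP.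
apply: (@ae_eq_integral _ _ _ mu A) (@measurable_angles R) _ _ _.
- by apply/measurable_EFinP; exact: cmeas_normc_sqr.
- by apply/measurable_EFinP; exact: cmeas_normc_sqr.
- by apply: (@ae_on_circleS _ (fun t => f t = g t)) fg => t ->.
Qed.

Lemma cint_mul f g : L2 f -> L2 g -> cint (fun t => f t * g t).
Proof.
move=> /L2P[mf if2] /L2P[mg ig2].
apply: (@cint_dominated _ _ (fun t => normc (f t) ^+ 2 + normc (g t) ^+ 2)).
- exact: cmeasM.
- exact: (integrableD (@measurable_angles R) if2 ig2).
- move=> t _; rewrite normcM.
  have := sqr_ge0 (normc (f t) - normc (g t)).
  by have := sqr_ge0 (normc (f t)); have := sqr_ge0 (normc (g t)); nra.
Qed.

Lemma cint_inner f g : L2 f -> L2 g -> cint (fun t => f t * conjc (g t)).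
Proof. by move=> Lf Lg; apply: cint_mul => //; exact: L2_conj. Qed.

Lemma inner_lin (a : R[i]) f g h : L2 f -> L2 g -> L2 h ->
  inner (fun t => a * f t + g t) h = a * inner f h + inner g h.
Proof.
move=> Lf Lg Lh; rewrite /inner -(meanZ a (cint_inner Lf Lh)).
rewrite -(meanD (cintZ a (cint_inner Lf Lh)) (cint_inner Lg Lh)).
by congr mean; apply/funext => t; rewrite mulrDl mulrA.
Qed.

Lemma inner_conj f g : L2 f -> L2 g -> inner g f = conjc (inner f g).
Proof.
move=> Lf Lg; rewrite /inner -(mean_conj (cint_inner Lf Lg)).
by congr mean; apply/funext => t; rewrite rmorphM /= conjcK mulrC.
Qed.

Lemma pi2_gt0 : 0 < 2 * pi :> R.
Proof. by rewrite mulr_gt0 // pi_gt0. Qed.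

Lemma inner_self f :
  inner f f = ((2 * pi)^-1 * \int[mu]_(t in A) (normc (f t) ^+ 2))%:C.
Proof.
rewrite /inner /mean; apply/eqP; rewrite eq_complex /=; apply/andP; split; apply/eqP.
  by congr (_ * _); apply: eq_Rintegral => t _; rewrite mul_conjcE.
rewrite (_ : \int[mu]_(t in A) _ = 0) ?mulr0 //.
rewrite -[RHS](@Rintegral_set0 _ _ _ mu (fun=> 0)) /Rintegral; congr fine.
rewrite integral_set0; apply: integral0_eq => t _.
by rewrite mul_conjcE.
Qed.

Lemma norm2_sqrE f : norm2 f ^+ 2 = (2 * pi)^-1 * \int[mu]_(t in A) (normc (f t) ^+ 2).
Proof.
rewrite /norm2 inner_self /= sqr_sqrtr // mulr_ge0 //.
  by rewrite invr_ge0 ltW // pi2_gt0.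
by apply: Rintegral_ge0 => t _; exact: sqr_ge0.
Qed.

Lemma inner_ge0 f : 0 <= inner f f.
Proof.
rewrite inner_self ler0c mulr_ge0 //; first by rewrite invr_ge0 ltW // pi2_gt0.
by apply: Rintegral_ge0 => t _; exact: sqr_ge0.
Qed.

Lemma semi_ip_inner (K : set (R -> R[i])) (hK : subspace K) : K `<=` @L2 R ->
  semi_ip (subspace_ip (hK := hK) (@inner R)).
Proof.
move=> KL; split=> [a f g h|f g|f]; rewrite /subspace_ip.
- by apply: inner_lin; apply: KL; exact: subspace_valP.
- by apply: inner_conj; apply: KL; exact: subspace_valP.
- exact: inner_ge0.
Qed.

Definition inL2 f (Lf : L2 f) : subspace_type subspace_L2 := exist _ f Lf.

(** Operations on functions are pointwise and [inL2] only attaches a proof, so the general facts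
    about semi-inner products are convertible to statements about functions; several of the
    following lemmas are obtained in this way. *)
Definition ipL2 := semi_ip_inner subspace_L2 (fun f Lf => Lf).

Lemma norm2_ge0 f : 0 <= norm2 f.
Proof. exact: sqrtr_ge0. Qed.

Lemma inner_CS f g : L2 f -> L2 g -> normc (inner f g) <= norm2 f * norm2 g.
Proof. by move=> Lf Lg; exact: (cauchy_schwarz ipL2 (inL2 Lf) (inL2 Lg)). Qed.

Lemma innerB f g h : L2 f -> L2 g -> L2 h ->
  inner (fun t => f t - g t) h = inner f h - inner g h.
Proof. by move=> Lf Lg Lh; exact: (ipBl ipL2 (inL2 Lf) (inL2 Lg) (inL2 Lh)). Qed.

Lemma innerBr f g h : L2 f -> L2 g -> L2 h ->
  inner h (fun t => f t - g t) = inner h f - inner h g.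
Proof. by move=> Lf Lg Lh; exact: (ipBr ipL2 (inL2 Lf) (inL2 Lg) (inL2 Lh)). Qed.

Lemma innerZr (a : R[i]) f h : L2 f -> L2 h ->
  inner h (fun t => a * f t) = conjc a * inner h f.
Proof. by move=> Lf Lh; exact: (ipZr ipL2 a (inL2 Lf) (inL2 Lh)). Qed.

Lemma L2D f g : L2 f -> L2 g -> L2 (fun t => f t + g t).
Proof. by move=> Lf Lg; exact: (subspace_valP (inL2 Lf + inL2 Lg)). Qed.

Lemma L2B f g : L2 f -> L2 g -> L2 (fun t => f t - g t).
Proof. by move=> Lf Lg; exact: (subspace_valP (inL2 Lf - inL2 Lg)). Qed.

Lemma norm2_tri h f g : L2 f -> L2 g -> L2 h ->
  norm2 (fun t => f t - g t) <=
  norm2 (fun t => f t - h t) + norm2 (fun t => h t - g t).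
Proof. by move=> Lf Lg Lh; exact: (nrm_tri ipL2 (inL2 Lh) (inL2 Lf) (inL2 Lg)). Qed.

Lemma norm2C f g : L2 f -> L2 g ->
  norm2 (fun t => f t - g t) = norm2 (fun t => g t - f t).
Proof. by move=> Lf Lg; exact: (nrmC ipL2 (inL2 Lf) (inL2 Lg)). Qed.

Lemma norm2_ae f g : cmeas f -> cmeas g -> aeeq f g -> norm2 f = norm2 g.
Proof.
move=> mf mg fg; rewrite /norm2 /inner.
rewrite (@mean_ae R (fun t => f t * conjc (f t)) (fun t => g t * conjc (g t))) //.
- by apply: cmeasM => //; exact: cmeas_conj.
- by apply: cmeasM => //; exact: cmeas_conj.
- by apply: ae_on_circleS fg => t ->.
Qed.

Lemma norm2_eq0 f : L2 f -> norm2 f = 0 <-> aeeq f (fun=> 0).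
Proof.
move=> Lf; split=> [f0|f0]; last first.
  rewrite (norm2_ae (L2_cmeas Lf) (cmeas_cst 0) f0) /norm2.
  by rewrite (_ : inner _ _ = 0) ?sqrtr0 //; exact: (ip0l ipL2 0).
have := norm2_sqrE f; rewrite f0 expr0n /= => /esym/eqP.
rewrite mulf_eq0 invr_eq0 gt_eqF ?pi2_gt0 //= => /eqP I0.
have /L2P[mf if2] := Lf.
have : (\int[mu]_(t in A) `|(normc (f t) ^+ 2)%:E| = 0)%E.
  under eq_integral do rewrite gee0_abs ?lee_fin ?sqr_ge0 //.
  have := integrable_fin_num (@measurable_angles R) if2 => /fineK <-.
  by congr EFin.
have mf2 : measurable_fun A (fun t => (normc (f t) ^+ 2)%:E).
  by apply/measurable_EFinP; exact: cmeas_normc_sqr.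
move=> /(ae_eq_integral_abs mu (@measurable_angles R) mf2) h.
apply: (@ae_on_circleS _ (fun t => (normc (f t) ^+ 2)%:E = 0%E)).
  move=> t [] /eqP; rewrite sqrf_eq0 => /eqP.
  exact: eq0_normc.
exact: h.
Qed.

Lemma norm2_mul_bounded (M : R) f g : L2 f -> cmeas g -> 0 <= M ->
  (forall t, normc (g t) <= M) -> norm2 (fun t => f t * g t) <= M * norm2 f.
Proof.
move=> Lf mg M0 gM; have Lfg := L2_mul_bounded Lf mg gM.
rewrite -(@ler_pXn2r _ 2) ?nnegrE ?mulr_ge0 ?norm2_ge0 // exprMn !norm2_sqrE.
have /L2P[mf if2] := Lf; have /L2P[_ ifg2] := Lfg.
rewrite mulrCA ler_wpM2l ?invr_ge0 ?(ltW pi2_gt0) //.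
rewrite -(RintegralZl _ (@measurable_angles R) if2).
apply: (le_Rintegral (@measurable_angles R) ifg2) => [|t _].
  exact: (integrableZl (@measurable_angles R) (M ^+ 2) if2).
rewrite normcM exprMn mulrC ler_wpM2r ?sqr_ge0 //.
by rewrite ler_pXn2r ?nnegrE ?normc_ge0.
Qed.

End L2Space.

Lemma nneseries_bounded (R : realType) (u : nat -> R) (B : R) :
  (forall n, 0 <= u n) -> (forall n, \sum_(i < n) u i <= B) ->
  (\sum_(0 <= i <oo) (u i)%:E <= B%:E)%E.
Proof.
move=> u0 uB; apply: lime_le; first by apply: is_cvg_nneseries => n _ _; rewrite lee_fin.
by apply: nearW => n; rewrite sumEFin lee_fin big_mkord.
Qed.

(** * Completeness of L^2 *)

Section RieszFischer.
Variable R : realType.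
Local Notation mu := (@lebesgue_measure R).
Local Notation A := (angles R : set (measurableTypeR R)).

Lemma geometric4_le n : \sum_(i < n) (4^-1 : R) ^+ i <= 2.
Proof.
suff -> : \sum_(i < n) (4^-1 : R) ^+ i = 4 / 3 * (1 - 4^-1 ^+ n).
  have : 0 <= (4^-1 : R) ^+ n by rewrite exprn_ge0.
  by lra.
elim: n => [|n IH]; first by rewrite big_ord0 expr0 subrr mulr0.
by rewrite big_ord_recr /= IH exprS; lra.
Qed.

Variable f : nat -> R -> R[i].
Hypothesis Lf : forall n, L2 (f n).
Hypothesis cf : forall e : R, 0 < e -> exists N, forall m n,
  (N <= m)%N -> (N <= n)%N -> norm2 (fun t => f m t - f n t) < e.

(* Along a fast subsequence [g], the weighted square sum
   [S = sum_j 4^j |g_(j+1) - g_j|^2] is integrable, hence finite almost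
   everywhere, and [sqrt S] controls the tails of [g] geometrically. *)
Lemma L2_complete : exists g, L2 g /\ forall e : R, 0 < e ->
  exists N, forall n, (N <= n)%N -> norm2 (fun t => f n t - g t) < e.
Proof.
have mA := @measurable_angles R.
have p4 j : 0 < (4^-1 : R) ^+ j by rewrite exprn_gt0.
have /choice[N0 hN0] : forall j, exists N, forall m n, (N <= m)%N -> (N <= n)%N ->
    norm2 (fun t => f m t - f n t) < 4^-1 ^+ j by move=> j; exact: cf.
(* Adding up the thresholds makes the indices nondecreasing while keeping each of them above its own
   threshold. *)
pose k j := (\sum_(i < j.+1) N0 i)%N.
have kN j : (N0 j <= k j)%N by rewrite /k big_ord_recr /= leq_addl.
have kS j : (k j <= k j.+1)%N by rewrite /k [in leqRHS]big_ord_recr /= leq_addr.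
pose g j := f (k j).
have Lg j : L2 (g j) by exact: Lf.
pose h j t := g j.+1 t - g j t.
have Lh j : L2 (h j) by exact: L2B.
have hlt j : norm2 (h j) < 4^-1 ^+ j.
  by apply: hN0; [exact: leq_trans (kS j) | exact: kN].
pose s j t : R := 4 ^+ j * normc (h j t) ^+ 2.
have s0 j t : 0 <= s j t by rewrite mulr_ge0 ?sqr_ge0 // exprn_ge0.
have ih j : mu.-integrable A (fun t => (normc (h j t) ^+ 2)%:E).
  by have /L2P[] := Lh j.
have is_ j : mu.-integrable A (fun t => (s j t)%:E).
  exact: (integrableZl mA (4 ^+ j) (ih j)).
have ms j : measurable_fun A (fun t => (s j t)%:E) := measurable_int mu (is_ j).
pose S t := (\sum_(0 <= j <oo) (s j t)%:E)%E.
have S0 t : (0 <= S t)%E by apply: nneseries_ge0 => n _ _; rewrite lee_fin.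
have mS : measurable_fun A S.
  by apply: ge0_emeasurable_sum => // j t _ _; rewrite lee_fin.
have Ih j : \int[mu]_(t in A) (normc (h j t) ^+ 2) = 2 * pi * norm2 (h j) ^+ 2.
  by rewrite norm2_sqrE mulrA divff ?mul1r // gt_eqF // pi2_gt0.
have IS : (\int[mu]_(t in A) S t <= (2 * pi * 2)%:E)%E.
  rewrite integral_nneseries //; last by move=> n t _; rewrite lee_fin.
  have E j : (\int[mu]_(t in A) (s j t)%:E)%E = (4 ^+ j * (2 * pi * norm2 (h j) ^+ 2))%:E.
    rewrite -Ih -(RintegralZl _ mA (ih j)) /Rintegral fineK //.
    exact: (integrable_fin_num mA (is_ j)).
  under eq_eseriesr do rewrite E.
  apply: nneseries_bounded => n.
    by rewrite !mulr_ge0 ?exprn_ge0 ?norm2_ge0 ?(ltW (pi_gt0 _)).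
  apply: le_trans (_ : 2 * pi * \sum_(i < n) 4^-1 ^+ i <= _); last first.
    by rewrite ler_pM2l ?pi2_gt0 // geometric4_le.
  rewrite mulr_sumr; apply: ler_sum => i _; rewrite mulrCA ler_pM2l ?pi2_gt0 //.
  have h4 : 4 ^+ i * 4^-1 ^+ i = 1 :> R by rewrite -exprMn divff ?expr1n.
  apply: le_trans (_ : 4 ^+ i * (4^-1 ^+ i) ^+ 2 <= _).
    rewrite ler_pM2l ?exprn_gt0 // ler_pXn2r ?nnegrE ?norm2_ge0 ?(ltW (p4 i)) //.
    exact: ltW.
  by rewrite expr2 mulrA h4 mul1r.
have iS : mu.-integrable A S.
  apply/integrableP; split=> //; under eq_integral do rewrite gee0_abs //.
  by apply: le_lt_trans IS _; rewrite ltry.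
pose E : set (measurableTypeR R) := A `&` [set t | (S t < +oo)%E].
have mE : measurable E by exact: emeasurable_fun_infty_o.
pose r t := fine (S t).
have r0 t : 0 <= r t by exact: fine_ge0.
have ir : mu.-integrable A (EFin \o r).
  apply: (le_integrable mA _ _ iS).
    apply/measurable_EFinP; apply: measurableT_comp mS; exact: fine_measurable.
  move=> t At /=; rewrite ger0_norm // gee0_abs //.
  by rewrite /r; case: (S t) (S0 t) => [x| |] //= _; rewrite leey.
have rS t : E t -> S t = (r t)%:E.
  by move=> [_ /= St]; rewrite /r fineK // ge0_fin_numE.
have sr j t : E t -> s j t <= r t.
  move=> Et; rewrite -lee_fin -rS //.
  apply: le_trans (nneseries_lim_ge j.+1 _) => [|n _ _]; last by rewrite lee_fin.
  rewrite sumEFin lee_fin big_mkord big_ord_recr /= lerDr.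
  by apply: sumr_ge0 => i _.
have p2 j : 0 < (2^-1 : R) ^+ j by rewrite exprn_gt0.
have hr j t : E t -> normc (h j t) <= Num.sqrt (r t) * 2^-1 ^+ j.
  move=> Et; rewrite -(@ler_pXn2r _ 2) ?nnegrE ?mulr_ge0 ?sqrtr_ge0 ?normc_ge0 ?(ltW (p2 j)) //.
  rewrite exprMn sqr_sqrtr // -exprM mulnC exprM.
  have -> : (2^-1 : R) ^+ 2 = 4^-1 by field.
  rewrite exprVn ler_pdivlMr ?exprn_gt0 // mulrC; exact: sr.
have gtail j m t : E t -> normc (g (j + m)%N t - g j t) <=
    2 * (Num.sqrt (r t) * 2^-1 ^+ j).
  (* The sharper bound telescopes and is therefore suited to induction on [m]. *)
  move=> Et; suff : normc (g (j + m)%N t - g j t) <=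
      2 * Num.sqrt (r t) * (2^-1 ^+ j - 2^-1 ^+ (j + m)).
    move=> hh; apply: le_trans hh _.
    have : 0 <= Num.sqrt (r t) * 2^-1 ^+ (j + m).
      by rewrite mulr_ge0 ?sqrtr_ge0 // (ltW (p2 _)).
    by lra.
  elim: m => [|m IH]; first by rewrite addn0 !subrr normc0 mulr0.
  have -> : g (j + m.+1)%N t - g j t = h (j + m)%N t + (g (j + m)%N t - g j t).
    by rewrite addnS /h addrA subrK.
  apply: le_trans (le_normcD _ _) _; have := hr (j + m)%N t Et.
  by rewrite addnS [2^-1 ^+ (j + m).+1]exprS; move: IH; lra.
have /choice[l hl] : forall t, exists l, (E t -> ccvg (fun j => g j t) l) /\ (~ E t -> l = 0).
  move=> t; have [Et|nEt] := pselect (E t); last by exists 0.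
  suff [l hl] : exists l, ccvg (fun j => g j t) l by exists l.
  apply: complex_cauchy_cvg => e e0.
  have e4 : 0 < e / (4 * (Num.sqrt (r t) + 1)).
    by rewrite divr_gt0 // mulr_gt0 // ltr_wpDl ?sqrtr_ge0.
  have /rcvgP/(_ _ e4)[N hN] : (fun j => (2^-1 : R) ^+ j) @ \oo --> (0 : R).
    by apply: cvg_expr; rewrite gtr0_norm // invf_lt1 // ltr1n.
  have {hN} := hN N (leqnn N); rewrite subr0 gtr0_norm // ltr_pdivlMr; last first.
    by rewrite mulr_gt0 // ltr_wpDl ?sqrtr_ge0.
  move=> hN; exists N => m n Nm Nn.
  have := gtail N (m - N)%N t Et; have := gtail N (n - N)%N t Et.
  rewrite !subnKC //; have := le_normcD (g m t - g N t) (- (g n t - g N t)).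
  rewrite normcN opprB addrA subrK; have := p2 N; nra.
have hl1 t (Et : E t) := (hl t).1 Et; have hl0 t (Et : ~ E t) := (hl t).2 Et.
(* Multiplying by the indicator of [E] makes the sequence converge at every angle, to [l], so that
   [l] is measurable as a pointwise limit. *)
pose I t : R[i] := (\1_E t)%:C.
have I1 t : E t -> I t = 1 by move=> Et; rewrite /I indicE mem_set.
have I0 t : ~ E t -> I t = 0 by move=> Et; rewrite /I indicE memNset.
have In t : normc (I t) <= 1.
  by have [/I1 ->|/I0 ->] := pselect (E t); rewrite ?normc1 ?normc0.
have mI : cmeas I.
  split; last exact: measurable_cst.
  exact: measurable_indic.
have LgI j : L2 (fun t => g j t * I t) by exact: L2_mul_bounded In.
have cI t : ccvg (fun j => g j t * I t) (l t).
  have [Et|Et] := pselect (E t).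
    by rewrite I1 // => e /(hl1 t Et)[N hN]; exists N => n /hN; rewrite mulr1.
  by rewrite I0 // hl0 // => e e0; exists 0%N => n _; rewrite mulr0 subrr normc0.
have ml : cmeas l.
  split.
    apply: (measurable_fun_cvg (h := fun j t => complex.Re (g j t * I t))).
      by move=> j; case: (L2_cmeas (LgI j)).
    move=> t At; apply/rcvgP => e /(cI t)[N hN]; exists N => n /hN.
    by apply: le_lt_trans; rewrite -raddfB; exact: normr_Re_le.
  apply: (measurable_fun_cvg (h := fun j t => complex.Im (g j t * I t))).
    by move=> j; case: (L2_cmeas (LgI j)).
  move=> t At; apply/rcvgP => e /(cI t)[N hN]; exists N => n /hN.
  by apply: le_lt_trans; rewrite -raddfB; exact: normr_Im_le.
have lb j t : normc (l t - g j t * I t) ^+ 2 <= 4 * (4^-1) ^+ j * r t.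
  have [Et|Et] := pselect (E t); last first.
    by rewrite I0 // hl0 // mulr0 subrr normc0 expr0n /= !mulr_ge0 ?(ltW (p4 j)).
  have -> : 4 * 4^-1 ^+ j * r t = (2 * (Num.sqrt (r t) * 2^-1 ^+ j)) ^+ 2.
    rewrite !exprMn sqr_sqrtr // -[(2^-1 ^+ j) ^+ 2]exprM mulnC exprM.
    have -> : (2^-1 : R) ^+ 2 = 4^-1 by field.
    by ring.
  rewrite ler_pXn2r ?nnegrE ?normc_ge0 ?mulr_ge0 ?sqrtr_ge0 ?(ltW (p2 j)) //.
  apply: (ccvg_normc_le (N := j) (cI t)) => n jn; rewrite I1 // !mulr1.
  by rewrite -(subnKC jn); exact: gtail.
have idom j : mu.-integrable A (EFin \o (fun t => 4 * 4^-1 ^+ j * r t)).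
  exact: (integrableZl mA (4 * 4^-1 ^+ j) ir).
have Ld j : L2 (fun t => l t - g j t * I t).
  apply: (L2_dominated _ (idom j)) => //.
  apply: cmeasD => //; have [m1 m2] := L2_cmeas (LgI j).
  have := cmeasM (cmeas_cst (-1)) (conj m1 m2).
  by under [X in cmeas X -> _]eq_fun do rewrite mulN1r.
have Ll : L2 l.
  have := L2D (Ld 0%N) (LgI 0%N).
  by rewrite (_ : (fun t => _) = l) //; apply/funext => t; rewrite subrK.
have aeE : ae_on_circle E.
  have hfin := integrable_ae mA iS.
  apply: (@ae_on_circleS _ (fun t => S t \is a fin_num /\ A t)).
    by move=> t [St At]; split => //=; rewrite -ge0_fin_numE.
  apply: ae_on_circleI; first exact: hfin.
  by apply: aeW => t At.
have gI j : norm2 (fun t => g j t - g j t * I t) = 0.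
  apply/norm2_eq0; first exact: L2B.
  by apply: ae_on_circleS aeE => t Et; rewrite I1 // mulr1 subrr.
have nl j : norm2 (fun t => l t - g j t * I t) ^+ 2 <=
    (2 * pi)^-1 * (4 * \int[mu]_(t in A) r t) * 4^-1 ^+ j.
  rewrite norm2_sqrE -mulrA ler_pM2l ?invr_gt0 ?pi2_gt0 //.
  have -> : 4 * (\int[mu]_(t in A) r t) * 4^-1 ^+ j =
      4 * 4^-1 ^+ j * \int[mu]_(t in A) r t by ring.
  rewrite -(RintegralZl _ mA ir).
  have /L2P[_ ild] := Ld j.
  by apply: (le_Rintegral mA ild (idom j)) => t _; exact: lb.
exists l; split => // e e0.
set B := (2 * pi)^-1 * _ in nl.
have B0 : 0 <= B.
  apply: mulr_ge0; first by rewrite invr_ge0 ltW // pi2_gt0.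
  by apply: mulr_ge0 => //; apply: Rintegral_ge0 => t _; exact: r0.
have e2 : 0 < e / 2 by lra.
have e3 : 0 < (e / 2) ^+ 2 / (B + 1) by rewrite divr_gt0 ?exprn_gt0 // ltr_wpDl.
have /rcvgP c4 : (fun j => (4^-1 : R) ^+ j) @ \oo --> (0 : R).
  by apply: cvg_expr; rewrite gtr0_norm // invf_lt1 // ltr1n.
have [M hM] := c4 _ e3; have [M' hM'] := c4 _ e2.
pose j := maxn M M'.
have {}hM := hM j (leq_maxl _ _); have {}hM' := hM' j (leq_maxr _ _).
rewrite subr0 gtr0_norm // in hM; rewrite subr0 gtr0_norm // in hM'.
have n1 : norm2 (fun t => l t - g j t * I t) < e / 2.
  rewrite -(@ltr_pXn2r _ 2) ?nnegrE ?norm2_ge0 ?(ltW e2) //.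
  apply: le_lt_trans (nl j) _; rewrite ltr_pdivlMr ?ltr_wpDl // in hM.
  by apply: le_lt_trans hM; rewrite mulrC ler_pM2l // lerDl.
exists (N0 j) => n Nn.
have n2 : norm2 (fun t => f n t - g j t) < 4^-1 ^+ j by apply: hN0.
have n3 := norm2_tri (Lf n) Ll (Lg j).
have n4 := norm2_tri (Lg j) Ll (LgI j).
rewrite gI add0r (norm2C (LgI j) Ll) in n4.
by lra.
Qed.

End RieszFischer.

(** * Exponentials on the circle *)

Section Expi.
Variable R : realType.
Local Notation A := (angles R : set (measurableTypeR R)).

Lemma expiD (x y : R) : expi (x + y) = expi x * expi y.
Proof.
by rewrite /expi cosD sinD; apply/eqP; rewrite eq_complex /= eqxx /= addrC.
Qed.

Lemma expiN (x : R) : expi (- x) = conjc (expi x).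
Proof. by rewrite /expi cosN sinN. Qed.

Lemma normc_expi (x : R) : normc (expi x) = 1.
Proof. by rewrite /= cos2Dsin2 sqrtr1. Qed.

Lemma expi0 : expi (0 : R) = 1.
Proof. by rewrite /expi cos0 sin0. Qed.

Lemma expi_mul_conj (x : R) : expi x * conjc (expi x) = 1.
Proof. by rewrite mul_conjcE normc_expi expr1n. Qed.

Definition expin (n : int) (t : R) : R[i] := expi (n%:~R * t).

Lemma expinD m n t : expin (m + n) t = expin m t * expin n t.
Proof. by rewrite /expin intrD mulrDl expiD. Qed.

Lemma expinN n t : expin (- n) t = conjc (expin n t).
Proof. by rewrite /expin mulrNz mulNr expiN. Qed.

Lemma normc_expin n t : normc (expin n t) = 1.
Proof. exact: normc_expi. Qed.

Lemma cmeas_expin n : cmeas (expin n).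
Proof.
have mn : measurable_fun A (fun t => n%:~R * t : R) by exact: mulrl_measurable.
have mc : measurable_fun setT (@cos R).
  by apply: continuous_measurable_fun; exact: continuous_cos.
have ms : measurable_fun setT (@sin R).
  by apply: continuous_measurable_fun; exact: continuous_sin.
by split; [exact: (measurableT_comp mc mn) | exact: (measurableT_comp ms mn)].
Qed.

Lemma lebesgue_measure_angles : lebesgue_measure A = (2 * pi : R)%:E.
Proof.
by rewrite /angles lebesgue_measure_itv /= lte_fin pi2_gt0 sube0.
Qed.

Lemma L2_1 : L2 (fun=> 1 : R[i]).
Proof.
apply: (@L2_dominated _ _ (fun=> 1)); first exact: cmeas_cst.
  apply/integrableP; split; first exact/measurable_EFinP/measurable_cst.
  under eq_integral do rewrite /= normr1.
  rewrite integral_cst; last exact: measurable_angles.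
  apply: le_lt_trans (ltry (2 * pi)); rewrite mul1e le_eqVlt.
  by apply/orP; left; apply/eqP; exact: lebesgue_measure_angles.
by move=> t _; rewrite normc1 expr1n.
Qed.

Lemma L2_bounded (f : R -> R[i]) (M : R) : cmeas f -> (forall t, normc (f t) <= M) -> L2 f.
Proof.
move=> mf fM; have := L2_mul_bounded L2_1 mf fM.
by under eq_fun do rewrite mul1r.
Qed.

Lemma L2_expin n : L2 (expin n).
Proof. by apply: (@L2_bounded _ 1) (cmeas_expin n) _ => t; rewrite normc_expin. Qed.

Lemma fourierE (f : R -> R[i]) n : fourier f n = inner f (expin n).
Proof. by congr mean; apply/funext => t; rewrite expiN. Qed.

End Expi.

(** * Uniqueness of Fourier coefficients *)

Section SmoothStep.
Variable R : realType.
Implicit Types x : R.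

(* A polynomial whose iterates converge on [0, 1] to a step function; applied to
   [(1 + cos (t - t0)) / 2], they are trigonometric polynomials converging
   boundedly to the indicator of an arc. *)
Definition smooth_step x : R := 3 * x ^+ 2 - 2 * x ^+ 3.

Lemma smooth_step_itv x : 0 <= x <= 1 -> 0 <= smooth_step x <= 1.
Proof.
move=> /andP[x0 x1]; rewrite /smooth_step; apply/andP; split.
  have -> : 3 * x ^+ 2 - 2 * x ^+ 3 = x ^+ 2 * (3 - 2 * x) by ring.
  by rewrite mulr_ge0 ?sqr_ge0 //; lra.
rewrite -subr_ge0.
have -> : 1 - (3 * x ^+ 2 - 2 * x ^+ 3) = (1 - x) ^+ 2 * (1 + 2 * x) by ring.
by rewrite mulr_ge0 ?sqr_ge0 //; lra.
Qed.

Lemma iter_smooth_step_itv n x : 0 <= x <= 1 -> 0 <= iter n smooth_step x <= 1.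
Proof. by move=> h; elim: n => //= n IH; exact: smooth_step_itv. Qed.

Lemma iter_smooth_step_compl n x :
  iter n smooth_step (1 - x) = 1 - iter n smooth_step x.
Proof. by elim: n => //= n ->; rewrite /smooth_step; ring. Qed.

Definition step_limit x : R := if x < 2^-1 then 0 else if x == 2^-1 then 2^-1 else 1.

(** Below [1/2] the polynomial is [y] times [y * (3 - 2 * y)], a factor increasing on this range and
    hence at most its value [rho] at the starting point. As [1 - rho = (1 - x) * (1 - 2 * x)] is
    positive, the iterates decay geometrically. *)
Lemma iter_smooth_step_low x : 0 <= x < 2^-1 ->
  rcvg (fun n => iter n smooth_step x) 0.
Proof.
move=> /andP[x0 x1]; pose rho := x * (3 - 2 * x).
have r0 : 0 <= rho by rewrite mulr_ge0 //; lra.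
have r1 : rho < 1.
  have : 0 < (1 - x) * (1 - 2 * x) by rewrite mulr_gt0 //; lra.
  by rewrite /rho; lra.
have key n : 0 <= iter n smooth_step x <= rho ^+ n * x.
  elim: n => [|n /andP[h1 h2]]; first by rewrite /= expr0 mul1r x0 lexx.
  rewrite /=; set y := iter n smooth_step x in h1 h2 *.
  have yx : y <= x by apply: le_trans h2 _; rewrite ler_piMl // exprn_ile1 // ltW.
  have yr : y * (3 - 2 * y) <= rho.
    have : 0 <= (x - y) * (3 - 2 * (x + y)) by rewrite mulr_ge0 //; lra.
    by rewrite /rho; lra.
  have -> : smooth_step y = (y * (3 - 2 * y)) * y by rewrite /smooth_step; ring.
  rewrite mulr_ge0 //=; last by rewrite mulr_ge0 //; lra.
  rewrite exprS -(mulrA rho); apply: ler_pM => //; rewrite mulr_ge0 //; lra.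
move=> e e0; have /rcvgP/(_ e e0)[N hN] : (fun n => rho ^+ n) @ \oo --> (0 : R).
  by apply: cvg_expr; rewrite ger0_norm.
exists N => n /hN; have /andP[h1 h2] := key n.
rewrite !subr0 !ger0_norm ?exprn_ge0 //; apply: le_lt_trans.
by apply: le_trans h2 _; rewrite ler_piMr ?exprn_ge0 //; lra.
Qed.

(** The point [1/2] is fixed, and the symmetry under [x |-> 1 - x] reduces the points above it to
    those below. *)
Lemma iter_smooth_step_cvg x : 0 <= x <= 1 ->
  rcvg (fun n => iter n smooth_step x) (step_limit x).
Proof.
move=> /andP[x0 x1]; rewrite /step_limit; case: ltP => [xlt|xge].
  by apply: iter_smooth_step_low; rewrite x0.
have [->|xne] := eqVneq x 2^-1.
  move=> e e0; exists 0%N => n _.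
  have -> : iter n smooth_step (2^-1 : R) = 2^-1.
    by elim: n => //= n ->; rewrite /smooth_step; field.
  by rewrite subrr normr0.
have h : 0 <= 1 - x < 2^-1.
  have : 2^-1 < x by rewrite lt_def xne.
  by move: x1; lra.
move=> e e0; have [N hN] := iter_smooth_step_low h e0; exists N => n /hN.
by rewrite iter_smooth_step_compl subr0 distrC.
Qed.

End SmoothStep.

Section TrigonometricPolynomials.
Variable R : realType.

Inductive trig : (R -> R[i]) -> Prop :=
| trig_e n : trig (expin n)
| trig_lin (a : R[i]) g h : trig g -> trig h -> trig (fun t => a * g t + h t).

Lemma trig0 : trig (fun=> 0).
Proof.
have := trig_lin (-1) (trig_e 0) (trig_e 0).
by congr trig; apply/funext => t; rewrite mulN1r addNr.
Qed.

Lemma trigZ a g : trig g -> trig (fun t => a * g t).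
Proof.
by move=> /(trig_lin a)/(_ trig0); congr trig; apply/funext => t; rewrite addr0.
Qed.

Lemma trigD g h : trig g -> trig h -> trig (fun t => g t + h t).
Proof.
by move=> /(trig_lin 1) tg /tg; congr trig; apply/funext => t; rewrite mul1r.
Qed.

Lemma trigM g h : trig g -> trig h -> trig (fun t => g t * h t).
Proof.
move=> tg; elim: tg h => [n|a g1 g2 _ IH1 _ IH2] h th; last first.
  have := trig_lin a (IH1 _ th) (IH2 _ th); congr trig; apply/funext => t.
  by rewrite mulrDl mulrA.
elim: th => [m|a h1 h2 _ IH1 _ IH2].
  by have := trig_e (n + m); congr trig; apply/funext => t; rewrite expinD.
have := trig_lin a IH1 IH2; congr trig; apply/funext => t.
by rewrite mulrDr mulrCA.
Qed.

Lemma trig1 : trig (fun=> 1).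
Proof.
by have := trig_e 0; congr trig; apply/funext => t; rewrite /expin mul0r expi0.
Qed.

Lemma cmeas_trig g : trig g -> cmeas g.
Proof.
elim=> [n|a g1 g2 _ IH1 _ IH2]; first exact: cmeas_expin.
by apply: cmeasD => //; apply: cmeasM => //; exact: cmeas_cst.
Qed.

Lemma L2_trig g : trig g -> L2 g.
Proof. by elim=> [n|a g1 g2 _ IH1 _ IH2]; [exact: L2_expin | exact: L2_lin]. Qed.

Lemma mean_mul_trig f g : L2 f -> (forall n, fourier f n = 0) -> trig g ->
  mean (fun t => f t * g t) = 0.
Proof.
move=> Lf f0; elim=> [n|a g1 g2 t1 IH1 t2 IH2].
  rewrite -(f0 (- n)) fourierE; congr mean; apply/funext => t.
  by rewrite expinN conjcK.
have c1 := cint_mul Lf (L2_trig t1); have c2 := cint_mul Lf (L2_trig t2).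
have := meanD (cintZ a c1) c2; rewrite meanZ // IH1 IH2 mulr0 addr0 => <-.
by congr mean; apply/funext => t; rewrite mulrDr mulrCA.
Qed.

Definition rtrig (G : R -> R) := trig (fun t => (G t)%:C).

Lemma rtrig_smooth_step n G : rtrig G -> rtrig (fun t => iter n (@smooth_step R) (G t)).
Proof.
move=> tG; elim: n => //= n IH.
have t2 := trigM IH IH; have t3 := trigM IH t2.
have := trigD (trigZ 3%:C t2) (trigZ (- 2%:C) t3).
congr trig; apply/funext => t; rewrite /smooth_step; apply/eqP.
by rewrite eq_complex /=; apply/andP; split; apply/eqP; ring.
Qed.

Lemma rtrig_cos (t0 a b : R) : rtrig (fun t => a + b * cos (t - t0)).
Proof.
have := trigD (trigZ a%:C trig1) (trigD (trigZ (b%:C * 2^-1%:C * conjc (expi t0)) (trig_e 1))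
   (trigZ (b%:C * 2^-1%:C * expi t0) (trig_e (-1)))).
congr trig; apply/funext => t; rewrite expinN /expin mul1r cosB /expi.
apply/eqP; rewrite eq_complex /=.
by apply/andP; split; apply/eqP; field.
Qed.

End TrigonometricPolynomials.

Section FourierUniqueness.
Variable R : realType.
Local Notation mu := (@lebesgue_measure R).
Local Notation A := (angles R : set (measurableTypeR R)).

(** Dominated convergence with majorant [|F|]. Measurability of the limit belongs to the conclusion
    because the lemma is applied twice in succession: to the iterates of [smooth_step], then to the
    resulting step functions. *)
Lemma Rint0_limit (F : R -> R) (G_ : nat -> R -> R) (G : R -> R) :
  mu.-integrable A (EFin \o F) ->
  (forall n, measurable_fun A (G_ n)) -> (forall n t, `|G_ n t| <= 1) ->
  (forall t, rcvg (fun n => G_ n t) (G t)) ->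
  (forall n, \int[mu]_(t in A) (F t * G_ n t) = 0) ->
  measurable_fun A G /\ \int[mu]_(t in A) (F t * G t) = 0.
Proof.
move=> iF mG_ bG cG I0; have mA := @measurable_angles R.
have mF : measurable_fun A F by have /measurable_EFinP := measurable_int mu iF.
have mG : measurable_fun A G.
  by apply: measurable_fun_cvg mG_ _ => t _; apply/rcvgP; exact: cG.
split => //.
have bG' t : `|G t| <= 1.
  apply/ler_addgt0Pr => e e0; have [N hN] := cG t e e0.
  have := hN N (leqnn N); have := bG N t; rewrite !ler_norml ltr_norml.
  by move=> /andP[a1 a2] /andP[b1 b2]; apply/andP; split; lra.
have dom (H : R -> R) : (forall t, `|H t| <= 1) -> forall t : R,
    (`|(F t * H t)%:E| <= `|(F t)%:E|)%E.
  by move=> bH t; rewrite lee_fin normrM ler_piMr.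
have iFG n : mu.-integrable A (fun t => (F t * G_ n t)%:E).
  apply: (le_integrable mA _ _ iF); first exact/measurable_EFinP/measurable_funM.
  by move=> t _; exact: dom.
have [|||||h1 _ h3] := @dominated_convergence _ _ _ mu A mA
  (fun n t => (F t * G_ n t)%:E) (fun t => (F t * G t)%:E) (fun t => `|(F t)%:E|%E).
- by move=> n; exact/measurable_EFinP/measurable_funM.
- exact/measurable_EFinP/measurable_funM.
- apply: aeW => t _; apply: cvg_EFin; first by near=> n.
  by apply: cvgM; [exact: cvg_cst | apply/rcvgP; exact: cG].
- exact: integrable_abse.
- by apply: aeW => t n _; exact: dom.
have E0 n : (\int[mu]_(t in A) (F t * G_ n t)%:E = 0)%E.
  rewrite -(fineK (integrable_fin_num mA (iFG n))); congr EFin; exact: I0.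
move: h3; rewrite (_ : [sequence _]_n = fun=> 0%E); last by apply/funext.
move=> h; have E : (\int[mu]_(t in A) (F t * G t)%:E = 0)%E.
  by apply: (cvg_unique _ h); [exact: ereal_hausdorff | exact: cvg_cst].
by rewrite /Rintegral E.
Unshelve. all: by end_near. Qed.

Let s (t0 t : R) : R := 2^-1 + 2^-1 * cos (t - t0).

Let s_itv t0 t : 0 <= s t0 t <= 1.
Proof.
by rewrite /s; have := cos_geN1 (t - t0); have := cos_le1 (t - t0);
  move=> h1 h2; apply/andP; split; lra.
Qed.

Let rtrig_meas G : rtrig G -> measurable_fun A G.
Proof. by move=> /cmeas_trig[]. Qed.

Section Arc.
Variable F : R -> R.
Hypothesis iF : mu.-integrable A (EFin \o F).
Hypothesis F0 : forall G, rtrig G -> \int[mu]_(t in A) (F t * G t) = 0.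

(** Dividing by [2 * c] moves the jump from [1/2] to [c]; the assumption [2^-1 <= c] keeps the
    quotient in [[0, 1]], where the iterates converge. *)
Lemma Rint0_step_limit (t0 c : R) : 2^-1 <= c -> c < 1 ->
  measurable_fun A (fun t => step_limit (s t0 t / (2 * c))) /\
  \int[mu]_(t in A) (F t * step_limit (s t0 t / (2 * c))) = 0.
Proof.
move=> c0 c1; have c2 : 0 < 2 * c by lra.
have itv t : 0 <= s t0 t / (2 * c) <= 1.
  have /andP[h1 h2] := s_itv t0 t; rewrite divr_ge0 // ?(ltW c2) //=.
  by rewrite ler_pdivrMr //; lra.
have tr n : rtrig (fun t => iter n (@smooth_step R) (s t0 t / (2 * c))).
  apply: rtrig_smooth_step; have := rtrig_cos t0 (2^-1 / (2 * c)) (2^-1 / (2 * c)).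
  by congr rtrig; apply/funext => t; rewrite /s mulrDl; ring.
apply: (@Rint0_limit F (fun n t => iter n (@smooth_step R) (s t0 t / (2 * c)))) => //.
- by move=> n; exact: rtrig_meas.
- move=> n t; have /andP[h1 h2] := iter_smooth_step_itv n (itv t).
  by rewrite ger0_norm.
- by move=> t; exact: iter_smooth_step_cvg.
- by move=> n; exact: F0.
Qed.

(** The step functions take the value [1/2] at the jump. Letting thresholds [cm m] decrease strictly
    to [c] removes it and leaves the indicator of a strict inequality. *)
Lemma Rint0_above (t0 c : R) : 2^-1 <= c -> c < 1 ->
  \int[mu]_(t in A) (F t * (if c < s t0 t then 1 else 0)) = 0.
Proof.
move=> c0 c1; pose cm m := c + (1 - c) / m.+2%:R.
have m0 m : 0 < (m.+2%:R : R) by rewrite ltr0n.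
have cmgt m : c < cm m by rewrite /cm ltrDl divr_gt0 //; lra.
have cmlt m : cm m < 1.
  have : (1 - c) / m.+2%:R < 1 - c.
    by rewrite ltr_pdivrMr // ltr_pMr ?ltr1n //; lra.
  by rewrite /cm; move: (_ / _) => x; lra.
have cm2 m : 0 < 2 * cm m by have := cmgt m; lra.
have stepE m t : step_limit (s t0 t / (2 * cm m)) =
    if s t0 t < cm m then 0 else if s t0 t == cm m then 2^-1 else 1.
  rewrite /step_limit ltr_pdivrMr // mulrA mulVf ?mul1r // -(inj_eq (mulIf (lt0r_neq0 (cm2 m)))).
  by rewrite divfK ?lt0r_neq0 // mulrA mulVf // mul1r.
have cb m : 2^-1 <= cm m by have := cmgt m; lra.
apply: (proj2 (@Rint0_limit F (fun m t => step_limit (s t0 t / (2 * cm m))) _ iF _ _ _ _)).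
- by move=> m; have [] := Rint0_step_limit t0 (cb m) (cmlt m).
- move=> m t; rewrite stepE; case: ifP => _; first by rewrite normr0.
  case: ifP => _; last by rewrite normr1.
  by rewrite ger0_norm //; lra.
- move=> t e e0; case: ltP => st.
    have st0 : 0 < s t0 t - c by lra.
    have [N hN] := inv_succ_small st0; exists N => m Nm.
    have lt : cm m < s t0 t.
      have := hN m.+1 (leqW Nm); rewrite /cm => h.
      have : (1 - c) / m.+2%:R <= m.+2%:R^-1.
        by rewrite ler_piMl ?invr_ge0 ?ler0n //; lra.
      by move: h; move: (m.+2%:R^-1) => x; lra.
    rewrite stepE; have -> : (s t0 t < cm m) = false.
      by apply/negbTE; rewrite -leNgt ltW.
    by rewrite gt_eqF // subrr normr0.
  exists 0%N => m _; rewrite stepE (le_lt_trans st (cmgt m)).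
  by rewrite subrr normr0.
- by move=> m; have [] := Rint0_step_limit t0 (cb m) (cmlt m).
Qed.

(** The set where [s t0] exceeds [(1 + cos d) / 2] is the arc of radius [d] about [t0]. With
    [d <= pi / 2] this threshold is at least [1/2], and the last two conditions keep the arc from
    wrapping around the ends of the interval of angles. *)
Lemma Rint0_ball (t0 d : R) : 0 < d -> d <= pi / 2 -> d <= t0 -> d <= 2 * pi - t0 ->
  \int[mu]_(t in A) (F t * \1_(ball t0 d) t) = 0.
Proof.
move=> d0 d1 d2 d3; have pi0 := pi_gt0 R.
have cd0 : 0 <= cos d by apply: cos_ge0_pihalf; lra.
have inpi (x : R) : 0 <= x -> x <= pi -> x \in `[0, pi].
  by move=> x0 x1; rewrite in_itv /= x0.
have cd1 : cos d < 1.
  by rewrite -[ltRHS](@cos0 R) ltr_cos ?inpi //; lra.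
rewrite -[RHS](@Rint0_above t0 (2^-1 + 2^-1 * cos d)); [|lra|lra].
apply: eq_Rintegral => t; rewrite inE /angles /= in_itv /= => /andP[ta tb].
congr (_ * _); rewrite indicE /s.
have -> : (2^-1 + 2^-1 * cos d < 2^-1 + 2^-1 * cos (t - t0)) = (cos d < cos (t - t0)).
  by apply/idP/idP; lra.
have -> : ((t : R) \in (ball t0 d : set R)) = (`|t - t0| < d).
  by apply/idP/idP; rewrite inE /= -ball_normE /= distrC.
rewrite -(cos_norm (t - t0)); set x := `|t - t0|.
have x0 : 0 <= x by exact: normr_ge0.
have xle : x <= 2 * pi - d by rewrite /x ler_norml; apply/andP; split; lra.
have [xpi|xpi] := leP x pi; first by rewrite ltr_cos ?inpi //; [case: ifP|lra|lra].
(* At distance more than [pi] from [t0], the angle is measured the other way around; it is still at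
   least [d] because [t0] is at least [d] away from both ends. *)
have -> : cos x = cos (2 * pi - x).
  by rewrite -[RHS]cosN opprB -[RHS]cosD2pi mulr2n; congr cos; ring.
rewrite ltr_cos ?inpi //; try lra.
have -> : (x < d) = false by apply/negbTE; rewrite -leNgt; lra.
by have -> : (2 * pi - x < d) = false by apply/negbTE; rewrite -leNgt; lra.
Qed.

End Arc.

End FourierUniqueness.

Section FourierUniquenessL2.
Variable R : realType.
Local Notation mu := (@lebesgue_measure R).
Local Notation A := (angles R : set (measurableTypeR R)).

(** The integrals of [F] over small intervals vanish, so [F] vanishes at each interior Lebesgue
    point by Lebesgue differentiation. *)
Lemma rtrig_ortho_ae0 (F : R -> R) : mu.-integrable A (EFin \o F) ->
  (forall G, rtrig G -> \int[mu]_(t in A) (F t * G t) = 0) ->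
  ae_on_circle (fun t => F t = 0).
Proof.
move=> iF F0; have mA := @measurable_angles R.
have locF := integrable_locally_restrict mA iF.
have hE (x : R) : nicely_shrinking x (fun n => ball x (n.+1%:R^-1 : R)).
  split=> [n|]; first exact: measurable_ball.
  have p n : 0 < (n.+1%:R^-1 : R) by rewrite invr_gt0 ltr0n.
  exists (1, fun n => PosNum (p n)); split => //=.
    by apply/rcvgP => e /inv_succ_small[N hN]; exists N => n /hN; rewrite subr0 gtr0_norm.
    by move=> n.
  by move=> n; rewrite mul1e.
have pts (x : R) : 0 < x < 2 * pi -> lebesgue_pt (F \_ A) x -> F x = 0.
  move=> /andP[x0 x1] lx.
  have xA : x \in A by rewrite inE /angles /= in_itv /= !ltW.
  have := nice_lebesgue_differentiation hE locF lx; rewrite patchE xA => h.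
  have [d d0 hd] : exists2 d, 0 < d & forall d', 0 < d' -> d' <= d ->
      (\int[mu]_(y in ball x d') ((F \_ A) y)%:E = 0)%E.
    have pi0 := pi_gt0 R.
    exists (Num.min (pi / 2) (Num.min x (2 * pi - x))).
      by rewrite !lt_min; apply/and3P; split; lra.
    move=> d' d'0; rewrite !le_min => /and3P[h1 h2 h3].
    have := Rint0_ball iF F0 d'0 h1 h2 h3; rewrite /Rintegral => I0.
    have E1 : (\int[mu]_(y in ball x d') ((F \_ A) y)%:E =
               \int[mu]_(t in A) (F t * \1_(ball x d') t)%:E)%E.
      rewrite integral_mkcond [RHS]integral_mkcond; apply: eq_integral => t _.
      rewrite !patchE indicE.
      by case: ifP => tb; case: ifP => ta; rewrite ?mulr1 ?mulr0.
    rewrite E1 -(fineK (x := (\int[mu]_(t in A) (F t * \1_(ball x d') t)%:E)%E)) ?I0 //.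
    apply: (integrable_fin_num mA); apply: (le_integrable mA _ _ iF).
      apply/measurable_EFinP/measurable_funM.
        by have /measurable_EFinP := measurable_int mu iF.
      by apply: measurable_indic; exact: measurable_ball.
    move=> t _; rewrite lee_fin normrM ler_piMr // indicE.
    by case: (_ \in _); rewrite ?normr1 ?normr0.
  have [N hN] := inv_succ_small d0.
  have : (fun n => ((mu (ball x (n.+1%:R^-1 : R)))^-1 *
     \int[mu]_(y in ball x (n.+1%:R^-1 : R)) ((F \_ A) y)%:E)%E) @ \oo --> (0%E : \bar R).
    apply: cvg_near_cst; exists N => // n Nn /=.
    by rewrite hd ?mule0 // ?invr_gt0 ?ltr0n // ltW // hN.
  by move=> /(cvg_unique _ h)/= => H; have [] := H (@ereal_hausdorff R).
have aeL := lebesgue_differentiation locF.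
(* No interval about an endpoint stays inside the range of angles; the two endpoints form a null set
   and are discarded. *)
have ends : {ae mu, forall x : R, ~ [set 0; 2 * pi] x}.
  exists [set 0; 2 * pi]; split.
  - by apply: measurableU; exact: measurable_set1.
  - apply/eqP; rewrite -measure_le0; apply: le_trans (measureU2 _ _ _) _.
    + exact: measurable_set1.
    + exact: measurable_set1.
    + have e1 (x : R) : (mu [set x] <= 0)%E by rewrite lebesgue_measure_set1.
      by apply: le_trans (leeD (e1 0) (e1 (2 * pi))) _; rewrite adde0.
  - by move=> x /= /contrapT.
apply: (@filterS2 _ _ (ae_filter_ringOfSetsType mu) _ _ _ _ aeL ends).
move=> t lt nt; rewrite /angles /= in_itv /= => /andP[t0 t1].
apply: pts lt; rewrite !lt_def t0 t1 !andbT; apply/andP; split; apply/eqP => e.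
  by apply: nt; left.
by apply: nt; right.
Qed.

Lemma fourier_uniq (f : R -> R[i]) : L2 f -> (forall n, fourier f n = 0) ->
  aeeq f (fun=> 0).
Proof.
move=> Lf f0; have Lf1 := cint_mul Lf (@L2_1 R).
have [iRe iIm] : cint f by move: Lf1; under eq_fun do rewrite mulr1.
have key G : rtrig G ->
    \int[mu]_(t in A) (complex.Re (f t) * G t) = 0 /\
    \int[mu]_(t in A) (complex.Im (f t) * G t) = 0.
  move=> tG; have := mean_mul_trig Lf f0 tG; rewrite /mean.
  have E1 t : complex.Re (f t * (G t)%:C) = complex.Re (f t) * G t.
    by rewrite complex_ReM /= mulr0 subr0.
  have E2 t : complex.Im (f t * (G t)%:C) = complex.Im (f t) * G t.
    by rewrite complex_ImM /= mulr0 add0r.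
  under eq_Rintegral do rewrite E1.
  under [X in _ +i* (_ * X)]eq_Rintegral do rewrite E2.
  move=> /eqP; rewrite eq_complex /= !mulf_eq0 !invr_eq0 !(gt_eqF (pi2_gt0 R)) /=.
  by move=> /andP[/eqP -> /eqP ->].
have h1 := rtrig_ortho_ae0 iRe (fun G tG => (key G tG).1).
have h2 := rtrig_ortho_ae0 iIm (fun G tG => (key G tG).2).
apply: ae_on_circleS (ae_on_circleI h1 h2) => t [].
by case: (f t) => a b /= -> ->.
Qed.

End FourierUniquenessL2.

(** * Orthonormality of the exponentials *)

Section Orthonormality.
Variable R : realType.
Local Notation mu := (@lebesgue_measure R).
Local Notation A := (angles R : set (measurableTypeR R)).

Lemma Rintegral_angles_FTC (f F : R -> R) : (forall x : R, is_derive x 1 F (f x)) ->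
  continuous f -> \int[mu]_(t in A) f t = F (2 * pi) - F 0.
Proof.
move=> dF cf; have cF x : {for x, continuous F}.
  by apply: differentiable_continuous; apply/derivable1_diffP; case: (dF x).
have := @continuous_FTC2 R f F 0 (2 * pi) (pi2_gt0 R).
rewrite /Rintegral /angles => -> //=.
- exact: continuous_subspaceT.
- split.
  + by move=> x _; case: (dF x).
  + exact/cvg_at_right_filter/cF.
  + exact/cvg_at_left_filter/cF.
- by move=> x _; rewrite derive1E; case: (dF x).
Qed.

Lemma expi_2pi : expi (2 * pi : R) = 1.
Proof. by rewrite mulr_natl /expi cos2pi sin2pi. Qed.

Lemma expin_nat n t : expin (Posz n) t = (expi t : R[i]) ^+ n.
Proof.
elim: n => [|n IH]; first by rewrite /expin mul0r expi0 expr0.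
by rewrite intS expinD IH exprS /expin mul1r.
Qed.

Lemma expin_2pi n : expin n (2 * pi : R) = 1.
Proof.
case: n => n; first by rewrite expin_nat expi_2pi expr1n.
by rewrite NegzE expinN expin_nat expi_2pi expr1n conjc1.
Qed.

Lemma mean_expin n : mean (@expin R n) = (n == 0)%:R.
Proof.
have [->|n0] := eqVneq n 0.
  rewrite (_ : expin 0 = fun=> 1); last first.
    by apply/funext => t; rewrite /expin mul0r expi0.
  rewrite /mean /=; apply/eqP; rewrite eq_complex /=; apply/andP; split; apply/eqP.
    rewrite Rintegral_cst; last exact: measurable_angles.
    rewrite mul1r (congr1 fine (lebesgue_measure_angles R)) /=.
    by rewrite mulVf // gt_eqF // pi2_gt0.
  by rewrite Rintegral_cst ?mul0r ?mulr0 //; exact: measurable_angles.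
pose k : R := n%:~R; have k0 : k != 0 by rewrite intr_eq0.
have e2 : cos (k * (2 * pi)) = 1 /\ sin (k * (2 * pi)) = 0.
  by have [] := expin_2pi n.
have dk (x : R) : is_derive x 1 (fun t : R => k * t) k.
  have := is_deriveZ k (is_derive_id x (1 : R)).
  by rewrite /GRing.scale /= mulr1.
have cc : continuous (fun t : R => cos (k * t)).
  move=> x; apply: continuous_comp; [exact: mulrl_continuous | exact: continuous_cos].
have cs : continuous (fun t : R => sin (k * t)).
  move=> x; apply: continuous_comp; [exact: mulrl_continuous | exact: continuous_sin].
have d1 (x : R) : is_derive x 1 (fun t => k^-1 * sin (k * t)) (cos (k * x)).
  have := is_deriveZ k^-1 (is_derive1_comp (is_derive_sin (k * x)) (dk x)).
  move=> H; have -> : cos (k * x) = k^-1 * (cos (k * x) * k) by field.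
  exact: H.
have d2 (x : R) : is_derive x 1 (fun t => - k^-1 * cos (k * t)) (sin (k * x)).
  have := is_deriveZ (- k^-1) (is_derive1_comp (is_derive_cos (k * x)) (dk x)).
  move=> H; have -> : sin (k * x) = - k^-1 * (- sin (k * x) * k) by field.
  exact: H.
rewrite /mean; apply/eqP; rewrite eq_complex /=; apply/andP; split; apply/eqP.
  rewrite (Rintegral_angles_FTC d1 cc).
  by rewrite !mulr0 sin0 e2.2 !mulr0 subr0 mulr0.
rewrite (Rintegral_angles_FTC d2 cs).
by rewrite !mulr0 cos0 e2.1 subrr mulr0.
Qed.

Lemma inner_expin m n : inner (@expin R m) (expin n) = (m == n)%:R.
Proof.
rewrite -subr_eq0 -mean_expin; congr mean; apply/funext => t.
by rewrite expinD expinN.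
Qed.

End Orthonormality.

(** * The Hardy space *)

Section Hardy.
Variable R : realType.
Local Notation mu := (@lebesgue_measure R).
Local Notation A := (angles R : set (measurableTypeR R)).
Implicit Types (f g h : R -> R[i]) (a : R[i]) (p : {poly R[i]}).

Lemma conjcM a b : conjc (a * b) = conjc a * conjc b.
Proof. exact: rmorphM. Qed.

Lemma conjcD a b : conjc (a + b) = conjc a + conjc b.
Proof. exact: rmorphD. Qed.

Lemma conjcB a b : conjc (a - b) = conjc a - conjc b.
Proof. exact: rmorphB. Qed.

Lemma conjcX a n : conjc (a ^+ n) = conjc a ^+ n.
Proof. exact: rmorphXn. Qed.

Lemma cmeas_cvg (f : nat -> R -> R[i]) g : (forall n, cmeas (f n)) ->
  (forall t, ccvg (fun n => f n t) (g t)) -> cmeas g.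
Proof.
move=> mf cf; split.
  apply: (measurable_fun_cvg (h := fun j t => complex.Re (f j t))).
    by move=> j; case: (mf j).
  move=> t At; apply/rcvgP => e /(cf t)[N hN]; exists N => n /hN.
  by apply: le_lt_trans; rewrite -raddfB; exact: normr_Re_le.
apply: (measurable_fun_cvg (h := fun j t => complex.Im (f j t))).
  by move=> j; case: (mf j).
move=> t At; apply/rcvgP => e /(cf t)[N hN]; exists N => n /hN.
by apply: le_lt_trans; rewrite -raddfB; exact: normr_Im_le.
Qed.

Lemma hcompleteL2 : hcomplete (subspace_ip (hK := @subspace_L2 R) (@inner R)).
Proof.
move=> f cf.
have [g [Lg hg]] := @L2_complete R (fun n => subspace_val (f n))
  (fun n => subspace_valP (f n)) cf.
by exists (inL2 Lg).
Qed.

Definition circle_poly p (t : R) : R[i] := p.[expi t].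

Definition expinL2 (n : nat) := inL2 (@L2_expin R n).

Lemma subspace_val_lincomb (V : lmodType R[i]) (K : set V) (hK : subspace K)
  (e : nat -> subspace_type hK) p :
  subspace_val (lincomb e p) = lincomb (fun i => subspace_val (e i)) p.
Proof.
by rewrite /lincomb; elim/big_rec2: _ => // i y1 y2 _ <-.
Qed.

Lemma lincomb_expin p : subspace_val (lincomb expinL2 p) = circle_poly p.
Proof.
rewrite subspace_val_lincomb; apply/funext => t.
rewrite /circle_poly horner_coef /lincomb fct_sumE; apply: eq_bigr => i _.
by rewrite -expin_nat.
Qed.

Lemma L2_circle_poly p : L2 (circle_poly p).
Proof. by rewrite -lincomb_expin; exact: subspace_valP. Qed.

Lemma inner_circle_poly p g : L2 g ->
  inner (circle_poly p) g = \sum_(i < size p) p`_i * inner (expin i) g.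
Proof.
move=> Lg; rewrite -lincomb_expin -[LHS]/(subspace_ip (@inner R) (lincomb expinL2 p) (inL2 Lg)).
rewrite (ip_suml (ipL2 R)); apply: eq_bigr => i _.
by rewrite (ipZl (ipL2 R)).
Qed.

Lemma inner_circle_poly_widen n p g : (size p <= n)%N -> L2 g ->
  inner (circle_poly p) g = \sum_(i < n) p`_i * inner (expin i) g.
Proof.
move=> pn Lg; rewrite inner_circle_poly //.
exact: (lincomb_widen (H := R[i]) (fun i : nat => inner (expin i) g) pn).
Qed.

Lemma fourier_circle_poly p n : fourier (circle_poly p) (Negz n) = 0.
Proof.
rewrite fourierE inner_circle_poly; last exact: L2_expin.
by rewrite big1 // => i _; rewrite inner_expin mulr0.
Qed.

Lemma H2_circle_poly p : H2 (circle_poly p).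
Proof. by split; [exact: L2_circle_poly | exact: fourier_circle_poly]. Qed.

Lemma fourierB f g n : L2 f -> L2 g ->
  fourier (fun t => f t - g t) n = fourier f n - fourier g n.
Proof. by move=> Lf Lg; rewrite !fourierE innerB //; exact: L2_expin. Qed.

Lemma fourier_le f n : L2 f -> normc (fourier f n) <= norm2 f.
Proof.
move=> Lf; rewrite fourierE; apply: le_trans (inner_CS Lf (L2_expin _ n)) _.
by rewrite {2}/norm2 inner_expin eqxx sqrtr1 mulr1.
Qed.

Lemma H2_dense f : H2 f -> exists p : nat -> {poly R[i]},
  forall e : R, 0 < e -> exists N, forall n, (N <= n)%N ->
    norm2 (fun t => circle_poly (p n) t - f t) < e.
Proof.
move=> [Lf Nf]; pose L p := inner (circle_poly p) f.
have LE p : L p = subspace_ip (@inner R) (lincomb expinL2 p) (inL2 Lf).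
  by rewrite /L -lincomb_expin.
have Llin b p q : L (b *: p + q) = b * L p + L q.
  by rewrite !LE lincomb_lin (ip_lin (ipL2 R)).
have Lb p : normc (L p) <= norm2 f *
    hnorm (subspace_ip (@inner R)) (lincomb expinL2 p).
  by rewrite LE mulrC; exact: (cauchy_schwarz (ipL2 R)).
have [g [h1 _ [w hw]]] := riesz (ipL2 R) hcompleteL2 (lincomb_lin expinL2) Llin
  (norm2_ge0 f) Lb.
have Lg := subspace_valP g; set gv := subspace_val g in Lg.
have fg0 : norm2 (fun t => f t - gv t) = 0.
  apply/norm2_eq0; first exact: L2B.
  apply: fourier_uniq; first exact: L2B.
  case=> n; rewrite fourierB //; last first.
    rewrite Nf sub0r; apply/eqP; rewrite oppr_eq0 -normc_eq0 eq_le normc_ge0 andbT.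
    apply/ler_addgt0Pr => e e0; rewrite add0r.
    have [N hN] := hcvg_ip (ipL2 R) (inL2 (L2_expin R (Negz n))) hw e0.
    have : normc (fourier (circle_poly (w N)) (Negz n) - fourier gv (Negz n)) < e.
      by rewrite !fourierE -lincomb_expin; exact: hN.
    by rewrite fourier_circle_poly sub0r normcN => /ltW.
  have e1 : lincomb expinL2 'X^n = expinL2 n.
    rewrite (@lincomb_widen _ _ n.+1) ?size_polyXn // big_ord_recr /= big1 => [|i _].
      by rewrite coefXn eqxx scale1r add0r.
    by rewrite coefXn (ltn_eqF (ltn_ord i)) scale0r.
  have e2 : inner (expin n) f = inner (expin n) gv.
    by have := h1 'X^n; rewrite LE e1.
  rewrite !fourierE (inner_conj (L2_expin R n) Lf) (inner_conj (L2_expin R n) Lg).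
  by rewrite e2 subrr.
exists w => e /hw[N hN]; exists N => n /hN; apply: le_lt_trans.
rewrite /hnorm /subspace_ip /= lincomb_expin.
apply: le_trans (norm2_tri (L2_circle_poly _) Lf Lg) _.
by rewrite (norm2C Lg Lf) fg0 addr0.
Qed.

Lemma norm2_le_bound f (M : R) : cmeas f -> 0 <= M -> (forall t, normc (f t) <= M) ->
  norm2 f <= M.
Proof.
move=> mf M0 fM; have := norm2_mul_bounded (L2_1 R) mf M0 fM.
have -> : norm2 (fun=> 1 : R[i]) = 1.
  have := inner_expin R 0 0; rewrite eqxx /norm2.
  have -> : expin 0 = fun=> 1 :> R[i].
    by apply/funext => t; rewrite /expin mul0r expi0.
  by move=> ->; rewrite sqrtr1.
by rewrite mulr1; under eq_fun do rewrite mul1r.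
Qed.

(** The Szego kernel, that is, the reproducing kernel of [H^2] at [a]; [disk_extE] is the
    reproducing property. *)
Definition kernel a (t : R) : R[i] := (1 - conjc a * expi t)^-1.

Section Kernel.
Variable a : R[i].
Hypothesis a1 : normc a < 1.

Lemma kernel_denom_ge t : 1 - normc a <= normc (1 - conjc a * expi t).
Proof.
have := le_normcD (1 - conjc a * expi t) (conjc a * expi t).
by rewrite subrK normc1 normcM normc_conj normc_expi mulr1; lra.
Qed.

Lemma kernel_denom_neq0 t : 1 - conjc a * expi t != 0.
Proof.
by rewrite -normc_gt0; apply: lt_le_trans (kernel_denom_ge t); rewrite subr_gt0.
Qed.

Lemma normc_kernel t : normc (kernel a t) <= (1 - normc a)^-1.
Proof.
rewrite normcV lef_pV2 ?posrE ?subr_gt0 ?normc_gt0 ?kernel_denom_neq0 //.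
exact: kernel_denom_ge.
Qed.

Lemma kernelE t : kernel a t * (1 - conjc a * expi t) = 1.
Proof. by rewrite /kernel mulVf // kernel_denom_neq0. Qed.

Lemma kernel_rec t : kernel a t = 1 + conjc a * expi t * kernel a t.
Proof. by have := kernelE t; rewrite mulrBr mulr1 mulrC => /eqP; rewrite subr_eq => /eqP. Qed.

Let partial N : {poly R[i]} := \poly_(i < N) (conjc a) ^+ i.

Lemma kernel_partial_sum N t :
  circle_poly (partial N) t = kernel a t * (1 - (conjc a * expi t) ^+ N).
Proof.
rewrite /kernel -[LHS](mulKf (kernel_denom_neq0 t)); congr (_ * _).
rewrite -(expr1n _ N) subrXX /circle_poly horner_poly; congr (_ * _).
  by rewrite expr1n.
by apply: eq_bigr => i _; rewrite !expr1n mul1r exprMn.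
Qed.

Lemma kernel_partial_dist N t : normc (circle_poly (partial N) t - kernel a t) <=
  normc a ^+ N / (1 - normc a).
Proof.
rewrite kernel_partial_sum mulrBr mulr1 addrC addKr normcN normcM normcX.
rewrite [normc (_ * _)]normcM normc_conj normc_expi mulr1 mulrC.
by rewrite ler_wpM2l ?exprn_ge0 ?normc_ge0 // normc_kernel.
Qed.

Lemma cvg_normcX (M e : R) : 0 <= M -> 0 < e ->
  exists N, forall n, (N <= n)%N -> M * (normc a ^+ n / (1 - normc a)) < e.
Proof.
move=> M0 e0; have a0 := normc_ge0 a; have q0 : 0 < 1 - normc a by rewrite subr_gt0.
have e1 : 0 < e * (1 - normc a) / (M + 1) by rewrite divr_gt0 ?mulr_gt0 // ltr_wpDl.
have /rcvgP/(_ _ e1)[N hN] : (fun n => normc a ^+ n) @ \oo --> (0 : R).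
  by apply: cvg_expr; rewrite ger0_norm.
exists N => n /hN; rewrite subr0 ger0_norm ?exprn_ge0 // ltr_pdivlMr ?ltr_wpDl // => h.
rewrite mulrA ltr_pdivrMr //; apply: le_lt_trans h.
by rewrite mulrC ler_wpM2l ?exprn_ge0 // lerDl.
Qed.

Lemma cmeas_kernel : cmeas (kernel a).
Proof.
apply: (@cmeas_cvg (fun N => circle_poly (partial N))).
  by move=> N; exact/L2_cmeas/L2_circle_poly.
move=> t e e0; have [N hN] := cvg_normcX ler01 e0; exists N => n /hN.
by rewrite mul1r; apply: le_lt_trans; exact: kernel_partial_dist.
Qed.

Lemma L2_kernel : L2 (kernel a).
Proof. exact: L2_bounded cmeas_kernel normc_kernel. Qed.

Lemma kernel_partial_norm2 N : norm2 (fun t => circle_poly (partial N) t - kernel a t) <=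
  normc a ^+ N / (1 - normc a).
Proof.
apply: norm2_le_bound (kernel_partial_dist N).
  exact/L2_cmeas/L2B/L2_kernel/L2_circle_poly.
by rewrite divr_ge0 ?exprn_ge0 ?normc_ge0 // subr_ge0 ltW.
Qed.

(** The partial sums of the power series are the inner products of [f] with the partial sums of the
    kernel, which converge uniformly. For general [f] in [L^2] both sides ignore the negative
    frequencies, so evaluation at [a] is linear and continuous on all of [L^2]. *)
Lemma fourier_series_cvg f : L2 f ->
  ccvg (series (fun n : nat => fourier f n%:Z * a ^+ n)) (inner f (kernel a)).
Proof.
move=> Lf e e0; have [N hN] := cvg_normcX (norm2_ge0 f) e0; exists N => n /hN.
apply: le_lt_trans.
have -> : series (fun n : nat => fourier f n%:Z * a ^+ n) n = inner f (circle_poly (partial n)).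
  rewrite (inner_conj (L2_circle_poly _) Lf) (@inner_circle_poly_widen n) ?size_poly //.
  rewrite rmorph_sum /series /= big_mkord; apply: eq_bigr => i _.
  rewrite coef_poly ltn_ord conjcM -(inner_conj (L2_expin R i) Lf) -fourierE.
  by rewrite conjcX conjcK mulrC.
rewrite -innerBr //; [|exact: L2_circle_poly|exact: L2_kernel].
apply: le_trans (inner_CS Lf _) _; first exact/L2B/L2_kernel/L2_circle_poly.
by rewrite ler_wpM2l ?norm2_ge0 // kernel_partial_norm2.
Qed.

Lemma disk_extE f : L2 f -> disk_ext f a = inner f (kernel a).
Proof.
move=> /fourier_series_cvg/ccvgP h.
by rewrite /disk_ext; apply: (cvg_lim _ h); exact: norm_hausdorff.
Qed.

End Kernel.

End Hardy.

(** * Multiplication in the Hardy space *)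

Section HardyAlgebra.
Variable R : realType.
Local Notation mu := (@lebesgue_measure R).
Local Notation A := (angles R : set (measurableTypeR R)).
Implicit Types (f g h : R -> R[i]) (a b w : R[i]) (p : {poly R[i]}).

Lemma inner_mulr f g h :
  inner (fun t => f t * g t) h = inner f (fun t => conjc (g t) * h t).
Proof.
by congr mean; apply/funext => t; rewrite conjcM conjcK mulrA.
Qed.

Lemma cmeas_expi : cmeas (@expi R).
Proof.
have := @cmeas_expin R 1; congr cmeas.
by apply/funext => t; rewrite /expin mul1r.
Qed.

Lemma L2_mul_expi f : L2 f -> L2 (fun t => f t * expi t).
Proof. by move=> Lf; apply: (L2_mul_bounded (M := 1) Lf cmeas_expi) => t; rewrite normc_expi. Qed.

Lemma disk_ext_lin (b w : R[i]) f g : normc w < 1 -> L2 f -> L2 g ->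
  disk_ext (fun t => b * f t + g t) w = b * disk_ext f w + disk_ext g w.
Proof.
move=> w1 Lf Lg; have Lk := L2_kernel w1.
by rewrite !disk_extE ?inner_lin //; exact: L2_lin.
Qed.

Lemma H2_lin (b : R[i]) f g : H2 f -> H2 g -> H2 (fun t => b * f t + g t).
Proof.
move=> [Lf Nf] [Lg Ng]; split=> [|n]; first exact: L2_lin.
rewrite fourierE inner_lin //; last exact: L2_expin.
by rewrite -!fourierE Nf Ng mulr0 addr0.
Qed.

Lemma H2_0 : H2 (fun=> 0 : R[i]).
Proof.
split=> [|n]; first exact: L2_0.
by rewrite fourierE -[RHS](ip0l (ipL2 R) (inL2 (L2_expin R (Negz n)))).
Qed.

Lemma H2_mul_expi f : H2 f -> H2 (fun t => f t * expi t) /\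
  forall w, normc w < 1 -> disk_ext (fun t => f t * expi t) w = disk_ext f w * w.
Proof.
move=> [Lf Nf]; have Lz := L2_mul_expi Lf; split.
  split=> // n; rewrite fourierE inner_mulr -(Nf n.+1) fourierE; congr inner.
  apply/funext => t; have <- : expin 1 t = expi t :> R[i] by rewrite /expin mul1r.
  by rewrite -expinN -expinD !NegzE -opprD -intS.
move=> w w1; rewrite !disk_extE // inner_mulr.
(* The extra exponential pairs with [f] to the Fourier coefficient of index [-1], which is zero. *)
have -> : (fun t => conjc (expi t) * kernel w t) =
    (fun t => conjc w * kernel w t + expin (-1) t).
  apply/funext => t; rewrite {1}(kernel_rec w1 t) expinN /expin mul1r.
  have := expi_mul_conj t; move: (expi t) (conjc (expi t)) => x y xy.
  by rewrite mulrDr mulr1 addrC mulrA (mulrCA y) (mulrC y) xy mulr1.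
have Lk := L2_kernel w1; have Le := L2_expin R (-1).
rewrite (inner_conj (L2_lin (conjc w) Lk Le) Lf) inner_lin //.
rewrite conjcD conjcM conjcK -(inner_conj Lk Lf) -(inner_conj Le Lf).
by rewrite -[X in _ + X]fourierE (Nf 0%N) addr0 mulrC.
Qed.

Lemma H2_mul_poly f p : H2 f -> H2 (fun t => f t * circle_poly p t) /\
  forall w, normc w < 1 ->
    disk_ext (fun t => f t * circle_poly p t) w = disk_ext f w * p.[w].
Proof.
move=> Hf; elim/poly_ind: p => [|p c [H1 H2']].
  have -> : (fun t => f t * circle_poly 0 t) = (fun=> 0).
    by apply/funext => t; rewrite /circle_poly horner0 mulr0.
  split=> [|w w1]; first exact: H2_0.
  rewrite horner0 mulr0 disk_extE //; last exact: L2_0.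
  exact: (ip0l (ipL2 R) (inL2 (L2_kernel w1))).
have [H3 H4] := H2_mul_expi H1.
have -> : (fun t => f t * circle_poly (p * 'X + c%:P) t) =
    (fun t => c * f t + f t * circle_poly p t * expi t).
  apply/funext => t; rewrite /circle_poly hornerD hornerM hornerX hornerC.
  by rewrite mulrDr mulrA addrC (mulrC c).
split=> [|w w1]; first exact: H2_lin.
rewrite disk_ext_lin //; [|by case: Hf|by case: H3].
by rewrite H4 // H2' // hornerD hornerM hornerX hornerC mulrDr mulrA addrC (mulrC c).
Qed.

Lemma L2_mul_boundedC (M : R) f g : L2 g -> cmeas f -> (forall t, normc (f t) <= M) ->
  L2 (fun t => f t * g t).
Proof.
by move=> Lg mf fM; have := L2_mul_bounded Lg mf fM; under eq_fun do rewrite mulrC.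
Qed.

Lemma expin0E : expin 0 = (fun=> 1) :> (R -> R[i]).
Proof. by apply/funext => t; rewrite /expin mul0r expi0. Qed.

Lemma disk_ext1 w : normc w < 1 -> disk_ext (fun=> 1) w = 1.
Proof.
move=> w1; rewrite disk_extE //; last exact: L2_1.
apply: (ccvg_uniq (fourier_series_cvg w1 (L2_1 R))) => e e0; exists 1%N => -[//|n] _.
rewrite /series /= big_nat_recl // big1 => [|i _].
  rewrite expr0 mulr1 addr0 fourierE.
  by rewrite -expin0E inner_expin eqxx subrr normc0.
by rewrite fourierE -expin0E inner_expin mul0r.
Qed.

Lemma H2_1 : H2 (fun=> 1 : R[i]).
Proof.
have := @H2_circle_poly R 1; congr H2; apply/funext => t.
by rewrite /circle_poly hornerC.
Qed.

Lemma disk_ext_circle_poly p w : normc w < 1 -> disk_ext (circle_poly p) w = p.[w].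
Proof.
move=> w1; have [_ /(_ _ w1)] := H2_mul_poly p H2_1.
have -> : (fun t => 1 * circle_poly p t) = circle_poly p.
  by apply/funext => t; rewrite mul1r.
by rewrite (disk_ext1 w1) mul1r.
Qed.

Lemma normc_small0 (x : R[i]) : (forall e : R, 0 < e -> normc x <= e) -> x = 0.
Proof.
move=> h; apply/eqP; rewrite -normc_eq0 eq_le normc_ge0 andbT.
by apply/ler_addgt0Pr => e e0; rewrite add0r; exact: h.
Qed.

Section BoundedMultiplier.
Variables (f : R -> R[i]) (M : R).
Hypotheses (Hf : H2 f) (fM : forall t, normc (f t) <= M).

Let mf : cmeas f. Proof. by apply: L2_cmeas; case: Hf. Qed.
Let M0 : 0 <= M. Proof. exact: le_trans (normc_ge0 _) (fM 0). Qed.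

Lemma L2_mulb g : L2 g -> L2 (fun t => f t * g t).
Proof. by move=> Lg; exact: L2_mul_boundedC fM. Qed.

Lemma norm2_mulb g : L2 g -> norm2 (fun t => f t * g t) <= M * norm2 g.
Proof.
by move=> Lg; have := norm2_mul_bounded Lg mf M0 fM; under eq_fun do rewrite mulrC.
Qed.

(** For polynomials in place of [h] this is [H2_mul_poly]; as multiplication by [f] is bounded in
    norm, approximating [h] by polynomials carries the vanishing of negative coefficients to the
    limit. *)
Lemma H2_mulb h : H2 h -> H2 (fun t => f t * h t).
Proof.
move=> Hh; have Lh : L2 h by case: Hh.
have Lfh := L2_mulb Lh; split => // n.
have [p hp] := H2_dense Hh; apply: normc_small0 => e e0.
have M1 : 0 < M + 1 by rewrite ltr_wpDl.
have [N hN] := hp _ (divr_gt0 e0 M1); have {hN} := hN N (leqnn N).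
rewrite ltr_pdivlMr // => hN; set q := p N in hN.
have [[Lq Nq] _] := H2_mul_poly q Hf.
have Lqh := L2B (L2_circle_poly q) Lh.
rewrite -normcN -sub0r -(Nq n) -fourierB //.
apply: le_trans (fourier_le _ (L2B Lq Lfh)) _.
have -> : (fun t => f t * circle_poly q t - f t * h t) =
    (fun t => f t * (circle_poly q t - h t)).
  by apply/funext => t; rewrite mulrBr.
apply: le_trans (norm2_mulb Lqh) _; apply: le_trans (ltW hN).
by rewrite mulrC ler_wpM2l ?norm2_ge0 // lerDl.
Qed.

(** Multiplicativity is known for polynomials, and both sides depend continuously on [h] in [L^2];
    [C] is the sum of the two Lipschitz constants. *)
Lemma disk_ext_mulb h w : H2 h -> normc w < 1 ->
  disk_ext (fun t => f t * h t) w = disk_ext f w * disk_ext h w.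
Proof.
move=> Hh w1; have Lh : L2 h by case: Hh. have Lf : L2 f by case: Hf.
have Lfh := L2_mulb Lh; have Lk := L2_kernel w1.
apply/eqP; rewrite -subr_eq0; apply/eqP; apply: normc_small0 => e e0.
have [p hp] := H2_dense Hh.
set C := (M + normc (disk_ext f w)) * norm2 (kernel w).
have C0 : 0 <= C by rewrite mulr_ge0 ?norm2_ge0 // addr_ge0 ?normc_ge0.
have C1 : 0 < C + 1 by rewrite ltr_wpDl.
have [N hN] := hp _ (divr_gt0 e0 C1); have {hN} := hN N (leqnn N).
rewrite ltr_pdivlMr // => hN; set q := p N in hN.
have [[Lq _] /(_ w w1) Eq] := H2_mul_poly q Hf.
have Lqh := L2B (L2_circle_poly q) Lh.
have E1 : disk_ext (fun t => f t * h t) w - disk_ext f w * disk_ext h w =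
   - inner (fun t => f t * (circle_poly q t - h t)) (kernel w) +
   disk_ext f w * inner (fun t => circle_poly q t - h t) (kernel w).
  have -> : (fun t => f t * (circle_poly q t - h t)) =
    (fun t => f t * circle_poly q t - f t * h t).
    by apply/funext => t; rewrite mulrBr.
  rewrite !innerB //; last exact: L2_circle_poly.
  rewrite -!disk_extE //; last exact: L2_circle_poly.
  rewrite Eq (disk_ext_circle_poly q w1).
  by move: (disk_ext _ w) (disk_ext _ w) (disk_ext _ w) q.[w] => x y z v; ring.
rewrite E1; apply: le_trans (le_normcD _ _) _; rewrite normcN normcM.
have b1 := inner_CS (L2_mulb Lqh) Lk; have b2 := inner_CS Lqh Lk.
have b3 := norm2_mulb Lqh.
apply: le_trans (_ : C * norm2 (fun t => circle_poly q t - h t) <= _); last first.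
  apply: le_trans (ltW hN); rewrite [leRHS]mulrC ler_wpM2r ?norm2_ge0 //.
  by rewrite lerDl.
have -> : C * norm2 (fun t => circle_poly q t - h t) =
    M * norm2 (fun t => circle_poly q t - h t) * norm2 (kernel w) +
    normc (disk_ext f w) * (norm2 (fun t => circle_poly q t - h t) * norm2 (kernel w)).
  by rewrite /C; ring.
apply: lerD; last by rewrite ler_wpM2l ?normc_ge0.
by apply: le_trans b1 _; rewrite ler_wpM2r ?norm2_ge0.
Qed.

End BoundedMultiplier.

End HardyAlgebra.

(** * Blaschke products *)

Section BlaschkeFactor.
Variable R : realType.
Local Notation mu := (@lebesgue_measure R).
Local Notation A := (angles R : set (measurableTypeR R)).
Implicit Types (f g h : R -> R[i]) (a b w : R[i]) (p : {poly R[i]}).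

Lemma mean_mul_ae f g h : cmeas f -> cmeas g -> cmeas h -> aeeq f g ->
  mean (fun t => f t * h t) = mean (fun t => g t * h t).
Proof.
move=> mf mg mh fg; apply: mean_ae; try exact: cmeasM.
by apply: ae_on_circleS fg => t ->.
Qed.

Lemma inner_ael f g h : cmeas f -> cmeas g -> cmeas h -> aeeq f g ->
  inner f h = inner g h.
Proof. by move=> mf mg mh; apply: mean_mul_ae => //; exact: cmeas_conj. Qed.

Lemma inner_aer f g h : cmeas f -> cmeas g -> cmeas h -> aeeq f g ->
  inner h f = inner h g.
Proof.
move=> mf mg mh fg; apply: mean_ae; try by apply: cmeasM => //; exact: cmeas_conj.
by apply: ae_on_circleS fg => t ->.
Qed.

Lemma fourier_ae f g n : cmeas f -> cmeas g -> aeeq f g -> fourier f n = fourier g n.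
Proof. by move=> *; rewrite !fourierE; apply: inner_ael => //; exact: cmeas_expin. Qed.

Lemma aeeq_sym f g : aeeq f g -> aeeq g f.
Proof. by apply: ae_on_circleS => t ->. Qed.

Lemma H2_ae f g : cmeas f -> aeeq f g -> H2 g -> H2 f.
Proof.
move=> mf fg [Lg Ng]; split=> [|n]; first exact: L2_ae Lg.
by rewrite (fourier_ae _ mf (L2_cmeas Lg) fg).
Qed.

Lemma disk_ext_ae f g : cmeas f -> cmeas g -> aeeq f g -> disk_ext f = disk_ext g.
Proof.
move=> mf mg fg; apply/funext => w; rewrite /disk_ext.
by under eq_fun do rewrite (fourier_ae _ mf mg fg).
Qed.

(** The multiplier lemmas ask for a bound at every angle. Setting [f] to [0] where the essential
    bound fails provides such a representative. *)
Lemma Hinfty_bounded f : Hinfty f -> exists g M,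
  [/\ H2 g, forall t, normc (g t) <= M & aeeq f g].
Proof.
move=> [Hf [M0 fM0]]; have mf : cmeas f by apply: L2_cmeas; case: Hf.
pose M := `|M0|; pose E : set (measurableTypeR R) := A `&` [set t | normc (f t) ^+ 2 <= M ^+ 2].
have mE : measurable E.
  have -> : E = A `&` (fun t => normc (f t) ^+ 2) @^-1` `]-oo, M ^+ 2]%classic.
    by apply/seteqP; split=> t [At]; rewrite /= in_itv.
  by apply: (cmeas_normc_sqr mf (@measurable_angles R)); exact: measurable_itv.
pose g t := f t * (\1_E t)%:C.
have mI : cmeas (fun t => (\1_E t)%:C : R[i]).
  by split; [exact: measurable_indic | exact: measurable_cst].
have gE t : E t -> g t = f t by move=> Et; rewrite /g indicE mem_set // mulr1.
have g0 t : ~ E t -> g t = 0 by move=> Et; rewrite /g indicE memNset // mulr0.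
have gM t : normc (g t) <= M.
  have [Et|Et] := pselect (E t); last by rewrite g0 // normc0 normr_ge0.
  rewrite gE // -(@ler_pXn2r _ 2) ?nnegrE ?normc_ge0 ?normr_ge0 //.
  by case: Et.
have fg : aeeq f g.
  have hA : ae_on_circle A by apply: aeW => t At.
  apply: (ae_on_circleS _ (ae_on_circleI fM0 hA)) => t [h1 At].
  rewrite gE //; split => //=.
  rewrite ler_pXn2r ?nnegrE ?normc_ge0 ?normr_ge0 //.
  exact: le_trans h1 (ler_norm _).
exists g, M; split => //; apply: (H2_ae _ (aeeq_sym fg)) => //.
exact: cmeasM.
Qed.

Section Factor.
Variable a : R[i].
Hypothesis a1 : normc a < 1.

Lemma H2_kernel : H2 (kernel a).
Proof.
have Lk := L2_kernel a1; split=> // n; apply: normc_small0 => e e0.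
have [N hN] := cvg_normcX a1 ler01 e0.
have := kernel_partial_norm2 a1 N.
set q := \poly_(i < N) _ => hq.
rewrite -normcN -sub0r -(fourier_circle_poly q n) -fourierB //; last exact: L2_circle_poly.
apply: le_trans (fourier_le _ (L2B (L2_circle_poly q) Lk)) _.
by apply: le_trans hq _; have := hN N (leqnn N); rewrite mul1r => /ltW.
Qed.

Lemma blaschke_denom_neq0 w : normc w < 1 -> 1 - conjc a * w != 0.
Proof.
move=> w1; rewrite subr_eq0; apply/eqP => e.
have : normc (conjc a * w) < 1.
  rewrite normcM normc_conj -[ltRHS]mulr1.
  by apply: ltr_pM; rewrite ?normc_ge0.
by rewrite -e normc1 ltxx.
Qed.

(** Multiplying the kernel by the polynomial [1 - conjc a * z] gives the constant [1], and
    evaluation respects products with polynomials. *)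
Lemma disk_ext_kernel w : normc w < 1 -> disk_ext (kernel a) w = (1 - conjc a * w)^-1.
Proof.
move=> w1; have [_ /(_ w w1)] := H2_mul_poly (1 - conjc a *: 'X) H2_kernel.
rewrite hornerD hornerN hornerZ hornerX hornerC.
have -> : (fun t => kernel a t * circle_poly (1 - conjc a *: 'X) t) = fun=> 1.
  apply/funext => t; rewrite /circle_poly hornerD hornerN hornerZ hornerX hornerC.
  exact: kernelE.
rewrite disk_ext1 // => h; apply: (mulIf (blaschke_denom_neq0 w1)).
by rewrite -h mulVf // blaschke_denom_neq0.
Qed.

Definition blaschke_num : {poly R[i]} :=
  if a == 0 then 'X else (`|a| / a) *: (a%:P - 'X).

Lemma blaschke_factorE w : blaschke_factor a w = blaschke_num.[w] / (1 - conjc a * w).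
Proof.
rewrite /blaschke_factor /blaschke_num; case: eqP => [->|_].
  by rewrite conjc0 mul0r subr0 hornerX divr1.
by rewrite hornerZ hornerD hornerN hornerX hornerC mulrA.
Qed.

Definition blaschke (t : R) : R[i] := blaschke_factor a (expi t).

Lemma blaschkeE t : blaschke t = kernel a t * circle_poly blaschke_num t.
Proof. by rewrite /blaschke blaschke_factorE mulrC. Qed.

Lemma H2_blaschke : H2 blaschke.
Proof.
have -> : blaschke = fun t => kernel a t * circle_poly blaschke_num t.
  by apply/funext => t; rewrite blaschkeE.
by have [] := H2_mul_poly blaschke_num H2_kernel.
Qed.

Lemma disk_ext_blaschke w : normc w < 1 -> disk_ext blaschke w = blaschke_factor a w.
Proof.
move=> w1; have [_ /(_ w w1)] := H2_mul_poly blaschke_num H2_kernel.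
have -> : (fun t => kernel a t * circle_poly blaschke_num t) = blaschke.
  by apply/funext => t; rewrite blaschkeE.
by rewrite (disk_ext_kernel w1) blaschke_factorE mulrC.
Qed.

Lemma normc_unit_factor : a != 0 -> normc (`|a| / a) = 1.
Proof.
move=> a0; rewrite normcM normcV normr_normcE normc_real ger0_norm ?normc_ge0 //.
by rewrite divff // normc_eq0.
Qed.

Lemma normc_blaschke t : normc (blaschke t) = 1.
Proof.
rewrite /blaschke /blaschke_factor; case: eqP => [_|/eqP a0]; first exact: normc_expi.
rewrite normcM normc_unit_factor // mul1r normcM normcV.
have -> : a - expi t = - (expi t * conjc (1 - conjc a * expi t)).
  have -> : conjc (1 - conjc a * expi t) = 1 - a * conjc (expi t).
    by rewrite conjcB conjc1 conjcM conjcK.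
  by rewrite mulrBr mulr1 mulrCA expi_mul_conj mulr1 opprB.
rewrite normcN normcM normc_expi mul1r normc_conj divff // normc_eq0.
exact: kernel_denom_neq0.
Qed.

Lemma blaschke_conj t : blaschke t * conjc (blaschke t) = 1.
Proof. by rewrite mul_conjcE normc_blaschke expr1n. Qed.

Section Division.
Variable h : R -> R[i].
Hypotheses (Hh : H2 h) (h0 : disk_ext h a = 0).

(* By induction on [j], from [k = 1 + conj a * zeta * k] for the kernel [k] at [a]. *)
Lemma inner_shifted_kernel (j : nat) :
  inner h (fun t => expin (- j%:Z) t * kernel a t) = 0.
Proof.
have [Lh Nh] := Hh.
have Lek n : L2 (fun t => expin n t * kernel a t).
  by apply: L2_mul_boundedC (L2_kernel a1) (cmeas_expin R n) _ => t; rewrite normc_expin.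
elim: j => [|j IH].
  rewrite -[RHS]h0 disk_extE //; congr inner; apply/funext => t.
  by rewrite oppr0 /expin mul0r expi0 mul1r.
have -> : (fun t => expin (- j.+1%:Z) t * kernel a t) =
    (fun t => conjc a * (expin (- j%:Z) t * kernel a t) + expin (- j.+1%:Z) t).
  apply/funext => t; rewrite {1}(kernel_rec a1 t).
  have -> : expin (- j%:Z) t = expin (- j.+1%:Z) t * expi t :> R[i].
    have <- : expin 1 t = expi t :> R[i] by rewrite /expin mul1r.
    by rewrite -expinD intS opprD addrAC addNr add0r.
  by ring.
have L1 := Lek (- j%:Z); have L2 := L2_expin R (- j.+1%:Z).
rewrite (inner_conj (L2_lin (conjc a) L1 L2) Lh) inner_lin //.
rewrite (inner_conj Lh L1) IH conjc0 mulr0 add0r -(inner_conj L2 Lh).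
by rewrite -[LHS]fourierE -NegzE Nh.
Qed.

(** On the circle the second factor is [1 / (expi t - a)]: this is division by a linear polynomial
    vanishing at the zero [a] of [h], and [inner_shifted_kernel] says that no negative coefficients
    arise. *)
Lemma H2_div_linear : H2 (fun t => h t * (conjc (expi t) * conjc (kernel a t))).
Proof.
have [Lh Nh] := Hh.
have mk : cmeas (fun t => conjc (expi t) * conjc (kernel a t)).
  by apply: cmeasM; apply: cmeas_conj; [exact: cmeas_expi | exact: cmeas_kernel].
have bk t : normc (conjc (expi t) * conjc (kernel a t)) <= (1 - normc a)^-1.
  by rewrite normcM !normc_conj normc_expi mul1r normc_kernel.
split=> [|n]; first exact: L2_mul_bounded bk.
rewrite fourierE inner_mulr -(inner_shifted_kernel n); congr inner.
apply/funext => t; rewrite conjcM !conjcK NegzE.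
have <- : expin 1 t = expi t :> R[i] by rewrite /expin mul1r.
by rewrite mulrAC -expinD intS opprD addrA subrr add0r.
Qed.

Lemma H2_div_blaschke : H2 (fun t => h t * conjc (blaschke t)).
Proof.
(* On the circle [conjc (expi t)] times [r] is the conjugate of the numerator of the Blaschke
   factor. *)
pose r : {poly R[i]} := if a == 0 then 1 else
  conjc (`|a| / a) *: (conjc a *: 'X - 1).
have [+ _] := H2_mul_poly r H2_div_linear; congr H2; apply/funext => t.
rewrite blaschkeE conjcM -!mulrA; congr (_ * _).
rewrite mulrCA; congr (_ * _); rewrite /r /blaschke_num /circle_poly.
case: eqP => _; first by rewrite hornerX hornerC mulr1.
rewrite !(hornerZ, hornerD, hornerN, hornerX, hornerC).
rewrite [in RHS]conjcM conjcB mulrCA; congr (_ * _).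
by rewrite mulrBr mulr1 mulrCA (mulrC _ (expi t)) expi_mul_conj mulr1.
Qed.

Lemma disk_ext_div_blaschke w : normc w < 1 ->
  disk_ext h w = blaschke_factor a w * disk_ext (fun t => h t * conjc (blaschke t)) w.
Proof.
move=> w1; rewrite -disk_ext_blaschke //.
rewrite -(disk_ext_mulb (M := 1) H2_blaschke _ H2_div_blaschke w1); last first.
  by move=> t; rewrite normc_blaschke.
have -> // : (fun t => blaschke t * (h t * conjc (blaschke t))) = h.
by apply/funext => t; rewrite mulrCA blaschke_conj mulr1.
Qed.

End Division.

Lemma blaschke_factor_neq0 w : normc w < 1 -> w != a -> blaschke_factor a w != 0.
Proof.
move=> w1 wa; rewrite /blaschke_factor; have [a0|a0] := eqVneq a 0; first by rewrite -a0.
apply: mulf_neq0; first by rewrite mulf_neq0 ?invr_neq0 ?normr_eq0.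
apply: mulf_neq0; first by rewrite subr_eq0 eq_sym.
by rewrite invr_neq0 // blaschke_denom_neq0.
Qed.

Lemma blaschke_factor_root : blaschke_factor a a = 0.
Proof.
rewrite /blaschke_factor; case: eqP => [//|_].
by rewrite subrr mul0r mulr0.
Qed.

End Factor.

End BlaschkeFactor.

Lemma nneseries_tail (R : realType) (u : nat -> R) : (forall n, 0 <= u n) ->
  (\sum_(0 <= n <oo) (u n)%:E < +oo)%E ->
  forall e : R, 0 < e -> exists N, forall m, (N <= m)%N -> \sum_(N <= i < m) u i < e.
Proof.
move=> u0 fin e e0; pose S n := \sum_(0 <= i < n) u i.
have S0 : (0 <= \sum_(0 <= n <oo) (u n)%:E)%E.
  by apply: nneseries_ge0 => n _ _; rewrite lee_fin.
have Sle n : S n <= fine (\sum_(0 <= n <oo) (u n)%:E)%E.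
  rewrite -lee_fin fineK ?ge0_fin_numE // -sumEFin.
  by apply: nneseries_lim_ge => i _ _; rewrite lee_fin.
have hs : has_sup (range S).
  by split; [exists (S 0%N), 0%N | exists (fine (\sum_(0 <= n <oo) (u n)%:E)%E) => _ [n _ <-]].
have [_ [N _ <-] hN] := sup_adherent e0 hs.
exists N => m Nm; have : S m <= sup (range S) by apply: ub_le_sup; [case: hs | exists m].
by rewrite /S (big_cat_nat (leq0n N) Nm) /=; move: hN; rewrite /S; lra.
Qed.

(** The Weierstrass product inequality, stated together with the bounds on the product that its
    induction uses. *)
Lemma prod_ge_sum (R : realType) (x : nat -> R) N M : (forall n, 0 <= x n <= 1) ->
  1 - \prod_(N <= n < M) x n <= \sum_(N <= n < M) (1 - x n) /\
  0 <= \prod_(N <= n < M) x n <= 1.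
Proof.
move=> x01; have [MN|NM] := leqP M N; first by rewrite !big_geq // subrr lexx ler01 lexx.
elim: M NM => // M IH; rewrite ltnS leq_eqVlt => /orP[/eqP <-|NM].
  by rewrite !big_nat1; have /andP[-> ->] := x01 N.
have [h1 /andP[h2 h3]] := IH NM; have /andP[x0 x1] := x01 M.
rewrite !big_nat_recr ?(ltnW NM) //=; set p := \prod_(_ <= _ < _) _ in h1 h2 h3 *.
have px : 0 <= (1 - p) * (1 - x M) by rewrite mulr_ge0 // subr_ge0.
have px2 : 0 <= p * x M by rewrite mulr_ge0.
have px3 : 0 <= p * (1 - x M) by rewrite mulr_ge0 // subr_ge0.
by split; [|apply/andP; split]; lra.
Qed.

(** * Limits in the Hardy space and uniqueness on the disk *)

Section InnerLimits.
Variable R : realType.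
Implicit Types (f g h : R -> R[i]) (w : R[i]).

Lemma norm2_cvg_inner (f : nat -> R -> R[i]) g h : (forall n, L2 (f n)) -> L2 g -> L2 h ->
  (forall e : R, 0 < e -> exists N, forall n, (N <= n)%N -> norm2 (fun t => f n t - g t) < e) ->
  ccvg (fun n => inner (f n) h) (inner g h).
Proof.
move=> Lf Lg Lh fg e e0; have h1 : 0 < norm2 h + 1 by rewrite ltr_wpDl ?norm2_ge0.
have [N hN] := fg _ (divr_gt0 e0 h1); exists N => n /hN.
rewrite ltr_pdivlMr // -innerB // => hlt.
apply: le_lt_trans (inner_CS (L2B (Lf n) Lg) Lh) _; apply: le_lt_trans hlt.
by rewrite ler_wpM2l ?norm2_ge0 // lerDl.
Qed.

Lemma ccvg_cst (c : R[i]) : ccvg (fun=> c) c.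
Proof. by move=> e e0; exists 0%N => n _; rewrite subrr normc0. Qed.

Lemma H2_limit (f : nat -> R -> R[i]) g : (forall n, H2 (f n)) -> L2 g ->
  (forall e : R, 0 < e -> exists N, forall n, (N <= n)%N -> norm2 (fun t => f n t - g t) < e) ->
  H2 g.
Proof.
move=> Hf Lg fg; split=> // n; have Lf k : L2 (f k) by case: (Hf k).
have := norm2_cvg_inner Lf Lg (L2_expin R (Negz n)) fg.
rewrite fourierE; move/ccvg_uniq; apply.
have -> : (fun k => inner (f k) (expin (Negz n))) = (fun=> 0).
  by apply/funext => k; rewrite -fourierE; case: (Hf k).
exact: ccvg_cst.
Qed.

Lemma kernel0 : kernel 0 = (fun=> 1) :> (R -> R[i]).
Proof. by apply/funext => t; rewrite /kernel conjc0 mul0r subr0 invr1. Qed.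

Lemma fourier0E f : L2 f -> fourier f 0 = disk_ext f 0.
Proof.
by move=> Lf; rewrite disk_extE ?normc0 ?ltr01 // kernel0 -expin0E fourierE.
Qed.

(** Continuity of the extension at the origin, obtained from the norm convergence of the kernels at
    [r] to the constant [1]. It serves where division by [z] controls the quotient only away from
    [0]. *)
Lemma disk_ext_continuous0 f : L2 f ->
  (forall w, normc w < 1 -> w != 0 -> disk_ext f w = 0) -> disk_ext f 0 = 0.
Proof.
move=> Lf f0; apply: normc_small0 => e e0.
(* With [r <= 1/2] the kernel at [r] is within [r / (1 - r) <= 2 * r] of the constant [1]; the
   second bound makes [2 * r * norm2 f] at most [e]. *)
pose r := Num.min 2^-1 (e / (2 * (norm2 f + 1))).
have n1 : 0 < norm2 f + 1 by rewrite ltr_wpDl ?norm2_ge0.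
have r0 : 0 < r.
  by rewrite lt_min invr_gt0 ltr0n /= divr_gt0 // mulr_gt0.
have [r2 re] : r <= 2^-1 /\ r <= e / (2 * (norm2 f + 1)) by split; rewrite ge_min lexx ?orbT.
have nr : normc (r%:C : R[i]) = r by rewrite normc_real gtr0_norm.
have w1 : normc (r%:C : R[i]) < 1 by rewrite nr; lra.
have w0 : r%:C != 0 :> R[i] by rewrite -normc_eq0 nr gt_eqF.
have Lk := L2_kernel w1.
have z1 : normc (0 : R[i]) < 1 by rewrite normc0.
have -> : disk_ext f 0 = inner f (fun=> 1) - inner f (kernel r%:C).
  by rewrite -(disk_extE w1 Lf) (f0 _ w1 w0) subr0 -kernel0 (disk_extE z1 Lf).
rewrite -innerBr //; last exact: L2_1.
have Ld := L2B (L2_1 R) Lk; apply: le_trans (inner_CS Lf Ld) _.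
have := kernel_partial_norm2 w1 1; rewrite expr1 nr.
have -> : circle_poly (\poly_(i < 1) conjc (r%:C : R[i]) ^+ i) = fun=> 1.
  apply/funext => t; rewrite /circle_poly horner_poly big_ord_recl big_ord0.
  by rewrite !expr0 mulr1 addr0.
move=> h; apply: le_trans (_ : norm2 f * (2 * r) <= _).
  rewrite ler_wpM2l ?norm2_ge0 //; apply: le_trans h _.
  by rewrite ler_pdivrMr; nra.
apply: le_trans (_ : (norm2 f + 1) * (2 * r) <= _).
  by rewrite ler_wpM2r ?lerDl // mulr_ge0 // ltW.
move: re; rewrite ler_pdivlMr ?mulr_gt0 //.
by have -> : r * (2 * (norm2 f + 1)) = (norm2 f + 1) * (2 * r) by ring.
Qed.

Lemma blaschke0 t : blaschke 0 t = expi t :> R[i].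
Proof. by rewrite /blaschke /blaschke_factor eqxx. Qed.

(** The coefficients vanish one after another: the one of index [0] is the value at the origin, and
    dividing by the Blaschke factor at [0], which is the coordinate, shifts the coefficients down.
    The quotient vanishes off the origin, hence also there by continuity. *)
Lemma disk_ext_uniq f : H2 f -> (forall w, normc w < 1 -> disk_ext f w = 0) ->
  aeeq f (fun=> 0).
Proof.
move=> Hf f0; apply: fourier_uniq; first by case: Hf.
case=> n; last by case: Hf.
elim: n f Hf f0 => [|n IH] f Hf f0; have z1 : normc (0 : R[i]) < 1 by rewrite normc0.
  by rewrite fourier0E ?f0 //; case: Hf.
pose g t := f t * conjc (blaschke 0 t).
have Hg : H2 g by apply: H2_div_blaschke => //; exact: f0.
have g0 w : normc w < 1 -> w != 0 -> disk_ext g w = 0.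
  move=> w1 w0; apply/eqP; have := f0 w w1.
  rewrite (disk_ext_div_blaschke z1 Hf (f0 0 z1) w1) => /eqP.
  by rewrite mulf_eq0 (negbTE (blaschke_factor_neq0 z1 w1 w0)).
have g00 : disk_ext g 0 = 0 by apply: disk_ext_continuous0 => //; case: Hg.
rewrite -(IH g Hg) => [|w w1]; last by have [->|w0] := eqVneq w 0; [|exact: g0].
rewrite !fourierE /g inner_mulr; congr inner; apply/funext => t.
rewrite conjcK blaschke0; have <- : expin 1 t = expi t :> R[i] by rewrite /expin mul1r.
by rewrite -expinD -intS.
Qed.

End InnerLimits.

Section BlaschkeProduct.
Variables (R : realType) (u : R -> R[i]) (z : nat -> R[i]).
Hypothesis hz : forall n, normc (z n) < 1.
Hypothesis hsum : (\sum_(0 <= n <oo) (1 - normc (z n))%:E < +oo)%E.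
Hypothesis Hu : H2 u.
Hypothesis hprod : forall w : R[i], normc w < 1 ->
  ccvg (fun N : nat => \prod_(0 <= n < N) blaschke_factor (z n) w) (disk_ext u w).

Definition bprod N M (t : R) : R[i] := \prod_(N <= n < M) blaschke (z n) t.

Lemma normc_bprod N M t : normc (bprod N M t) = 1.
Proof.
rewrite /bprod; elim/big_rec: _ => [|i x _ h]; first exact: normc1.
by rewrite normcM h normc_blaschke ?mulr1.
Qed.

Lemma bprod_conj N M t : bprod N M t * conjc (bprod N M t) = 1.
Proof. by rewrite mul_conjcE normc_bprod expr1n. Qed.

Lemma bprodS N M t : (N <= M)%N -> bprod N M.+1 t = blaschke (z M) t * bprod N M t.
Proof. by move=> NM; rewrite /bprod big_nat_recr //= mulrC. Qed.

Lemma bprod_geq N M t : (M <= N)%N -> bprod N M t = 1.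
Proof. by move=> NM; rewrite /bprod big_geq. Qed.

Lemma H2_bprod N M : H2 (bprod N M) /\
  forall w, normc w < 1 -> disk_ext (bprod N M) w = \prod_(N <= n < M) blaschke_factor (z n) w.
Proof.
have [MN|] := leqP M N.
  have -> : bprod N M = fun=> 1 by apply/funext => t; rewrite bprod_geq.
  by split=> [|w w1]; [exact: H2_1 | rewrite big_geq // disk_ext1].
have base : H2 (bprod N N) /\
  forall w, normc w < 1 -> disk_ext (bprod N N) w = \prod_(N <= n < N) blaschke_factor (z n) w.
  have -> : bprod N N = fun=> 1 by apply/funext => t; rewrite bprod_geq.
  by split=> [|w w1]; [exact: H2_1 | rewrite big_geq // disk_ext1].
elim: M => // M IH; rewrite ltnS => NM.
have {}IH : H2 (bprod N M) /\
  forall w, normc w < 1 -> disk_ext (bprod N M) w = \prod_(N <= n < M) blaschke_factor (z n) w.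
  by move: NM; rewrite leq_eqVlt => /orP[/eqP <- //|/IH].
have -> : bprod N M.+1 = fun t => blaschke (z M) t * bprod N M t.
  by apply/funext => t; rewrite bprodS.
have b1 t : normc (blaschke (z M) t) <= 1 by rewrite normc_blaschke.
split=> [|w w1]; first exact: (H2_mulb (H2_blaschke (hz M)) b1 IH.1).
rewrite (disk_ext_mulb (H2_blaschke (hz M)) b1 IH.1 w1) disk_ext_blaschke //.
by rewrite IH.2 // big_nat_recr //= mulrC.
Qed.

Lemma L2_bprod N M : L2 (bprod N M).
Proof. by case: (H2_bprod N M) => -[]. Qed.

(** The mean is the value at the origin, where the normalization of each factor makes it equal to
    [|z n|]. *)
Lemma mean_bprod N M : mean (bprod N M) = (\prod_(N <= n < M) normc (z n))%:C.
Proof.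
have [[Lb _] hb] := H2_bprod N M.
have <- : inner (bprod N M) (expin 0) = mean (bprod N M).
  by rewrite expin0E /inner; congr mean; apply/funext => t; rewrite conjc1 mulr1.
rewrite -fourierE fourier0E // hb ?normc0 // rmorph_prod; apply: eq_bigr => n _.
rewrite /blaschke_factor; have [->|z0] := eqVneq (z n) 0; first by rewrite normc0.
by rewrite subr0 mulr0 subr0 divr1 mulrVK ?unitfE // normr_normcE.
Qed.

Lemma bprod_dist N M : (N <= M)%N ->
  norm2 (fun t => bprod 0 M t - bprod 0 N t) ^+ 2 <=
  2 * \sum_(N <= n < M) (1 - normc (z n)).
Proof.
move=> NM; have LM := L2_bprod 0 M; have LN := L2_bprod 0 N.
have n1 K : norm2 (bprod 0 K) ^+ 2 = 1.
  rewrite norm2_sqrE; under eq_Rintegral do rewrite normc_bprod expr1n.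
  rewrite Rintegral_cst; last exact: measurable_angles.
  rewrite mul1r (congr1 fine (lebesgue_measure_angles R)) /=.
  by rewrite mulVf // gt_eqF // pi2_gt0.
(* The shorter product is unimodular, so it cancels against its conjugate and leaves the factors
   from [N] to [M]. *)
have iE : inner (bprod 0 M) (bprod 0 N) = (\prod_(N <= n < M) normc (z n))%:C.
  rewrite -mean_bprod; congr mean; apply/funext => t.
  rewrite {1}/bprod (big_cat_nat (leq0n N) NM) /=.
  by rewrite -/(bprod 0 N t) mulrAC bprod_conj mul1r.
have E : norm2 (fun t => bprod 0 M t - bprod 0 N t) ^+ 2 = norm2 (bprod 0 M) ^+ 2 +
    norm2 (bprod 0 N) ^+ 2 - 2 * complex.Re (inner (bprod 0 M) (bprod 0 N)).
  exact: (nrm_sqrB (ipL2 R) (inL2 LM) (inL2 LN)).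
rewrite E iE !n1 /=.
have [hp _] := @prod_ge_sum R (fun n => normc (z n)) N M
  (fun n => introT andP (conj (normc_ge0 (z n)) (ltW (hz n)))).
by lra.
Qed.

(* The partial products converge in [L^2] because
   [|B_M - B_N|^2 = 2 - 2 prod_(N <= n < M) |z_n|], and the limit has the same
   Taylor coefficients as [u]. *)
Lemma bprod_cvg : forall e : R, 0 < e -> exists N, forall n, (N <= n)%N ->
  norm2 (fun t => bprod 0 n t - u t) < e.
Proof.
have Lu : L2 u by case: Hu.
have cB e : 0 < e -> exists N, forall m n, (N <= m)%N -> (N <= n)%N ->
    norm2 (fun t => bprod 0 m t - bprod 0 n t) < e.
  move=> e0; have e2 : 0 < (e / 2) ^+ 2 / 2 by rewrite divr_gt0 // exprn_gt0 // divr_gt0.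
  have [|N hN] := nneseries_tail _ hsum e2.
    by move=> n; rewrite subr_ge0 ltW.
  have key m : (N <= m)%N -> norm2 (fun t => bprod 0 m t - bprod 0 N t) < e / 2.
    move=> Nm; rewrite -(@ltr_pXn2r _ 2) ?nnegrE ?norm2_ge0 ?divr_ge0 ?(ltW e0) //.
    apply: le_lt_trans (bprod_dist Nm) _; have := hN m Nm.
    by rewrite ltr_pdivlMr // mulrC.
  exists N => m n /key h1 /key h2.
  apply: le_lt_trans (norm2_tri (L2_bprod 0 m) (L2_bprod 0 n) (L2_bprod 0 N)) _.
  by rewrite (norm2C (L2_bprod 0 N) (L2_bprod 0 n)); lra.
have [B [LB hB]] := L2_complete (L2_bprod 0) cB.
have HB : H2 B := H2_limit (fun n => (H2_bprod 0 n).1) LB hB.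
have uB : aeeq (fun t => u t - B t) (fun=> 0).
  have HuB : H2 (fun t => u t - B t).
    by have := H2_lin (-1) HB Hu; under eq_fun do rewrite mulN1r addrC.
  apply: disk_ext_uniq => // w w1; have Lk := L2_kernel w1.
  rewrite disk_extE; [|by []|exact: L2B]; rewrite innerB // -!disk_extE //.
  apply/eqP; rewrite subr_eq0; apply/eqP; apply: (ccvg_uniq (hprod w1)).
  have := norm2_cvg_inner (L2_bprod 0) LB Lk hB; rewrite -disk_extE //.
  congr ccvg; apply/funext => n; rewrite -disk_extE //; last exact: L2_bprod.
  by rewrite (H2_bprod 0 n).2.
have n0 : norm2 (fun t => u t - B t) = 0 by apply/norm2_eq0 => //; exact: L2B.
move=> e /hB[N hN]; exists N => n /hN; apply: le_lt_trans.
apply: le_trans (norm2_tri (L2_bprod 0 n) Lu LB) _.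
by rewrite (norm2C LB Lu) n0 addr0.
Qed.

End BlaschkeProduct.

(** * Boundary modulus of a limit of unimodular functions *)

Section Unimodular.
Variable R : realType.
Local Notation mu := (@lebesgue_measure R).
Local Notation A := (angles R : set (measurableTypeR R)).

Lemma trig_bounded (g : R -> R[i]) : trig g -> exists C : R, forall t, normc (g t) <= C.
Proof.
elim=> [n|a g1 g2 _ [C1 h1] _ [C2 h2]]; first by exists 1 => t; rewrite normc_expin.
exists (normc a * C1 + C2) => t; apply: le_trans (le_normcD _ _) _.
by rewrite normcM lerD // ler_wpM2l ?normc_ge0.
Qed.

(* The functions [|f n|^2 = 1] converge to [|u|^2] weakly against
   trigonometric polynomials. *)
Lemma limit_unimodular (f : nat -> R -> R[i]) u : (forall n, L2 (f n)) -> L2 u ->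
  (forall n t, normc (f n t) = 1) ->
  (forall e : R, 0 < e -> exists N, forall n, (N <= n)%N -> norm2 (fun t => f n t - u t) < e) ->
  ae_on_circle (fun t => normc (u t) = 1).
Proof.
move=> Lf Lu f1 fu; have mA := @measurable_angles R.
have /L2P[mu_ iu] := Lu; have /L2P[_ i1] := L2_1 R.
have iF : mu.-integrable A (EFin \o (fun t => 1 - normc (u t) ^+ 2)).
  have -> : EFin \o (fun t => 1 - normc (u t) ^+ 2) =
      ((fun t => (normc (1 : R[i]) ^+ 2)%:E) \- (fun t => (normc (u t) ^+ 2)%:E))%E.
    by apply/funext => t; rewrite normc1 expr1n.
  exact: integrableB.
suff : ae_on_circle (fun t => 1 - normc (u t) ^+ 2 = 0).
  apply: ae_on_circleS => t /eqP; rewrite subr_eq0 eq_sym => /eqP h.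
  by apply/eqP; rewrite -(@eqrXn2 _ 2) ?normc_ge0 // h expr1n.
apply: rtrig_ortho_ae0 => // G tG.
have [C hC] := trig_bounded tG; have mG := cmeas_trig tG.
have C0 : 0 <= C := le_trans (normc_ge0 _) (hC 0).
have LG g : L2 g -> L2 (fun t => (G t)%:C * g t).
  by move=> Lg; exact: L2_mul_boundedC hC.
have nG g : L2 g -> norm2 (fun t => (G t)%:C * g t) <= C * norm2 g.
  by move=> Lg; have := norm2_mul_bounded Lg mG C0 hC; under eq_fun do rewrite mulrC.
have cG : ccvg (fun n => inner (fun t => (G t)%:C * f n t) (f n))
    (inner (fun t => (G t)%:C * u t) u).
  move=> e e0; pose D := C * (1 + norm2 u).
  have D0 : 0 <= D by rewrite mulr_ge0 // addr_ge0 ?norm2_ge0.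
  have D1 : 0 < D + 1 by rewrite ltr_wpDl.
  have [N hN] := fu _ (divr_gt0 e0 D1); exists N => n /hN.
  rewrite ltr_pdivlMr // => hlt; set d := (fun t => f n t - u t) in hlt.
  have Ld : L2 d by exact: L2B.
  have E : inner (fun t => (G t)%:C * f n t) (f n) - inner (fun t => (G t)%:C * u t) u =
     inner (fun t => (G t)%:C * d t) (f n) + inner (fun t => (G t)%:C * u t) d.
    have -> : (fun t => (G t)%:C * d t) = (fun t => (G t)%:C * f n t - (G t)%:C * u t).
      by apply/funext => t; rewrite /d mulrBr.
    rewrite innerB ?innerBr //; try exact: LG.
    by rewrite addrA subrK.
  have nf : norm2 (f n) <= 1.
    by apply: norm2_le_bound => // [|t]; [exact: L2_cmeas | rewrite f1].
  rewrite E; apply: le_lt_trans (le_normcD _ _) _.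
  have b1 := inner_CS (LG _ Ld) (Lf n); have b2 := inner_CS (LG _ Lu) Ld.
  have b3 := nG _ Ld; have b4 := nG _ Lu.
  have nd := norm2_ge0 d; have nu := norm2_ge0 u; have nfn := norm2_ge0 (f n).
  have b5 : norm2 (fun t => (G t)%:C * d t) * norm2 (f n) <= C * norm2 d * 1.
    by apply: ler_pM; rewrite ?norm2_ge0.
  have b6 : norm2 (fun t => (G t)%:C * u t) * norm2 d <= C * norm2 u * norm2 d.
    by apply: ler_wpM2r.
  have b7 : norm2 d * (D + 1) = C * norm2 d * 1 + C * norm2 u * norm2 d + norm2 d.
    by rewrite /D; ring.
  move: b1 b2 b5 b6 hlt; rewrite b7; move: (normc _) (normc _) (_ * norm2 (f n)) (_ * norm2 d).
  by move=> n1 n2 n3 n4; lra.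
have E1 : (fun n => inner (fun t => (G t)%:C * f n t) (f n)) =
    fun=> mean (fun t => (G t)%:C).
  apply/funext => n; congr mean; apply/funext => t.
  by rewrite -mulrA mul_conjcE f1 expr1n mulr1.
rewrite E1 in cG; have {cG} := ccvg_uniq (@ccvg_cst _ _) cG.
move=> /eqP; rewrite eq_complex => /andP[/eqP + _]; rewrite /inner /mean /=.
have p0 : (2 * pi : R)^-1 != 0 by rewrite invr_neq0 // gt_eqF // pi2_gt0.
move=> /(mulfI p0) => E2.
have iG : mu.-integrable A (EFin \o G).
  have [] : cint (fun t => (G t)%:C * 1 : R[i]).
    by apply: cint_mul; [exact: L2_trig | exact: L2_1].
  have -> : EFin \o G = fun t => (complex.Re ((G t)%:C * 1 : R[i]))%:E.
    by apply/funext => t; rewrite mulr1.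
  by [].
have iGu : mu.-integrable A (EFin \o (fun t => G t * normc (u t) ^+ 2)).
  have [h _] := cint_inner (LG _ Lu) Lu.
  have -> : EFin \o (fun t => G t * normc (u t) ^+ 2) =
      fun t => (complex.Re ((G t)%:C * u t * conjc (u t)))%:E.
    by apply/funext => t; rewrite -mulrA mul_conjcE -rmorphM.
  exact: h.
have -> : \int[mu]_(t in A) ((1 - normc (u t) ^+ 2) * G t) =
    \int[mu]_(t in A) (G t - G t * normc (u t) ^+ 2).
  by apply: eq_Rintegral => t _; ring.
rewrite (RintegralB mA iG iGu); apply/eqP; rewrite subr_eq0; apply/eqP.
rewrite E2; apply: eq_Rintegral => t _.
by rewrite -mulrA mul_conjcE -rmorphM.
Qed.

End Unimodular.

(** * The basis of reproducing kernels *)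

Section ModelSpace.
Variables (R : realType) (u v : R -> R[i]) (M : R).
Hypotheses (Hu : H2 u) (Hv : H2 v) (vM : forall t, normc (v t) <= M).
Hypothesis uv : aeeq u v.
Local Notation K := (model_space u).

Let mu_ : cmeas u. Proof. by apply: L2_cmeas; case: Hu. Qed.
Let mv : cmeas v. Proof. by apply: L2_cmeas; case: Hv. Qed.

Lemma L2_vmul h : L2 h -> L2 (fun t => v t * h t).
Proof. exact: L2_mulb. Qed.

(** Here [v] is a representative of [u] bounded at every angle, so that the lemmas on bounded
    multipliers apply to it; orthogonality does not see the change on a null set. *)
Lemma model_spaceP f : K f <-> H2 f /\ forall h, H2 h -> inner f (fun t => v t * h t) = 0.
Proof.
have E h : H2 f -> H2 h -> inner f (fun t => u t * h t) = inner f (fun t => v t * h t).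
  move=> [Lf _] [Lh _]; apply: inner_aer; rewrite ?(L2_cmeas Lf) //.
  - by apply: cmeasM => //; exact: L2_cmeas.
  - by apply: L2_cmeas; exact: L2_vmul.
  - exact: L2_cmeas.
  - by apply: ae_on_circleS uv => t ->.
split=> -[Hf hf]; split=> // h Hh.
  by rewrite -E // hf.
by rewrite E // hf.
Qed.

Lemma model_space_L2 : K `<=` @L2 R.
Proof. by move=> f [[]]. Qed.

Lemma subspace_model : subspace K.
Proof.
split=> [|a f g].
  apply/model_spaceP; split=> [|h [Lh _]]; first exact: H2_0.
  exact: (ip0l (ipL2 R) (inL2 (L2_vmul Lh))).
move=> /model_spaceP[Hf hf] /model_spaceP[Hg hg]; apply/model_spaceP.
split=> [|h Hh]; first exact: H2_lin.
have [Lf _] := Hf; have [Lg _] := Hg; have [Lh _] := Hh.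
have E := inner_lin a Lf Lg (L2_vmul Lh).
rewrite hf // hg // mulr0 addr0 in E; exact: E.
Qed.

Lemma hcomplete_model :
  hcomplete (subspace_ip (hK := subspace_model) (@inner R)).
Proof.
move=> f cf; pose g n := subspace_val (f n).
have Kg n : K (g n) := subspace_valP (f n).
have Lg n : L2 (g n) := model_space_L2 (Kg n).
have [l [Ll hl]] := @L2_complete R g Lg cf.
have Kl : K l.
  apply/model_spaceP; split; first by apply: (H2_limit _ Ll hl) => n; case: (Kg n).
  move=> h Hh; have Lvh : L2 (fun t => v t * h t) by apply: L2_vmul; case: Hh.
  apply: (ccvg_uniq (norm2_cvg_inner Lg Ll Lvh hl)).
  have -> : (fun n => inner (g n) (fun t => v t * h t)) = fun=> 0.
    by apply/funext => n; have /model_spaceP[_] := Kg n; exact.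
  exact: ccvg_cst.
by exists (exist _ l Kl).
Qed.

(** Pairing the kernel at [a] with [v h] gives the conjugate of the value of [v h] at [a], which
    contains the factor [disk_ext u a]. *)
Lemma model_kernel a : normc a < 1 -> disk_ext u a = 0 -> K (kernel a).
Proof.
move=> a1 ua; apply/model_spaceP; split=> [|h Hh]; first exact: H2_kernel.
have Lvh : L2 (fun t => v t * h t) by apply: L2_vmul; case: Hh.
rewrite (inner_conj Lvh (L2_kernel a1)) -disk_extE // (disk_ext_mulb Hv vM Hh a1).
by rewrite -(disk_ext_ae mu_ mv uv) ua mul0r conjc0.
Qed.

Lemma Hinfty_kernel (a : R[i]) : normc a < 1 -> Hinfty (kernel a).
Proof.
move=> a1; split; first exact: H2_kernel.
by exists (1 - normc a)^-1; apply: ae_on_circleW => t; exact: normc_kernel.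
Qed.

Section Zeros.
Variable z : nat -> R[i].
Hypothesis hz : forall n, normc (z n) < 1.
Hypothesis zinj : injective z.
Hypothesis v1 : ae_on_circle (fun t => normc (v t) = 1).
Hypothesis cvgB : forall e : R, 0 < e -> exists N, forall n, (N <= n)%N ->
  norm2 (fun t => bprod z 0 n t - v t) < e.

(* Dividing [f] by the partial products shows that [f * conj u] is in [H^2], hence
   that [f] is in [u H^2]. *)
Lemma model_space_zeros f : K f -> (forall n, disk_ext f (z n) = 0) -> norm2 f = 0.
Proof.
move=> Kf f0; have [Hf _] := Kf; have [Lf _] := Hf.
have step N : H2 (fun t => f t * conjc (bprod z 0 N t)) /\
    forall m, (N <= m)%N -> disk_ext (fun t => f t * conjc (bprod z 0 N t)) (z m) = 0.
  elim: N => [|N [IH1 IH2]].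
    have -> : (fun t => f t * conjc (bprod z 0 0 t)) = f.
      by apply/funext => t; rewrite bprod_geq // conjc1 mulr1.
    by split.
  have -> : (fun t => f t * conjc (bprod z 0 N.+1 t)) =
      (fun t => f t * conjc (bprod z 0 N t) * conjc (blaschke (z N) t)).
    by apply/funext => t; rewrite bprodS // conjcM (mulrC (conjc (blaschke _ _))) mulrA.
  have H0 := IH2 N (leqnn N); split; first exact: H2_div_blaschke.
  (* The zeros being distinct, the factor just divided out does not vanish at the later ones, so the
     quotient does. *)
  move=> m Nm; have zm : z m != z N by apply/eqP => /zinj e; rewrite e ltnn in Nm.
  have := disk_ext_div_blaschke (hz N) IH1 H0 (hz m).
  rewrite IH2 ?(ltnW Nm) // => /esym/eqP.
  by rewrite mulf_eq0 (negbTE (blaschke_factor_neq0 (hz N) (hz m) zm)) /= => /eqP.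
pose h t := f t * conjc (v t).
have mcv := cmeas_conj mv.
have vM' t : normc (conjc (v t)) <= M by rewrite normc_conj.
have Lh : L2 h := L2_mul_bounded Lf mcv vM'.
have Lv : L2 v by case: Hv.
have Hh : H2 h.
  split=> // n; rewrite fourierE /h inner_mulr.
  have mK : cmeas (@expin R (Negz n)) := cmeas_expin R _.
  have e1 t : normc (@expin R (Negz n) t) <= 1 by rewrite normc_expin.
  apply: normc_small0 => e e0; have f1 : 0 < norm2 f + 1 by rewrite ltr_wpDl ?norm2_ge0.
  have [N hN] := cvgB (divr_gt0 e0 f1); have {hN} := hN N (leqnn N).
  rewrite ltr_pdivlMr // => hlt.
  have LB : L2 (bprod z 0 N) := L2_bprod hz 0 N.
  have Lve : L2 (fun t => conjc (conjc (v t)) * expin (Negz n) t).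
    by under eq_fun do rewrite conjcK; exact: L2_mul_bounded e1.
  have LBe : L2 (fun t => conjc (conjc (bprod z 0 N t)) * expin (Negz n) t).
    by under eq_fun do rewrite conjcK; exact: L2_mul_bounded e1.
  have B0 : inner f (fun t => conjc (conjc (bprod z 0 N t)) * expin (Negz n) t) = 0.
    by rewrite -inner_mulr -fourierE; case: (step N) => -[_ ->].
  rewrite -normcN -sub0r -B0 -innerBr //.
  have Ld := L2B LB Lv.
  have -> : (fun t => conjc (conjc (bprod z 0 N t)) * expin (Negz n) t -
      conjc (conjc (v t)) * expin (Negz n) t) =
      (fun t => (bprod z 0 N t - v t) * expin (Negz n) t).
    by apply/funext => t; rewrite !conjcK mulrBl.
  apply: le_trans (inner_CS Lf (L2_mul_bounded Ld mK e1)) _.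
  apply: le_trans (_ : norm2 f * (1 * norm2 (fun t => bprod z 0 N t - v t)) <= _).
    by rewrite ler_wpM2l ?norm2_ge0 // norm2_mul_bounded.
  rewrite mul1r mulrC; apply: le_trans (ltW hlt).
  by rewrite ler_wpM2l ?norm2_ge0 // lerDl.
(* As [h] is in [H^2] and [v h = f] almost everywhere, [f] is orthogonal to itself. *)
have /model_spaceP[_ /(_ h Hh)] := Kf.
have vhf : aeeq (fun t => v t * h t) f.
  by apply: ae_on_circleS v1 => t vt; rewrite /h mulrCA mul_conjcE vt expr1n mulr1.
have Lvh := L2_vmul Lh.
rewrite (inner_aer (L2_cmeas Lvh) (L2_cmeas Lf) (L2_cmeas Lf) vhf) /norm2 => ->.
by rewrite sqrtr0.
Qed.

End Zeros.

End ModelSpace.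

Section KernelBasis.
Variables (R : realType) (u : R -> R[i]) (z : nat -> R[i]).
Local Notation K := (model_space u).
Hypothesis hK : subspace K.
Local Notation H := (subspace_type hK).
Local Notation ip := (subspace_ip (hK := hK) (@inner R)).
Hypothesis KH2 : forall f, K f -> H2 f.
Hypothesis Hcomp : hcomplete ip.
Hypothesis hz : forall n, normc (z n) < 1.
Hypothesis Kk : forall n, K (kernel (z n)).
Hypothesis zeros : forall f, K f -> (forall n, disk_ext f (z n) = 0) -> norm2 f = 0.
Hypothesis interp : forall w : nat -> R[i], (exists M : R, forall n, normc (w n) <= M) ->
  exists psi (M : R), [/\ H2 psi, forall t, normc (psi t) <= M &
    forall n, disk_ext psi (z n) = w n].

Let KL2 f (Kf : K f) : L2 f := proj1 (KH2 Kf).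

Lemma semi_ip_model : semi_ip ip.
Proof. by apply: semi_ip_inner => f; exact: KL2. Qed.
Let ipH := semi_ip_model.

Definition kernel_norm n : R := norm2 (kernel (z n)).

Lemma kernel_norm_gt0 n : 0 < kernel_norm n.
Proof.
rewrite lt_def norm2_ge0 andbT; apply/eqP => k0.
have Lk := L2_kernel (hz n); have := inner_CS Lk Lk; rewrite -/(kernel_norm n) k0 mul0r.
rewrite -disk_extE // disk_ext_kernel // => h.
have : normc (1 - conjc (z n) * z n)^-1 = 0.
  by apply/eqP; rewrite eq_le h normc_ge0.
move=> /eqP; rewrite normc_eq0 invr_eq0; apply/negP.
exact: blaschke_denom_neq0.
Qed.

Definition unit_kernel n : H :=
  ((kernel_norm n)^-1)%:C *: (exist _ (kernel (z n)) (Kk n) : H).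

Lemma inner_unit_kernel f n : L2 f ->
  inner f (subspace_val (unit_kernel n)) = ((kernel_norm n)^-1)%:C * disk_ext f (z n).
Proof.
move=> Lf; have Lk := L2_kernel (hz n); rewrite disk_extE //.
have := innerZr ((kernel_norm n)^-1)%:C Lk Lf.
by rewrite conjc_real.
Qed.

Lemma ip_unit_kernel (f : H) n :
  ip f (unit_kernel n) = ((kernel_norm n)^-1)%:C * disk_ext (subspace_val f) (z n).
Proof. by apply: inner_unit_kernel; apply: KL2; exact: subspace_valP. Qed.

Lemma nrm_unit_kernel n : hnorm ip (unit_kernel n) = 1.
Proof.
rewrite /unit_kernel (nrmZ ipH) normc_real gtr0_norm ?invr_gt0 ?kernel_norm_gt0 //.
by rewrite -[X in _ * X]/(kernel_norm n) mulVf // gt_eqF // kernel_norm_gt0.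
Qed.

Lemma inner_val_sum (h : R -> R[i]) (e : nat -> H) n (c : nat -> R[i]) : L2 h ->
  inner h (subspace_val (\sum_(i < n) c i *: e i)) =
  \sum_(i < n) conjc (c i) * inner h (subspace_val (e i)).
Proof.
move=> Lh; have LH (x : H) : L2 (subspace_val x) by apply: KL2; exact: subspace_valP.
elim: n => [|n IH].
  by rewrite !big_ord0; exact: (ip0r (ipL2 R) (inL2 Lh)).
rewrite !big_ord_recr /= -IH; set S := \sum_(i < n) _.
have := ipDr (ipL2 R) (inL2 (LH S)) (c n *: inL2 (LH (e n))) (inL2 Lh).
by rewrite (ipZr (ipL2 R)).
Qed.

(* The adjoint of multiplication by an interpolating [psi] acts diagonally on
   the kernels. *)
Lemma multiplier_unconditional (psi : R -> R[i]) (M : R) : H2 psi ->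
  (forall t, normc (psi t) <= M) -> forall n (c : nat -> R[i]),
  hnorm ip (\sum_(i < n) (conjc (disk_ext psi (z i)) * c i) *: unit_kernel i) <=
  M * hnorm ip (\sum_(i < n) c i *: unit_kernel i).
Proof.
move=> Hp pM n c; set G := \sum_(i < n) (_ * _) *: _; set F := \sum_(i < n) _ *: _.
have HG := KH2 (subspace_valP G); have LG : L2 (subspace_val G) by case: HG.
have LF : L2 (subspace_val F) by apply: KL2; exact: subspace_valP.
have LpG := L2_mulb Hp pM LG.
have E : ip G G = inner (fun t => psi t * subspace_val G t) (subspace_val F).
  rewrite /subspace_ip {2}/G /F.
  rewrite (inner_val_sum unit_kernel n (fun i => conjc (disk_ext psi (z i)) * c i) LG).
  rewrite (inner_val_sum unit_kernel n c LpG); apply: eq_bigr => i _.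
  rewrite (inner_unit_kernel i LG) (inner_unit_kernel i LpG).
  rewrite (disk_ext_mulb Hp pM HG (hz i)) conjcM conjcK.
  by move: (disk_ext _ _) (disk_ext _ _) => x y; ring.
have [->|G0] := eqVneq (hnorm ip G) 0.
  rewrite mulr_ge0 ?nrm_ge0 //; exact: le_trans (normc_ge0 _) (pM 0).
have Gp : 0 < hnorm ip G by rewrite lt_def G0 nrm_ge0.
rewrite -(ler_pM2r Gp) -expr2 (nrm_sqr ipH) E.
apply: le_trans (Re_le_normc _) _; apply: le_trans (inner_CS LpG LF) _.
rewrite mulrAC; apply: ler_wpM2r; first exact: norm2_ge0.
exact: (norm2_mulb Hp pM LG).
Qed.

(** Uniform boundedness is applied to seminorms indexed by the finite combinations of norm at most
    [1]. For a fixed sequence [w] they are bounded thanks to a function interpolating the conjugates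
    of [w], since the adjoint multiplier has the conjugate values on the diagonal. *)
Lemma unit_kernel_unconditional : exists2 C : R, 0 < C &
  forall n (c w : nat -> R[i]), (forall i, normc (w i) <= 1) ->
  hnorm ip (\sum_(i < n) (w i * c i) *: unit_kernel i) <=
  C * hnorm ip (\sum_(i < n) c i *: unit_kernel i).
Proof.
pose F n (c : nat -> R[i]) := \sum_(i < n) c i *: unit_kernel i.
pose J := {nc : nat * (nat -> R[i]) | hnorm ip (F nc.1 nc.2) <= 1}.
pose q (j : J) (w : nat -> R[i]) :=
  hnorm ip (F (sval j).1 (fun i => w i * (sval j).2 i)).
have pw (w : nat -> R[i]) : (exists M : R, forall n, normc (w n) <= M) ->
    exists2 B : R, 0 <= B & forall n c, hnorm ip (F n (fun i => w i * c i)) <= B * hnorm ip (F n c).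
  move=> [M wM]; have [|psi [B [Hp pB pw]]] := interp (w := fun n => conjc (w n)).
    by exists M => n; rewrite normc_conj.
  exists B; first exact: le_trans (normc_ge0 _) (pB 0).
  move=> n c; have h := multiplier_unconditional Hp pB n c; rewrite /F.
  by under eq_bigr => i _ do rewrite -[w i]conjcK -pw.
have [||||C hC] := @uniform_boundedness R J q.
- move=> j w w'; rewrite /q /F; apply: le_trans (nrmD ipH _ _); rewrite -big_split /=.
  by rewrite le_eqVlt; apply/orP; left; apply/eqP; congr hnorm; apply: eq_bigr => i _;
    rewrite mulrDl scalerDl.
- move=> j r w; rewrite /q /F -(normc_real r) -(nrmZ ipH) scaler_sumr; congr hnorm.
  by apply: eq_bigr => i _; rewrite -mulrA -scalerA.
- move=> j; exists (\sum_(i < (sval j).1) normc ((sval j).2 i)) => w w1; rewrite /q /F.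
  elim: (sval j).1 => [|n IH]; first by rewrite !big_ord0 (nrm0 ipH).
  rewrite !big_ord_recr /=; apply: le_trans (nrmD ipH _ _) _; apply: lerD => //.
  by rewrite (nrmZ ipH) nrm_unit_kernel mulr1 normcM ler_piMl ?normc_ge0.
- move=> w /pw[B B0 hB]; exists B => j; apply: le_trans (hB _ _) _.
  by rewrite -[leRHS]mulr1 ler_wpM2l //; exact: (svalP j).
exists (`|C| + 1); first by rewrite ltr_wpDl.
move=> n c w w1; rewrite -/(F n c) -/(F n (fun i => w i * c i)).
have C1 : C <= `|C| + 1 by have := ler_norm C; lra.
(* A null combination cannot be normalized; for it the bound depending on [w] is enough, whatever
   its constant. *)
have [F0|F0] := eqVneq (hnorm ip (F n c)) 0.
  have [|B _ hB] := pw w; first by exists 1.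
  by have := hB n c; rewrite F0 !mulr0.
have Fp : 0 < hnorm ip (F n c) by rewrite lt_def F0 nrm_ge0.
set r := hnorm ip (F n c) in F0 Fp *.
have scale (c' : nat -> R[i]) :
    hnorm ip (F n (fun i => (r^-1)%:C * c' i)) = r^-1 * hnorm ip (F n c').
  rewrite -[X in X * _]gtr0_norm ?invr_gt0 // -(normc_real r^-1) -(nrmZ ipH) /F scaler_sumr.
  by congr hnorm; apply: eq_bigr => i _; rewrite -scalerA.
have hj : hnorm ip (F (n, fun i => (r^-1)%:C * c i).1 (n, fun i => (r^-1)%:C * c i).2) <= 1.
  by rewrite /= scale mulVf.
have := hC (exist _ (n, fun i => (r^-1)%:C * c i) hj) w w1; rewrite /q /=.
have -> : (fun i => w i * ((r^-1)%:C * c i)) = (fun i => (r^-1)%:C * (w i * c i)).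
  by apply/funext => i; rewrite mulrCA.
rewrite scale ler_pdivrMl // mulrC => h; apply: le_trans h _.
by rewrite ler_wpM2r // ltW.
Qed.

Lemma unit_kernel_total (f : H) : (forall n, ip f (unit_kernel n) = 0) -> hnorm ip f = 0.
Proof.
move=> f0; apply: zeros; first exact: subspace_valP.
move=> n; have /eqP := f0 n; rewrite ip_unit_kernel mulf_eq0.
have -> : ((kernel_norm n)^-1%:C == 0 :> R[i]) = false.
  by rewrite -normc_eq0 normc_real normr_eq0 invr_eq0 gt_eqF // kernel_norm_gt0.
by move=> /eqP.
Qed.

Theorem unit_kernel_riesz_basis : exists2 C : R, 0 < C &
  [/\ forall f N, \sum_(i < N) normc (ip f (unit_kernel i)) ^+ 2 <= C ^+ 2 * hnorm ip f ^+ 2,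
    forall f (B : R), 0 <= B ->
      (forall N, \sum_(i < N) normc (ip f (unit_kernel i)) ^+ 2 <= B ^+ 2) ->
      hnorm ip f <= C * B,
    forall (c : nat -> R[i]) (B : R), 0 <= B ->
      (forall N, \sum_(i < N) normc (c i) ^+ 2 <= B ^+ 2) ->
      exists g, forall n, ip g (unit_kernel n) = c n &
    forall f, exists p : nat -> {poly R[i]}, hcvg ip (fun n => lincomb unit_kernel (p n)) f].
Proof.
have [C C0 hC] := unit_kernel_unconditional.
have up := unconditional_upper ipH nrm_unit_kernel hC.
have lo := unconditional_lower ipH nrm_unit_kernel hC.
exists C => //; split.
- by move=> f N; refine (coord_bessel ipH up f N).
- move=> f B B0 hB.
  by have [] := coord_lower_dense ipH Hcomp C0 lo unit_kernel_total B0 hB.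
- move=> c B B0 hB; have [g [hg _ _]] := coord_surj ipH Hcomp C0 lo B0 hB.
  by exists g.
- by move=> f; refine (coord_dense ipH Hcomp C0 up lo unit_kernel_total f).
Qed.

End KernelBasis.

(** * Compact positive operators *)

(** Linearity up to null vectors, the counterpart of linearity up to almost everywhere equality in
    [bounded_op]. *)
Definition hlin (R : realType) (H : lmodType R[i]) (ip : H -> H -> R[i]) (T : H -> H) :=
  forall (a : R[i]) f g, hnorm ip (T (a *: f + g) - (a *: T f + T g)) = 0.

Definition hbounded (R : realType) (H : lmodType R[i]) (ip : H -> H -> R[i]) (T : H -> H) :=
  exists M : R, forall f, hnorm ip (T f) <= M * hnorm ip f.

Section LinearOperators.
Variables (R : realType) (H : lmodType R[i]) (ip : H -> H -> R[i]).
Hypothesis ipH : semi_ip ip.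
Local Notation nrm := (hnorm ip).

Section Operator.
Variable T : H -> H.
Hypotheses (Tl : hlin ip T) (Tb : hbounded ip T).

Lemma hlin_ip (a : R[i]) f g h : ip (T (a *: f + g)) h = a * ip (T f) h + ip (T g) h.
Proof. by rewrite -(ip_lin ipH); exact: (nrm_eq0_eq ipH h (Tl a f g)). Qed.

Lemma hlin_sub f g : nrm (T f - T g) = nrm (T (f - g)).
Proof.
have h := Tl (-1) g f; rewrite !scaleN1r in h.
by rewrite (addrC f) (addrC (T f)); apply/esym/(nrm_eq0_nrm ipH).
Qed.

Lemma hlin0 : nrm (T 0) = 0.
Proof. by rewrite -(subrr 0) -hlin_sub subrr (nrm0 ipH). Qed.

Lemma hlin_eqv f g : nrm (f - g) = 0 -> nrm (T f - T g) = 0.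
Proof.
move=> fg; have [M hM] := Tb; rewrite hlin_sub; apply/eqP; rewrite eq_le nrm_ge0 andbT.
by have := hM (f - g); rewrite fg mulr0.
Qed.

Lemma hlin_sum (I : Type) (r : seq I) (P : pred I) (c : I -> R[i]) (e : I -> H) h :
  ip (T (\sum_(i <- r | P i) c i *: e i)) h =
  \sum_(i <- r | P i) c i * ip (T (e i)) h.
Proof.
elim/big_rec2: _ => [|i x y _ <-]; last by rewrite hlin_ip.
by rewrite ip_null // hlin0.
Qed.

Lemma hbounded_cvg (f : nat -> H) g : hcvg ip f g -> hcvg ip (fun n => T (f n)) (T g).
Proof.
have [M0 hM0] := Tb; pose M := `|M0| + 1.
have Mp : 0 < M by rewrite ltr_wpDl.
move=> fg e e0; have [N hN] := fg _ (divr_gt0 e0 Mp); exists N => n /hN.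
rewrite ltr_pdivlMr // hlin_sub; apply: le_lt_trans.
apply: le_trans (hM0 _) _; rewrite mulrC; apply: ler_wpM2l; first exact: nrm_ge0.
by have := ler_norm M0; rewrite /M; lra.
Qed.

End Operator.

Section PositiveOperator.
Variable A : H -> H.
Hypotheses (Al : hlin ip A) (Ab : hbounded ip A) (Ap : forall f, 0 <= ip (A f) f).

(** Positivity forces hermitian symmetry by polarization: the imaginary part of the form at
    [c *: g + f] vanishes, and the choices [c = 1] and [c = 'i] compare the imaginary and the real
    parts of [ip (A f) g] and [ip (A g) f]. *)
Lemma semi_ip_positive : semi_ip (fun f g => ip (A f) g).
Proof.
split=> [a f g h|f g|f]; [exact: hlin_ip| |exact: Ap].
have q (c : R[i]) : complex.Im (conjc c * ip (A f) g + c * ip (A g) f) = 0.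
  have /ger0_Im := Ap (c *: g + f); rewrite (hlin_ip Al) (ipDr ipH) (ipZr ipH).
  rewrite (ipDr ipH) (ipZr ipH) !complex_ImD.
  have /ger0_Im i1 := Ap f.
  have i2 : complex.Im (c * (conjc c * ip (A g) g)) = 0.
    rewrite mulrA mul_conjcE complex_ImM /= mul0r addr0.
    by have /ger0_Im -> := Ap g; rewrite mulr0.
  rewrite mulrDr complex_ImD i1 i2 addr0 add0r => <-.
  by rewrite addrC.
have := q 1; have := q 'i; rewrite conjc1 !mul1r.
case: (ip (A f) g) (ip (A g) f) => x y [x' y'] /=.
move=> h1 h2; apply/eqP; rewrite eq_complex /=; apply/andP; split; apply/eqP; lra.
Qed.

Lemma positive_sa f g : ip (A f) g = ip f (A g).
Proof. by rewrite (ip_conj semi_ip_positive g f) -(ip_conj ipH). Qed.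

(* Cauchy-Schwarz for the form [<A f, g>], applied to [f] and [A f]. *)
Lemma positive_norm_le (M : set H) (l : R) : 0 <= l -> (forall f, M f -> M (A f)) ->
  (forall f, M f -> complex.Re (ip (A f) f) <= l * nrm f ^+ 2) ->
  forall f, M f -> nrm (A f) ^+ 2 <= l * complex.Re (ip (A f) f).
Proof.
move=> l0 MA Ml f Mf; have MAf := MA f Mf.
have h := Re_ip_le semi_ip_positive f (A f); rewrite -(nrm_sqr ipH) in h.
have x0 := nrm_ge0 (fun f g => ip (A f) g) f.
have y0 := nrm_ge0 (fun f g => ip (A f) g) (A f).
have xE := nrm_sqr semi_ip_positive f; have yE := nrm_sqr semi_ip_positive (A f).
have yl := Ml _ MAf; rewrite -yE in yl; rewrite -xE.
move: h x0 y0 yl; set n := nrm (A f); set x := hnorm _ f; set y := hnorm _ (A f).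
have n0 : 0 <= n by exact: nrm_ge0.
move=> h x0 y0 yl.
have [->|nn] := eqVneq n 0; first by rewrite expr0n mulr_ge0 // sqr_ge0.
have np : 0 < n ^+ 2 by rewrite exprn_gt0 // lt_def nn.
rewrite -(ler_pM2r np); apply: le_trans (_ : x ^+ 2 * y ^+ 2 <= _).
  by rewrite -expr2 -exprMn ler_pXn2r // ?nnegrE ?sqr_ge0 ?mulr_ge0.
have -> : l * x ^+ 2 * n ^+ 2 = x ^+ 2 * (l * n ^+ 2) by ring.
by rewrite ler_wpM2l ?sqr_ge0.
Qed.

(** Unit vectors [f n] of [M] nearly maximizing the Rayleigh quotient are nearly eigenvectors.
    Compactness makes [A (f (k n))] converge, hence also [f (k n)], because [l] is positive; the
    limit stays in [M], which is closed, and is an eigenvector. *)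
Lemma rayleigh_max (M : set H) : hcompact ip A ->
  (forall f, M f -> M (A f)) -> (forall (a : R[i]) f, M f -> M (a *: f)) ->
  (forall (f : nat -> H) g, (forall n, M (f n)) -> hcvg ip f g -> M g) ->
  (exists2 f, M f & 0 < complex.Re (ip (A f) f)) ->
  exists v (l : R), [/\ M v, nrm v = 1, 0 < l, nrm (A v - l%:C *: v) = 0 &
    forall f, M f -> complex.Re (ip (A f) f) <= l * nrm f ^+ 2].
Proof.
move=> Ac MA MZ Mc [f0 Mf0 hf0]; have [B0 hB0] := Ab.
pose S := [set complex.Re (ip (A f) f) | f in [set f | M f /\ nrm f = 1]].
have ipAZ (a : R[i]) f : complex.Re (ip (A (a *: f)) (a *: f)) =
    normc a ^+ 2 * complex.Re (ip (A f) f).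
  have := nrmZ semi_ip_positive a f; move=> /(congr1 (fun x => x ^+ 2)).
  by rewrite exprMn !(nrm_sqr semi_ip_positive).
have n_gt0 f : 0 < complex.Re (ip (A f) f) -> 0 < nrm f.
  move=> h; rewrite lt_def nrm_ge0 andbT; apply/eqP => n0; move: h.
  rewrite (ip_conj ipH f) (ip_null ipH) // conjc0 ltxx //.
have normalize f : M f -> 0 < nrm f -> S (complex.Re (ip (A f) f) / nrm f ^+ 2).
  move=> Mf fp; exists ((nrm f)^-1%:C *: f); last first.
    by rewrite ipAZ normc_real ger0_norm ?invr_ge0 ?nrm_ge0 // exprVn mulrC.
  split; first exact: MZ.
  by rewrite (nrmZ ipH) normc_real ger0_norm ?invr_ge0 ?nrm_ge0 // mulVf // gt_eqF.
have hS : has_sup S.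
  split; first by exists (complex.Re (ip (A f0) f0) / nrm f0 ^+ 2); exact/normalize/n_gt0.
  exists `|B0| => _ [f [Mf f1] <-]; apply: le_trans (Re_ip_le ipH _ _) _.
  by rewrite f1 mulr1; apply: le_trans (hB0 f) _; rewrite f1 mulr1 ler_norm.
pose l := sup S.
have lS f : M f -> nrm f = 1 -> complex.Re (ip (A f) f) <= l.
  by move=> Mf f1; apply: ub_le_sup; [case: hS | exists f].
have l0 : 0 < l.
  apply: lt_le_trans (_ : complex.Re (ip (A f0) f0) / nrm f0 ^+ 2 <= _).
    by rewrite divr_gt0 // exprn_gt0 // n_gt0.
  by apply: ub_le_sup; [case: hS | exact/normalize/n_gt0].
have lM f : M f -> complex.Re (ip (A f) f) <= l * nrm f ^+ 2.
  move=> Mf; have [h|h] := leP (complex.Re (ip (A f) f)) 0.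
    by apply: le_trans h _; rewrite mulr_ge0 ?sqr_ge0 // ltW.
  have fp := n_gt0 f h; rewrite -ler_pdivrMr ?exprn_gt0 //.
  by apply: ub_le_sup; [case: hS | exact: normalize].
have An f := positive_norm_le (ltW l0) MA lM (f := f).
have /choice[f hf] : forall n : nat, exists f, [/\ M f, nrm f = 1 &
    l - n.+1%:R^-1 < complex.Re (ip (A f) f)].
  move=> n; have n0 : 0 < (n.+1%:R^-1 : R) by rewrite invr_gt0 ltr0n.
  by have [_ [g [Mg g1] <-] hg] := sup_adherent n0 hS; exists g.
(* With [x] the Rayleigh quotient of [f n], the square is [l ^+ 2 + |A f|^2 - 2 * l * x]; since
   [|A f|^2 <= l * x], it is at most [l * (l - x)]. *)
have fw n : nrm (l%:C *: f n - A (f n)) ^+ 2 <= l * n.+1%:R^-1.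
  have [Mf f1 hn] := hf n; have h := An _ Mf.
  rewrite (nrm_sqrB ipH) (nrmZ ipH) f1 mulr1 normc_real (gtr0_norm l0) (ipZl ipH).
  rewrite -(positive_sa (f n)); move: hn h; case: (ip (A (f n)) (f n)) => x y /=.
  by rewrite mul0r subr0; move: (n.+1%:R^-1) (nrm (A (f n)) ^+ 2) => e r; nra.
have [|k [g [kh kg]]] := Ac f; first by exists 1 => n; case: (hf n) => _ -> _.
have kge n : (n <= k n)%N.
  by elim: n => // n IH; apply: leq_ltn_trans IH _; apply: kh.
pose v := (l^-1)%:C *: g.
have lv : l%:C *: v = g by rewrite scalerA -rmorphM /= divff ?gt_eqF // scale1r.
have cv : hcvg ip (fun n => f (k n)) v.
  move=> e e0; have e1 : 0 < l * e / 2 by rewrite divr_gt0 // mulr_gt0.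
  have e2 : 0 < (l * e / 2) ^+ 2 / l by rewrite divr_gt0 // exprn_gt0.
  have [N1 hN1] := kg _ e1; have [N2 hN2] := inv_succ_small e2.
  exists (maxn N1 N2) => n; rewrite geq_max => /andP[/hN1 h1 nN2].
  have h2 : nrm (l%:C *: f (k n) - A (f (k n))) < l * e / 2.
    rewrite -(@ltr_pXn2r _ 2) ?nnegrE ?nrm_ge0 ?(ltW e1) //.
    apply: le_lt_trans (fw _) _; rewrite mulrC -ltr_pdivlMr //.
    by apply: hN2; apply: leq_trans nN2 (kge n).
  have : nrm (l%:C *: f (k n) - g) < l * e.
    by apply: le_lt_trans (nrm_tri ipH (A (f (k n))) _ _) _; lra.
  by rewrite -{1}lv -scalerBr (nrmZ ipH) normc_real gtr0_norm // ltr_pM2l.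
have Mv : M v by apply: Mc cv => n; case: (hf (k n)).
have v1 : nrm v = 1.
  apply/eqP; rewrite eq_le; apply/andP; split.
    by apply: (hcvg_nrm ipH cv) => n; case: (hf (k n)) => _ -> _.
  apply/ler_addgt0Pr => e /cv[N hN]; have := hN N (leqnn N).
  have := nrm_leB ipH (f (k N)) v; case: (hf (k N)) => _ -> _; lra.
exists v, l; split => //; rewrite lv.
exact: (hcvg_uniq ipH (hbounded_cvg Al Ab cv) kg).
Qed.

End PositiveOperator.

End LinearOperators.

(** * Comparison of sequences by counting *)

Lemma seq_min (R : realType) (a : nat -> R) (F : seq nat) : F != [::] ->
  exists2 x, x \in F & forall y, y \in F -> a x <= a y.
Proof.
elim: F => // x F IH _; have [->|/IH [y yF hy]] := eqVneq F [::].
  by exists x; rewrite ?mem_head // => y; rewrite inE => /eqP ->.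
have [xy|yx] := leP (a x) (a y).
  exists x; first exact: mem_head.
  by move=> w; rewrite inE => /orP[/eqP -> //|/hy]; exact: le_trans.
exists y; first by rewrite inE yF orbT.
by move=> w; rewrite inE => /orP[/eqP ->|/hy //]; exact: ltW.
Qed.

(** A homogeneous linear system with fewer equations, indexed by [G], than unknowns, indexed by [F]:
    the matrix has a nonzero left kernel. *)
Lemma kernel_seq (K : fieldType) (F G : seq nat) (b : nat -> nat -> K) :
  uniq F -> (size G < size F)%N ->
  exists c : nat -> K, (exists2 n, n \in F & c n != 0) /\
    forall k, k \in G -> \sum_(n <- F) c n * b n k = 0.
Proof.
move=> uF GF; pose B := \matrix_(i < size F, j < size G) b (nth 0%N F i) (nth 0%N G j).
have : kermx B != 0.
  rewrite -mxrank_eq0 mxrank_ker subn_eq0 -ltnNge.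
  exact: leq_ltn_trans (rank_leq_col B) GF.
case/rowV0Pn => v /sub_kermxP vB v0.
have [i vi] : exists i, v 0 i != 0.
  apply/existsP; apply: contraR v0 => /existsPn h; apply/eqP/rowP => i.
  by rewrite mxE; apply/eqP; rewrite -[_ == _]negbK; exact: h.
pose c n := if insub (index n F) is Some j then v 0 j else 0.
have cE (j : 'I_(size F)) : c (nth 0%N F j) = v 0 j.
  by rewrite /c index_uniq // valK.
exists c; split; first by exists (nth 0%N F i); rewrite ?mem_nth ?cE.
move=> k kG; have hk : (index k G < size G)%N by rewrite index_mem.
have := congr1 (fun M : 'rV_(size G) => M 0 (Ordinal hk)) vB; rewrite !mxE => h.
rewrite -[RHS]h (big_nth 0%N) big_mkord; apply: eq_bigr => j _.
by rewrite cE mxE /= nth_index.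
Qed.

Lemma ler_sum_uniq (R : realType) (f : nat -> R) (G : seq nat) M :
  (forall n, 0 <= f n) -> uniq G -> (forall n, n \in G -> (n < M)%N) ->
  \sum_(n <- G) f n <= \sum_(n < M) f n.
Proof.
move=> f0 uG GM; rewrite -(big_mkord xpredT f).
rewrite (perm_big [seq n <- index_iota 0 M | n \in G]) /=; last first.
  apply: uniq_perm => //; first by rewrite filter_uniq // iota_uniq.
  by move=> n; rewrite mem_filter mem_index_iota; case: (boolP (n \in G)) => // /GM ->.
rewrite big_filter big_mkcond; apply: ler_sum => n _; by case: ifP.
Qed.

(* Listing a finite set of indices by decreasing values of [a], one injects it
   greedily into indices where [b] is at least [c] times as large. *)
Lemma ellp_comparison (R : realType) (r c : R) (a b : nat -> R) :
  0 < r -> 0 < c -> (forall n, 0 <= a n) -> (forall n, 0 <= b n) ->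
  (forall (l : R) F G, 0 < l -> uniq F -> (forall n, n \in F -> l <= a n) ->
    (size G < size F)%N -> exists2 n, n \notin G & c * l <= b n) ->
  ellp r%:E b -> ellp r%:E a.
Proof.
move=> r0 c0 a0 b0 hab; rewrite /ellp => hb.
have bE n : `|b n| `^ r = b n `^ r by rewrite ger0_norm.
have aE n : `|a n| `^ r = a n `^ r by rewrite ger0_norm.
have greedy m : forall F, size F = m -> uniq F -> (forall n, n \in F -> 0 < a n) ->
    exists G, [/\ uniq G, size G = m &
      c `^ r * \sum_(n <- F) a n `^ r <= \sum_(n <- G) b n `^ r].
  elim: m => [F /size0nil -> _ _|m IH F Fm uF Fp].
    by exists [::]; split => //; rewrite !big_nil mulr0.
  (* The smallest value is matched last: all of [F] lies above the level [a x], and the indices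
     already used are one fewer than [F], so the hypothesis provides a new one. *)
  have [|x xF hx] := @seq_min R a F; first by case: F Fm {uF Fp}.
  have [G [uG Gm hG]] : exists G, [/\ uniq G, size G = m &
      c `^ r * \sum_(n <- rem x F) a n `^ r <= \sum_(n <- G) b n `^ r].
    apply: IH; rewrite ?rem_uniq ?size_rem ?Fm // => n /mem_rem; exact: Fp.
  have [|n nG hn] := hab (a x) F G (Fp _ xF) uF hx; first by rewrite Gm Fm.
  exists (n :: G); split; rewrite /= ?uG ?nG ?Gm //.
  rewrite (perm_big _ (perm_to_rem xF)) !big_cons mulrDr; apply: lerD hG.
  rewrite -powRM ?(ltW c0) //; apply: ge0_ler_powR; rewrite ?(ltW r0) ?nnegrE //.
  by rewrite mulr_ge0 // ltW.
pose B := fine (\sum_(0 <= n <oo) (b n `^ r)%:E)%E.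
have hB N : \sum_(n < N) b n `^ r <= B.
  have E : (\sum_(0 <= n <oo) (`|b n| `^ r)%:E)%E = (\sum_(0 <= n <oo) (b n `^ r)%:E)%E.
    by apply: eq_eseriesr => n _; rewrite bE.
  rewrite E in hb; have b1 : (0 <= \sum_(0 <= n <oo) (b n `^ r)%:E)%E.
    by apply: nneseries_ge0 => n _ _; rewrite lee_fin powR_ge0.
  rewrite -lee_fin fineK ?ge0_fin_numE // -sumEFin -(big_mkord xpredT (fun i => (b i `^ r)%:E)).
  apply: nneseries_lim_ge => n _ _; by rewrite lee_fin powR_ge0.
have cr : 0 < c `^ r by rewrite powR_gt0.
have hA N : \sum_(n < N) a n `^ r <= B / c `^ r.
  (* The levels must be positive; the indices left out contribute zero to the sum, as [r] is
     positive. *)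
  pose F := [seq n <- index_iota 0 N | 0 < a n].
  have [||G [uG _ hG]] := greedy (size F) F erefl.
  - by rewrite filter_uniq // iota_uniq.
  - by move=> n; rewrite mem_filter => /andP[].
  rewrite ler_pdivlMr // mulrC; apply: le_trans (le_trans hG _).
    rewrite big_filter ler_wpM2l ?(ltW cr) // big_mkord [leRHS]big_mkcond.
    apply: ler_sum => n _; case: ifPn => //; rewrite -leNgt => an.
    have -> : a n = 0 by apply/eqP; rewrite eq_le an a0.
    by rewrite powR0 // gt_eqF.
  pose M := (\max_(n <- G) n).+1.
  apply: le_trans (hB M); apply: ler_sum_uniq => // [n|n nG]; first exact: powR_ge0.
  by rewrite ltnS; exact: leq_bigmax_seq.
apply: le_lt_trans (ltry (B / c `^ r)).
apply: lime_le; first by apply: is_cvg_nneseries => n _ _; rewrite lee_fin powR_ge0.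
apply: nearW => N /=; rewrite big_mkord sumEFin lee_fin.
by under eq_bigr do rewrite aE.
Qed.

Lemma conjc_sum (R : realType) (I : Type) (r : seq I) (P : pred I) (F : I -> R[i]) :
  conjc (\sum_(i <- r | P i) F i) = \sum_(i <- r | P i) conjc (F i).
Proof. exact: rmorph_sum. Qed.

Lemma eqCR (R : realType) (a b : R) : (a%:C == b%:C :> R[i]) = (a == b).
Proof. by rewrite eq_complex /= eqxx andbT. Qed.

(** * Counting singular values against diagonal entries *)

Section SingularValueCount.
Variables (R : realType) (H : lmodType R[i]) (ip : H -> H -> R[i]).
Hypothesis ipH : semi_ip ip.
Local Notation nrm := (hnorm ip).
Variable A : H -> H.
Hypotheses (Al : hlin ip A) (Ab : hbounded ip A) (Ap : forall f, 0 <= ip (A f) f).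
Variables (s : nat -> R) (E : nat -> H).
Hypothesis eigen : forall n, 0 < s n -> nrm (A (E n) - (s n)%:C *: E n) = 0.
Hypothesis indep : forall (l : R) F (c : nat -> R[i]), 0 < l -> uniq F ->
  (forall n, n \in F -> s n = l) -> nrm (\sum_(n <- F) c n *: E n) = 0 ->
  forall n, n \in F -> c n = 0.
Hypothesis span : forall (l : R) f, 0 < l -> nrm (A f - l%:C *: f) = 0 ->
  exists (F : seq nat) (c : nat -> R[i]), (forall n, n \in F -> s n = l) /\
    nrm (f - \sum_(n <- F) c n *: E n) = 0.

Lemma eigen_ip (l : R) v f : nrm (A v - l%:C *: v) = 0 -> ip (A f) v = l%:C * ip f v.
Proof.
move=> h; rewrite (positive_sa ipH Al Ap) (ip_conj ipH (A v)).
by rewrite (nrm_eq0_eq ipH f h) (ipZl ipH) conjcM -(ip_conj ipH) conjc_real.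
Qed.

Lemma eigen_orth (l m : R) v w : l != m -> nrm (A v - l%:C *: v) = 0 ->
  nrm (A w - m%:C *: w) = 0 -> ip v w = 0.
Proof.
move=> lm hv hw; have := eigen_ip v hw; rewrite (nrm_eq0_eq ipH w hv) (ipZl ipH).
move/eqP; rewrite -subr_eq0 -mulrBl mulf_eq0 -rmorphB => /orP[|/eqP //].
by rewrite -[0]/((0 : R)%:C) eqCR subr_eq0 (negPf lm).
Qed.

(** The operator expands the span of eigenvectors with eigenvalues at least [l] by at least [l]. The
    second claim is independence across eigenvalues; it ensures that a nonzero choice of
    coefficients gives a vector of positive norm. *)
Lemma eigen_combination (F : seq nat) (c : nat -> R[i]) (l : R) : 0 < l ->
  uniq F -> (forall n, n \in F -> l <= s n) ->
  let f := \sum_(n <- F) c n *: E n in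
  l * nrm f <= nrm (A f) /\ (nrm f = 0 -> forall n, n \in F -> c n = 0).
Proof.
move=> l0 uF Fl f.
have sp n : n \in F -> 0 < s n by move/Fl; exact: lt_le_trans.
have orth n m : n \in F -> m \in F -> s n != s m -> ip (E n) (E m) = 0.
  by move=> nF mF nm; apply: eigen_orth nm (eigen _) (eigen _); exact: sp.
split.
  (* [|A f|^2 = l^2 |f|^2 + |g|^2], the eigenvectors with distinct eigenvalues
     being orthogonal. *)
  pose w n := (Num.sqrt (s n ^+ 2 - l ^+ 2))%:C.
  pose g := \sum_(n <- F) (w n * c n) *: E n.
  have ipE (a b : nat -> R[i]) : ip (\sum_(n <- F) a n *: E n) (\sum_(n <- F) b n *: E n) =
      \sum_(n <- F) \sum_(m <- F) a n * conjc (b m) * ip (E n) (E m).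
    rewrite (ip_suml ipH); apply: eq_bigr => n _.
    rewrite (ip_sumr ipH); apply: eq_bigr => m _.
    by rewrite (ipZl ipH) (ipZr ipH) mulrA.
  have Af : ip (A f) (A f) = \sum_(n <- F) \sum_(m <- F)
      c n * conjc (c m) * (s n * s m)%:C * ip (E n) (E m).
    rewrite (hlin_sum ipH Al); apply: eq_big_seq => n nF.
    rewrite (nrm_eq0_eq ipH _ (eigen (sp n nF))) (ipZl ipH).
    rewrite (ip_conj ipH (A f)) (hlin_sum ipH Al) conjc_sum !mulr_sumr.
    apply: eq_big_seq => m mF; rewrite (nrm_eq0_eq ipH _ (eigen (sp m mF))) (ipZl ipH).
    by rewrite !conjcM conjc_real -(ip_conj ipH) rmorphM; ring.
  have : ip (A f) (A f) = (l ^+ 2)%:C * ip f f + ip g g.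
    rewrite Af /f /g !ipE mulr_sumr -big_split; apply: eq_big_seq => n nF /=.
    rewrite mulr_sumr -big_split; apply: eq_big_seq => m mF /=.
    (* Vectors with the same eigenvalue may fail to be orthogonal, but [w] depends only on the
       eigenvalue, so for such a pair [w n * w m] is still [s n * s m - l ^+ 2]; the other pairs
       contribute zero. *)
    have [e|ne] := eqVneq (s n) (s m); last by rewrite (orth n m) // !mulr0 addr0.
    have -> : w n * c n * conjc (w m * c m) * ip (E n) (E m) =
       (w n * w m) * (c n * conjc (c m) * ip (E n) (E m)).
      by rewrite conjcM conjc_real; ring.
    have -> : w n * w m = (s n * s m - l ^+ 2)%:C.
      apply/eqP; rewrite /w -e eq_complex /= !(mul0r, mulr0) subr0 addr0 eqxx andbT.
      rewrite -!expr2 sqr_sqrtr // subr_ge0 ler_pXn2r ?nnegrE ?(ltW l0) ?Fl //.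
      exact/ltW/sp.
    by rewrite rmorphB; ring.
  rewrite !(ip_self ipH) -rmorphM -rmorphD => /eqP; rewrite eqCR => /eqP h.
  rewrite -(@ler_pXn2r _ 2) ?nnegrE ?mulr_ge0 ?nrm_ge0 ?(ltW l0) //.
  by rewrite h exprMn lerDl sqr_ge0.
(* The part of [f] belonging to the eigenvalue [s n] is orthogonal to the remaining part, hence null
   together with [f], and [indep] applies inside this eigenspace. *)
move=> f0 n nF; pose FF := [seq m <- F | s m == s n].
have FFs m : m \in FF -> s m = s n by rewrite mem_filter => /andP[/eqP].
have uFF : uniq FF by rewrite filter_uniq.
have nFF : n \in FF by rewrite mem_filter eqxx.
apply: (indep (sp n nF) uFF FFs _ nFF).
set g := \sum_(_ <- FF) _; have : ip f g = ip g g.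
  rewrite /f (bigID (fun m => s m == s n)) /= (ipDl ipH) -big_filter -/FF -/g.
  rewrite [X in _ + X](ip_suml ipH) big_seq_cond big1 ?addr0 // => m /andP[mF mn].
  rewrite (ipZl ipH) (ip_sumr ipH) big_seq big1 ?mulr0 // => k.
  rewrite mem_filter => /andP[/eqP kn kF].
  by rewrite (ipZr ipH) orth ?mulr0 // kn.
rewrite (ip_null ipH _ f0) (ip_self ipH) => /eqP.
by rewrite eq_sym -[0]/((0 : R)%:C) eqCR sqrf_eq0 => /eqP.
Qed.

Variables (e : nat -> H) (K : R).
Hypothesis K0 : 0 < K.
Hypothesis coord_le : forall f N,
  \sum_(i < N) normc (ip f (e i)) ^+ 2 <= K ^+ 2 * nrm f ^+ 2.
Hypothesis coord_ge : forall f (B : R), 0 <= B ->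
  (forall N, \sum_(i < N) normc (ip f (e i)) ^+ 2 <= B ^+ 2) -> nrm f <= K * B.
Hypothesis coord_ex : forall (c : nat -> R[i]) (B : R), 0 <= B ->
  (forall N, \sum_(i < N) normc (c i) ^+ 2 <= B ^+ 2) ->
  exists g, forall n, ip g (e n) = c n.
Variables (d : nat -> R[i]) (T : H -> H).
Hypothesis hT : forall f n, ip (T f) (e n) = d n * ip f (e n).
Hypothesis TA : forall f, nrm (T f) = nrm (A f).
Let c := (2 * K ^+ 2)^-1.

(* Some nonzero combination [f] of the [E n], [n] in [F], has zero coordinates on
   [G], and [l |f| <= |A f| = |T f|]. *)
Lemma multiplier_count (l : R) F G : 0 < l -> uniq F ->
  (forall n, n \in F -> l <= s n) -> (size G < size F)%N ->
  exists2 n, n \notin G & c * l <= normc (d n).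
Proof.
move=> l0 uF Fl GF; apply: contrapT => no.
have dG n : n \notin G -> normc (d n) <= c * l.
  by move=> nG; rewrite leNgt; apply/negP => h; apply: no; exists n => //; exact: ltW.
have [a [[n nF an] ha]] := kernel_seq (fun n k => ip (E n) (e k)) uF GF.
pose f := \sum_(n <- F) a n *: E n.
have [f1 f2] := eigen_combination a l0 uF Fl.
have fp : 0 < nrm f.
  rewrite lt_def nrm_ge0 andbT; apply/eqP => /f2 /(_ n nF) /eqP.
  by rewrite (negPf an).
have fG k : k \in G -> ip f (e k) = 0.
  move=> /ha h; rewrite (ip_suml ipH) -[RHS]h; apply: eq_bigr => m _.
  by rewrite (ipZl ipH).
have c0 : 0 < c by rewrite invr_gt0 mulr_gt0 // exprn_gt0.
have cl0 : 0 <= c * l by rewrite ltW // mulr_gt0.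
have : nrm (T f) <= K * (c * l * (K * nrm f)).
  apply: coord_ge; first by rewrite mulr_ge0 // mulr_ge0 ?nrm_ge0 // ltW.
  move=> N; rewrite exprMn; apply: le_trans
    (_ : (c * l) ^+ 2 * \sum_(i < N) normc (ip f (e i)) ^+ 2 <= _); last first.
    by rewrite ler_wpM2l ?sqr_ge0 // exprMn.
  rewrite mulr_sumr; apply: ler_sum => i _; rewrite hT normcM exprMn.
  have [/fG -> |/dG h] := boolP (nat_of_ord i \in G).
    by rewrite normc0 expr0n !mulr0.
  by rewrite ler_wpM2r ?sqr_ge0 // ler_pXn2r // nnegrE normc_ge0.
(* By the choice of [c], the upper bound for [nrm (T f)] is half of the lower bound [l * nrm f]. *)
have -> : K * (c * l * (K * nrm f)) = l * nrm f / 2.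
  by rewrite /c; field; rewrite gt_eqF.
by rewrite TA; have := mulr_gt0 l0 fp; move: f1; rewrite -/f; lra.
Qed.

Hypothesis Ac : hcompact ip A.

(* Some nonzero combination [f] of the dual vectors of [F] is orthogonal to the
   [E n], [n] in [G]; if these include all eigenvectors for eigenvalues at least
   [c l], then [|T f| = |A f| <= c l |f|] by the variational principle. *)
Lemma singular_value_count (l : R) F G : 0 < l -> uniq F ->
  (forall n, n \in F -> l <= normc (d n)) -> (size G < size F)%N ->
  exists2 n, n \notin G & c * l <= s n.
Proof.
move=> l0 uF Fl GF; apply: contrapT => no.
have c0 : 0 < c by rewrite invr_gt0 mulr_gt0 // exprn_gt0.
have cl0 : 0 < c * l by rewrite mulr_gt0.
have sG n : c * l <= s n -> n \in G.
  by move=> h; apply: contrapT => /negP nG; apply: no; exists n.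
have /choice[g hg] := dual_vector coord_ge coord_ex.
have [a [[n nF an] ha]] := kernel_seq (fun n k => ip (g n) (E k)) uF GF.
pose f := \sum_(n <- F) a n *: g n.
have fE k : k \in G -> ip f (E k) = 0.
  move=> /ha h; rewrite (ip_suml ipH) -[RHS]h; apply: eq_bigr => m _.
  by rewrite (ipZl ipH).
have fe k : k \notin F -> ip f (e k) = 0.
  move=> kF; rewrite (ip_suml ipH) big_seq big1 // => m mF; rewrite (ipZl ipH).
  have [_ _ ->] := hg m; rewrite ?mulr0 //.
  by apply: contraNneq kF => ->.
have fn : ip f (e n) = a n.
  rewrite (ip_suml ipH) (perm_big _ (perm_to_rem nF)) big_cons (ipZl ipH).
  have [_ -> _] := hg n; rewrite mulr1 big_seq big1 => [|m]; first exact: addr0.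
  rewrite mem_rem_uniq // inE => /andP[mn _]; rewrite (ipZl ipH).
  by have [_ _ ->] := hg m; rewrite ?mulr0 // eq_sym.
have fp : 0 < nrm f.
  rewrite lt_def nrm_ge0 andbT; apply/eqP => f0; move: an.
  by rewrite -fn (ip_null ipH) // eqxx.
have f_le : nrm f <= K * (l^-1 * (K * nrm (T f))).
  apply: coord_ge.
    by rewrite !mulr_ge0 ?nrm_ge0 ?invr_ge0 ?(ltW l0) ?(ltW K0).
  move=> N; rewrite exprMn; apply: le_trans
    (_ : (l^-1) ^+ 2 * \sum_(i < N) normc (ip (T f) (e i)) ^+ 2 <= _); last first.
    by rewrite ler_wpM2l ?sqr_ge0 // exprMn.
  rewrite mulr_sumr; apply: ler_sum => i _; rewrite hT normcM exprMn.
  have [/Fl h|/fe ->] := boolP (nat_of_ord i \in F); last first.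
    by rewrite normc0 expr0n !mulr0.
  rewrite mulrA -exprMn ler_peMl ?sqr_ge0 // exprn_ege1 //.
  by rewrite mulrC ler_pdivlMr // mul1r.
(* [M] is described by all eigenvectors for eigenvalues at least [c * l], not only by the listed
   ones, so that no maximizer of the Rayleigh quotient on [M] can have such an eigenvalue. That [f]
   belongs to it follows from [span]. *)
pose M := [set h : H | forall (m : R) v, c * l <= m ->
   nrm (A v - m%:C *: v) = 0 -> ip h v = 0].
have Mf : M f.
  move=> m v hm hv; have m0 : 0 < m := lt_le_trans cl0 hm.
  have [F' [b [F's hb]]] := span m0 hv; rewrite (ip_conj ipH v).
  rewrite (nrm_eq0_eq ipH f hb) (ip_suml ipH) big_seq big1 ?conjc0 // => k /F's kE.
  by rewrite (ipZl ipH) (ip_conj ipH f) fE ?conjc0 ?mulr0 // sG // kE.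
have MA h : M h -> M (A h).
  by move=> hM m v hm hv; rewrite (eigen_ip h hv) (hM m v) // mulr0.
have MZ (b : R[i]) h : M h -> M (b *: h).
  by move=> hM m v hm hv; rewrite (ipZl ipH) (hM m v) // mulr0.
have Mc (u : nat -> H) h : (forall n, M (u n)) -> hcvg ip u h -> M h.
  move=> uM uh m v hm hv; apply/eqP; rewrite -normc_eq0 eq_le normc_ge0 andbT.
  apply/ler_addgt0Pr => eps eps0; have [N hN] := hcvg_ip ipH v uh eps0.
  have := hN N (leqnn N); rewrite (uM N m v) // sub0r normcN add0r.
  exact: ltW.
(* [m] is the maximal Rayleigh quotient on [M], or [0] if the form is nowhere positive there. If it
   exceeded [c * l], the maximizer would be orthogonal to itself. *)
suff [m [m0 mc hm]] : exists m : R, [/\ 0 <= m, m <= c * l & forall h, M h ->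
    complex.Re (ip (A h) h) <= m * nrm h ^+ 2].
  have h1 := positive_norm_le ipH Al Ap m0 MA hm Mf.
  have h2 := hm _ Mf.
  have Af : nrm (A f) <= c * l * nrm f.
    rewrite -(@ler_pXn2r _ 2) ?nnegrE ?mulr_ge0 ?nrm_ge0 ?(ltW l0) ?(ltW c0) //.
    apply: le_trans h1 _; apply: le_trans (ler_wpM2l m0 h2) _.
    rewrite mulrA exprMn ler_wpM2r ?sqr_ge0 // -expr2.
    by rewrite ler_pXn2r // nnegrE // ltW.
  rewrite TA in f_le; have : K * (l^-1 * (K * nrm (A f))) <= nrm f / 2.
    have -> : nrm f / 2 = K * (l^-1 * (K * (c * l * nrm f))).
      by rewrite /c; field; rewrite !gt_eqF.
    by rewrite !ler_wpM2l ?invr_ge0 ?(ltW l0) ?(ltW K0).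
  by lra.
have [pos|/forallNP npos] := pselect (exists h, M h /\ 0 < complex.Re (ip (A h) h)).
  have [h Mh hp] : exists2 h, M h & 0 < complex.Re (ip (A h) h).
    by case: pos => h [h1 h2]; exists h.
  have [v [m [Mv v1 m0 hv hm]]] := rayleigh_max ipH Al Ab Ap Ac MA MZ Mc (ex_intro2 _ _ h Mh hp).
  exists m; split => //; first exact: ltW.
  rewrite leNgt; apply/negP => /ltW cm; have := Mv m v cm hv.
  rewrite (ip_self ipH) v1 expr1n => /eqP.
  by rewrite -[0]/((0 : R)%:C) eqCR oner_eq0.
exists 0; split => //; first exact: ltW.
move=> h Mh; rewrite mul0r leNgt; apply/negP => hp.
by apply: (npos h).
Qed.

End SingularValueCount.

Definition hdim (R : realType) (H : lmodType R[i]) (ip : H -> H -> R[i])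
    (V : set H) (d : nat) :=
  exists e : 'I_d -> H, [/\ forall i, V (e i),
    forall c : 'I_d -> R[i], hnorm ip (\sum_(i < d) c i *: e i) = 0 ->
      forall i, c i = 0 &
    forall f, V f -> exists c : 'I_d -> R[i],
      hnorm ip (f - \sum_(i < d) c i *: e i) = 0].

Definition heigen (R : realType) (H : lmodType R[i]) (ip : H -> H -> R[i])
    (A : H -> H) (l : R[i]) : set H := [set f | hnorm ip (A f - l *: f) = 0].

Definition eigen_listing (R : realType) (H : lmodType R[i]) (ip : H -> H -> R[i])
    (A : H -> H) (s : nat -> R) :=
  forall l : R, 0 < l -> exists2 d : nat, hdim ip (heigen ip A l%:C) d &
    ([set n | s n = l] #= `I_d)%card.

Section Eigenvectors.
Variables (R : realType) (H : lmodType R[i]) (ip : H -> H -> R[i]).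
Local Notation nrm := (hnorm ip).

(** For every [l] a basis of the eigenspace is carried over to the indices [n] with [s n = l] by the
    bijection that comes with the listing. The choice is made for all [l] at once, and [E n] reads
    it at [l = s n]. *)
Lemma eigen_listing_vectors (A : H -> H) (s : nat -> R) :
  eigen_listing ip A s -> exists E : nat -> H,
  [/\ forall n, 0 < s n -> nrm (A (E n) - (s n)%:C *: E n) = 0,
      forall (l : R) F (c : nat -> R[i]), 0 < l -> uniq F ->
        (forall n, n \in F -> s n = l) -> nrm (\sum_(n <- F) c n *: E n) = 0 ->
        forall n, n \in F -> c n = 0 &
      forall (l : R) f, 0 < l -> nrm (A f - l%:C *: f) = 0 ->
        exists (F : seq nat) (c : nat -> R[i]), (forall n, n \in F -> s n = l) /\
          nrm (f - \sum_(n <- F) c n *: E n) = 0].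
Proof.
move=> hs.
pose P (l : R) (x : nat * (nat -> H) * (nat -> nat)) := 0 < l ->
  let: (d, e, g) := x in
  [/\ forall i, (i < d)%N -> nrm (A (e i) - l%:C *: e i) = 0,
    forall c : nat -> R[i], nrm (\sum_(i < d) c i *: e i) = 0 ->
      forall i, (i < d)%N -> c i = 0,
    forall f, nrm (A f - l%:C *: f) = 0 -> exists c : nat -> R[i],
      nrm (f - \sum_(i < d) c i *: e i) = 0 &
    set_bij [set n | s n = l] `I_d g].
have /choice[w hw] : forall l, exists x, P l x.
  move=> l; have [l0|l0] := ltP 0 l; last first.
    by exists (0%N, fun=> 0, id) => /(le_lt_trans l0); rewrite ltxx.
  have [d [e [e1 e2 e3]] /card_set_bijP[g hg]] := hs l l0.
  exists (d, fun i => if insub i is Some j then e j else 0, g) => _.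
  have eE (c : nat -> R[i]) : \sum_(i < d) c i *:
      (if insub (nat_of_ord i) is Some j then e j else 0) = \sum_(i < d) c i *: e i.
    by apply: eq_bigr => i _; rewrite valK.
  split => //.
  - move=> i id; rewrite insubT; exact: e1.
  - by move=> c; rewrite eE => /e2 h i id; exact: (h (Ordinal id)).
  - move=> f /e3[c hc]; exists (fun i => if insub i is Some j then c j else 0).
    rewrite (eE (fun i => if insub i is Some j then c j else 0)); move: hc; congr (nrm (_ - _) = 0).
    by apply: eq_bigr => i _; rewrite valK.
pose E n := (w (s n)).1.2 ((w (s n)).2 n).
exists E; split.
- move=> n sn; have := hw _ sn; rewrite /E; case: (w (s n)) => [[d e] g] /=.
  by case=> h1 _ _ [fg _ _]; apply: h1; exact: fg.
- move=> l F c l0 uF Fl; have := hw _ l0.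
  have EE n : n \in F -> E n = (w l).1.2 ((w l).2 n) by move/Fl => <-.
  case: (w l) EE => [[d e] g] /= EE [h1 h2 h3 [gd gi gs]].
  pose a i := \sum_(n <- F | g n == i) c n.
  have -> : \sum_(n <- F) c n *: E n = \sum_(i < d) a i *: e i.
    under [RHS]eq_bigr do rewrite /a scaler_suml big_mkcond.
    rewrite exchange_big; apply: eq_big_seq => n nF; rewrite EE //.
    have gn : (g n < d)%N by apply: gd => /=; exact: Fl.
    rewrite (bigD1 (Ordinal gn)) //= eqxx big1 ?addr0 // => i.
    by rewrite -val_eqE /= eq_sym => /negPf ->.
  move=> /h2 a0 n nF; have gn : (g n < d)%N by apply: gd => /=; exact: Fl.
  rewrite -(a0 _ gn) /a (perm_big _ (perm_to_rem nF)) big_cons eqxx.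
  rewrite big_seq_cond big1 => [|m]; first by rewrite /= addr0.
  rewrite mem_rem_uniq // inE => /andP[/andP[mn mF] /eqP mg]; case/eqP: mn.
  by apply: gi mg; rewrite inE /=; exact: Fl.
- move=> l f l0 hf; have := hw _ l0.
  have EE n : s n = l -> E n = (w l).1.2 ((w l).2 n) by move=> <-.
  case: (w l) EE => [[d e] g] /= EE [h1 h2 h3 [gd gi gs]].
  have [c hc] := h3 f hf.
  have /choice[nn hnn] : forall i : 'I_d, exists n, s n = l /\ g n = i.
    by move=> i; have [n] := gs i (ltn_ord i); exists n.
  exists [seq nn i | i <- enum 'I_d], (c \o g); split.
    by move=> n /mapP[i _ ->]; case: (hnn i).
  rewrite big_map; move: hc; congr (nrm (_ - _) = 0).
  rewrite big_enum /=; apply: eq_bigr => i _; have [a b] := hnn i.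
  by rewrite (EE _ a) b.
Qed.

Hypotheses (ipH : semi_ip ip) (Hc : hcomplete ip).

Lemma adjoint_ex (T : H -> H) : hlin ip T -> hbounded ip T ->
  exists S : H -> H, [/\ hlin ip S, hbounded ip S &
    forall f g, ip (T f) g = ip f (S g)].
Proof.
move=> Tl [M0 hM0]; pose M := `|M0|.
have hM f : nrm (T f) <= M * nrm f.
  by apply: le_trans (hM0 f) _; rewrite ler_wpM2r ?nrm_ge0 // ler_norm.
have /choice[S hS] : forall g, exists h, (forall f, ip (T f) g = ip f h) /\
    nrm h <= M * nrm g.
  move=> g; have [||||h [h1 h2 _]] := riesz ipH Hc (W := H) (J := id)
    (L := fun f => ip (T f) g) (B := M * nrm g); last by exists h.
  - by [].
  - by move=> a v w; rewrite (hlin_ip ipH Tl).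
  - by apply: mulr_ge0; [exact: normr_ge0 | exact: nrm_ge0].
  - move=> f; apply: le_trans (cauchy_schwarz ipH _ _) _.
    by rewrite mulrAC ler_wpM2r ?nrm_ge0.
exists S; split; last by move=> f g; case: (hS g).
  move=> a f g; apply: (nrm_null (ip := ip)) => h; rewrite (ipBl ipH) (ip_lin ipH).
  rewrite !(ip_conj ipH h) -!(hS _).1 (ipDr ipH) (ipZr ipH).
  by rewrite conjcD conjcM conjcK subrr.
by exists M => f; case: (hS f).
Qed.

Lemma abs_op_norm (T S A : H -> H) : hlin ip A ->
  (forall f, 0 <= ip (A f) f) -> (forall f g, ip (T f) g = ip f (S g)) ->
  (forall f, nrm (A (A f) - S (T f)) = 0) -> forall f, nrm (T f) = nrm (A f).
Proof.
move=> Al Ap TS AS f; have : ip (T f) (T f) = ip (A f) (A f).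
  rewrite TS (positive_sa ipH Al Ap) (ip_conj ipH _ f).
  by rewrite -(nrm_eq0_eq ipH f (AS f)) -(ip_conj ipH).
rewrite !(ip_self ipH) => /eqP; rewrite eqCR => /eqP h.
by apply/eqP; rewrite -(@eqrXn2 _ 2) ?nrm_ge0 // h.
Qed.

Lemma same_norm_compact (T A : H -> H) : hlin ip T -> hlin ip A ->
  (forall f, nrm (T f) = nrm (A f)) -> hcompact ip T -> hcompact ip A.
Proof.
move=> Tl Al TA Tc f fM; have [k [g [kh kg]]] := Tc f fM.
have [e e0|h hh] := Hc (f := fun n => A (f (k n))); last by exists k, h.
have [N hN] := hcvg_cauchy ipH kg e0; exists N => m n mN nN.
by have := hN m n mN nN; rewrite (hlin_sub ipH Tl) (hlin_sub ipH Al) TA.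
Qed.

End Eigenvectors.

(** * Spectral decomposition and square root of a compact positive operator *)

Section CompactPositiveRoot.
Variables (R : realType) (H : lmodType R[i]) (ip : H -> H -> R[i]).
Hypotheses (ipH : semi_ip ip) (Hc : hcomplete ip).
Local Notation nrm := (hnorm ip).
Variable C : H -> H.
Hypotheses (Cl : hlin ip C) (Cb : hbounded ip C) (Cp : forall f, 0 <= ip (C f) f).
Hypothesis Cc : hcompact ip C.

(** The Rayleigh quotient is maximized on the orthogonal complement of [L]. If the form is nowhere
    positive there, the pair [(0, 0)] is returned, so that the construction can go on forever. *)
Lemma next_eigenvector (L : seq H) :
  (forall w, w \in L -> exists m : R, nrm (C w - m%:C *: w) = 0) ->
  exists x : H * R, [/\ forall w, w \in L -> ip x.1 w = 0, 0 <= x.2,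
    nrm (C x.1 - x.2%:C *: x.1) = 0, ip x.1 x.1 = (0 < x.2)%R%:R &
    forall f, (forall w, w \in L -> ip f w = 0) ->
      complex.Re (ip (C f) f) <= x.2 * nrm f ^+ 2].
Proof.
move=> eigL; pose M := [set f : H | forall w, w \in L -> ip f w = 0].
have MC f : M f -> M (C f).
  move=> Mf w wL; have [m hm] := eigL w wL.
  by rewrite (eigen_ip ipH Cl Cp f hm) Mf // mulr0.
have MZ (a : R[i]) f : M f -> M (a *: f).
  by move=> Mf w wL; rewrite (ipZl ipH) Mf // mulr0.
have Mc (f : nat -> H) g : (forall n, M (f n)) -> hcvg ip f g -> M g.
  move=> Mf fg w wL; apply/eqP; rewrite -normc_eq0 eq_le normc_ge0 andbT.
  apply/ler_addgt0Pr => e e0; have [N hN] := hcvg_ip ipH w fg e0.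
  by have := hN N (leqnn N); rewrite Mf // sub0r normcN add0r => /ltW.
have [pos|/forallNP npos] := pselect (exists h, M h /\ 0 < complex.Re (ip (C h) h)).
  have [h Mh hp] : exists2 h, M h & 0 < complex.Re (ip (C h) h).
    by case: pos => h [h1 h2]; exists h.
  have [v [l [Mv v1 l0 hv hl]]] :=
    rayleigh_max ipH Cl Cb Cp Cc MC MZ Mc (ex_intro2 _ _ h Mh hp).
  exists (v, l); split => //=; first exact: ltW.
  by rewrite (ip_self ipH) v1 expr1n l0.
exists (0, 0); split => //= [w _|||f Mf].
- exact: ip0l.
- by rewrite scaler0 subr0 (hlin0 ipH Cl).
- by rewrite (ip0l ipH) ltxx.
- by rewrite mul0r leNgt; apply/negP => h; apply: (npos f).
Qed.

(* The vectors are orthonormal except that, once the spectrum is exhausted, the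
   remaining ones are [0] with eigenvalue [0]. *)
Lemma greedy_eigenvectors : exists (v : nat -> H) (lam : nat -> R),
  [/\ forall m n, ip (v m) (v n) = ((m == n) && (0 < lam m)%R)%:R,
    forall n, nrm (C (v n) - (lam n)%:C *: v n) = 0, forall n, 0 <= lam n,
    forall n f, (forall k, (k < n)%N -> ip f (v k) = 0) ->
      complex.Re (ip (C f) f) <= lam n * nrm f ^+ 2 & rcvg lam 0].
Proof.
pose P (L : seq H) (x : H * R) :=
  (forall w, w \in L -> exists m : R, nrm (C w - m%:C *: w) = 0) ->
  [/\ forall w, w \in L -> ip x.1 w = 0, 0 <= x.2,
    nrm (C x.1 - x.2%:C *: x.1) = 0, ip x.1 x.1 = (0 < x.2)%R%:R &
    forall f, (forall w, w \in L -> ip f w = 0) ->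
      complex.Re (ip (C f) f) <= x.2 * nrm f ^+ 2].
have /choice[nx hnx] : forall L, exists x, P L x.
  move=> L; have [h|h] := pselect (forall w, w \in L -> exists m : R, nrm (C w - m%:C *: w) = 0).
    by have [x hx] := next_eigenvector h; exists x.
  by exists (0, 0) => /h.
pose Ls n := iter n (fun L => (nx L).1 :: L) [::].
pose v n := (nx (Ls n)).1; pose lam n := (nx (Ls n)).2.
have LsS n : Ls n.+1 = v n :: Ls n by [].
have vLs k n : (k < n)%N -> v k \in Ls n.
  elim: n => // n IH; rewrite ltnS leq_eqVlt LsS inE => /orP[/eqP ->|/IH ->].
    by rewrite eqxx.
  by rewrite orbT.
have Lsv n w : w \in Ls n -> exists2 k, (k < n)%N & w = v k.
  elim: n => // n IH; rewrite LsS inE => /orP[/eqP ->|/IH[k kn ->]]; first by exists n.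
  by exists k => //; exact: ltnW.
have eigLs n w : w \in Ls n -> exists m : R, nrm (C w - m%:C *: w) = 0.
  elim: n w => // n IH w; rewrite LsS inE => /orP[/eqP ->|/IH //].
  by have [_ _ h _ _] := hnx (Ls n) IH; exists (lam n).
have h n := hnx (Ls n) (@eigLs n).
have orth m n : (m < n)%N -> ip (v n) (v m) = 0.
  by move=> mn; have [h1 _ _ _ _] := h n; exact/h1/vLs.
have orthV m n : ip (v m) (v n) = ((m == n) && (0 < lam m)%R)%:R.
  have [->|] := eqVneq m n; first by have [_ _ _ ->] := h n.
  rewrite neq_ltn => /orP[|/orth ->] // mn.
  by rewrite (ip_conj ipH) orth // conjc0.
have lam0 n : 0 <= lam n by have [_ h2] := h n.
have eig n : nrm (C (v n) - (lam n)%:C *: v n) = 0 by have [_ _ h3] := h n.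
have lamM n f : (forall k, (k < n)%N -> ip f (v k) = 0) ->
    complex.Re (ip (C f) f) <= lam n * nrm f ^+ 2.
  move=> hf; have [_ _ _ _ h5] := h n; apply: h5 => w /Lsv[k kn ->]; exact: hf.
have lamd m n : (m <= n)%N -> lam n <= lam m.
  move=> mn; have [ln0|ln0] := ltP 0 (lam n); last exact: le_trans ln0 (lam0 m).
  have := lamM m (v n) (fun k km => orth _ _ (leq_trans km mn)).
  rewrite (nrm_eq0_eq ipH _ (eig n)) (ipZl ipH) (nrm_sqr ipH) orthV eqxx ln0.
  by rewrite /= !mulr1 !mulr0 subr0.
exists v, lam; split => //.
(* The eigenvalues being nonincreasing, failure to tend to [0] keeps them all above some [eps]. Then
   the [v n] are orthonormal, and the difference of the images of two of them has component at least
   [eps] along the first, against compactness. *)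
apply: contrapT => /existsNP[eps /not_implyP[eps0 /forallNP hd]].
have lamge n : eps <= lam n.
  have /existsNP[m /not_implyP[nm /negP]] := hd n.
  rewrite subr0 -leNgt ger0_norm // => hm; exact: le_trans hm (lamd _ _ nm).
have lamp n : 0 < lam n := lt_le_trans eps0 (lamge n).
have v1 n : nrm (v n) = 1.
  by apply/eqP; rewrite -(@eqrXn2 _ 2) ?nrm_ge0 // (nrm_sqr ipH) orthV eqxx lamp expr1n.
have [|k [g [kh kg]]] := Cc (f := v); first by exists 1 => n; rewrite v1.
have [N hN] := hcvg_cauchy ipH kg eps0.
have kn := kh _ _ (ltnSn N).
have := hN _ _ (leqnn N) (leqnSn N); rewrite (hlin_sub ipH Cl) => hlt.
have E : ip (C (v (k N) - v (k N.+1))) (v (k N)) = (lam (k N))%:C.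
  rewrite (eigen_ip ipH Cl Cp _ (eig _)) (ipBl ipH) !orthV eqxx lamp gtn_eqF //.
  by rewrite subr0 mulr1.
have := cauchy_schwarz ipH (C (v (k N) - v (k N.+1))) (v (k N)).
rewrite E normc_real v1 mulr1 ger0_norm // => h1.
by have := le_lt_trans (le_trans (lamge (k N)) h1) hlt; rewrite ltxx.
Qed.

Variables (v : nat -> H) (lam : nat -> R).
Hypothesis orth : forall m n, ip (v m) (v n) = ((m == n) && (0 < lam m)%R)%:R.
Hypothesis eig : forall n, nrm (C (v n) - (lam n)%:C *: v n) = 0.
Hypothesis lam_ge0 : forall n, 0 <= lam n.
Hypothesis lamM : forall n f, (forall k, (k < n)%N -> ip f (v k) = 0) ->
  complex.Re (ip (C f) f) <= lam n * nrm f ^+ 2.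
Hypothesis lam_cvg : rcvg lam 0.

(** Partial sums of a function [w] of the operator: [w = lam] gives [C] itself, the square roots of
    [lam] give its root, and [w = 1] the projection onto the first [N] vectors. *)
Let psum (w : nat -> R) N f := \sum_(i < N) ((w i)%:C * ip f (v i)) *: v i.

(** When [lam n] is zero, [v n] is null, so the degenerate vectors do not disturb the orthonormal
    calculus. *)
Lemma ip_eigenvector f n : ip f (v n) * (0 < lam n)%R%:R = ip f (v n).
Proof.
have [l0|l0] := ltP 0 (lam n); first by rewrite mulr1.
rewrite mulr0 (ip_conj ipH) ip_null ?conjc0 //; apply/eqP.
by rewrite -sqrf_eq0 (nrm_sqr ipH) orth ltNge l0 andbF.
Qed.

Lemma ip_psum w N f n : ip (psum w N f) (v n) =
  if (n < N)%N then (w n)%:C * ip f (v n) else 0.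
Proof.
rewrite (ip_suml ipH); case: ifPn => [nN|nN].
  rewrite (bigD1 (Ordinal nN)) //= big1 => [|i]; last first.
    by rewrite -val_eqE /= (ipZl ipH) orth => /negPf ->; rewrite mulr0.
  by rewrite addr0 (ipZl ipH) orth eqxx -mulrA ip_eigenvector.
rewrite big1 // => i _; rewrite (ipZl ipH) orth ltn_eqF ?mulr0 //.
by apply: leq_trans (ltn_ord i) _; rewrite leqNgt.
Qed.

Lemma ip_psum_self w N f g : ip (psum w N f) g =
  \sum_(i < N) (w i)%:C * (ip f (v i) * conjc (ip g (v i))).
Proof.
rewrite (ip_suml ipH); apply: eq_bigr => i _.
by rewrite (ipZl ipH) -(ip_conj ipH) mulrA.
Qed.

Lemma psum_norm w N f :
  nrm (psum w N f) ^+ 2 = \sum_(i < N) w i ^+ 2 * normc (ip f (v i)) ^+ 2.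
Proof.
rewrite (nrm_sqr ipH) ip_psum_self raddf_sum; apply: eq_bigr => i _.
rewrite ip_psum ltn_ord conjcM conjc_real.
have -> : (w i)%:C * (ip f (v i) * ((w i)%:C * conjc (ip f (v i)))) =
  (w i)%:C * ((w i)%:C * (ip f (v i) * conjc (ip f (v i)))) by ring.
by rewrite mul_conjcE /=; ring.
Qed.

Lemma eigen_bessel N f :
  \sum_(i < N) normc (ip f (v i)) ^+ 2 <= nrm f ^+ 2 /\
  nrm (f - psum (fun=> 1) N f) <= nrm f.
Proof.
have E : \sum_(i < N) normc (ip f (v i)) ^+ 2 = nrm (psum (fun=> 1) N f) ^+ 2.
  by rewrite psum_norm; apply: eq_bigr => i _; rewrite expr1n mul1r.
have h := nrm_sqrB ipH f (psum (fun=> 1) N f).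
have Re_ip : complex.Re (ip f (psum (fun=> 1) N f)) = nrm (psum (fun=> 1) N f) ^+ 2.
  rewrite (ip_conj ipH) Re_conj ip_psum_self raddf_sum -E.
  by apply: eq_bigr => i _; rewrite mul_conjcE /= mul1r mul0r subr0.
rewrite Re_ip in h; rewrite E; split.
  by have := sqr_ge0 (nrm (f - psum (fun=> 1) N f)); rewrite h; lra.
rewrite -(@ler_pXn2r _ 2) ?nnegrE ?nrm_ge0 // h.
by have := sqr_ge0 (nrm (psum (fun=> 1) N f)); lra.
Qed.

Lemma psum_tail_le w B M N f : 0 <= B -> (M <= N)%N ->
  (forall n, 0 <= w n) -> (forall n, (M <= n)%N -> w n <= B) ->
  nrm (psum w N f - psum w M f) <= B * nrm f.
Proof.
move=> B0 MN w0 wB; pose w' n := if (n < M)%N then 0 else w n.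
have -> : psum w N f - psum w M f = psum w' N f.
  rewrite /psum -!(big_mkord xpredT (fun i => ((_ i)%:C * ip f (v i)) *: v i)).
  rewrite (big_cat_nat (leq0n M) MN) //= addrAC subrr add0r [RHS](big_cat_nat (leq0n M) MN) //=.
  rewrite [X in _ = X + _]big_nat_cond [X in _ = X + _]big1 ?add0r; last first.
    by move=> i /andP[/andP[_ iM] _]; rewrite /w' iM mul0r scale0r.
  rewrite [LHS]big_nat_cond [RHS]big_nat_cond; apply: eq_bigr => i /andP[/andP[Mi _] _].
  by rewrite /w' ltnNge Mi.
rewrite -(@ler_pXn2r _ 2) ?nnegrE ?mulr_ge0 ?nrm_ge0 // psum_norm exprMn.
apply: le_trans (ler_wpM2l (sqr_ge0 B) (eigen_bessel N f).1).
rewrite mulr_sumr; apply: ler_sum => i _; rewrite ler_wpM2r ?sqr_ge0 //.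
rewrite /w'; case: ltnP => iM; first by rewrite expr0n sqr_ge0.
by rewrite ler_pXn2r // ?nnegrE ?wB.
Qed.

Lemma psum_cauchy w f : (forall n, 0 <= w n) -> rcvg w 0 ->
  hcauchy ip (fun N => psum w N f).
Proof.
move=> w0 wc e e0; have f1 : 0 < nrm f + 1 by rewrite ltr_wpDl ?nrm_ge0.
have e1 : 0 < e / 2 / (nrm f + 1) by rewrite !divr_gt0.
have [N0 hN0] := wc _ e1.
have key m n : (N0 <= m)%N -> (m <= n)%N -> nrm (psum w n f - psum w m f) < e.
  move=> Nm mn; apply: le_lt_trans (psum_tail_le f (ltW e1) mn w0 _) _.
    move=> i mi; have := hN0 i (leq_trans Nm mi).
    by rewrite subr0 ger0_norm // => /ltW.
  apply: le_lt_trans (_ : e / 2 / (nrm f + 1) * (nrm f + 1) < _).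
    by rewrite ler_wpM2l ?(ltW e1) // lerDl.
  by rewrite divfK ?gt_eqF //; lra.
exists N0 => m n Nm Nn; have [mn|/ltnW nm] := leqP m n; last exact: key.
by rewrite (nrmC ipH); exact: key.
Qed.

Lemma hcvg_lin (a : R[i]) (f g : nat -> H) x y : hcvg ip f x -> hcvg ip g y ->
  hcvg ip (fun n => a *: f n + g n) (a *: x + y).
Proof.
move=> fx gy e e0; have a1 : 0 < normc a + 1 by rewrite ltr_wpDl ?normc_ge0.
have e1 : 0 < e / 2 / (normc a + 1) by rewrite !divr_gt0.
have e2 : 0 < e / 2 by rewrite divr_gt0.
have [N1 h1] := fx _ e1; have [N2 h2] := gy _ e2.
exists (maxn N1 N2) => n; rewrite geq_max => /andP[/h1 h3 /h2 h4].
rewrite opprD addrACA -scalerBr; apply: le_lt_trans (nrmD ipH _ _) _.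
rewrite (nrmZ ipH); have : normc a * nrm (f n - x) <= e / 2.
  apply: le_trans (_ : (normc a + 1) * (e / 2 / (normc a + 1)) <= _).
    by apply: ler_pM; rewrite ?normc_ge0 ?nrm_ge0 ?(ltW h3) // lerDl.
  by rewrite mulrC divfK // gt_eqF.
by move: h4; lra.
Qed.

Lemma hcvg_ip_ge0 (f : nat -> H) x y : hcvg ip f x -> (forall n, 0 <= ip (f n) y) ->
  0 <= ip x y.
Proof.
move=> fx f0; have [a b] : `|complex.Im (ip x y)| <= 0 /\ 0 <= complex.Re (ip x y).
  suff h (e : R) : 0 < e -> `|complex.Im (ip x y)| <= e /\ - complex.Re (ip x y) <= e.
    split; first by apply/ler_addgt0Pr => e /h[]; rewrite add0r.
    by rewrite -oppr_le0; apply/ler_addgt0Pr => e /h[]; rewrite add0r.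
  move=> e0; have [N hN] := hcvg_ip ipH y fx e0; have {}hN := hN N (leqnn N).
  have := normr_Im_le (ip (f N) y - ip x y); have := normr_Re_le (ip (f N) y - ip x y).
  have := f0 N; rewrite lecE /= => /andP[/eqP i0 r0].
  have {r0 i0} : complex.Re (ip (f N) y) >= 0 /\ complex.Im (ip (f N) y) = 0 by [].
  move: hN; move: (ip (f N) y) (ip x y) => [p q] [p' q'] hN [/= p0 q0]; subst q.
  rewrite sub0r normrN => h1 h2; rewrite /= sub0r in hN; split; first exact: le_trans h2 (ltW hN).
  by have := ler_norm (p - p'); move: (le_trans h1 (ltW hN)); lra.
rewrite lecE /= b andbT; apply/eqP/normr0_eq0/eqP; by rewrite eq_le a normr_ge0.
Qed.

(** The remainder [r] of [f] is orthogonal to the first [N] vectors, where [C] is bounded by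
    [lam N]; hence [|C r| <= lam N * |f|], which tends to zero. *)
Lemma compact_positive_expansion f : hcvg ip (fun N => psum lam N f) (C f).
Proof.
move=> e e0; have f1 : 0 < nrm f + 1 by rewrite ltr_wpDl ?nrm_ge0.
have e1 : 0 < e / (nrm f + 1) by rewrite !divr_gt0.
have [N0 hN0] := lam_cvg e1; exists N0 => N NN.
pose r := f - psum (fun=> 1) N f.
have Cr : nrm (C r - (C f - psum lam N f)) = 0.
  apply: (nrm_null (ip := ip)) => h; rewrite !(ipBl ipH) /r.
  have -> : f - psum (fun=> 1) N f = (-1) *: psum (fun=> 1) N f + f.
    by rewrite scaleN1r addrC.
  rewrite (hlin_ip ipH Cl) mulN1r (hlin_sum ipH Cl) (ip_suml ipH).
  have -> : \sum_(i < N) 1%:C * ip f (v i) * ip (C (v i)) h =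
      \sum_(i < N) ip ((lam i)%:C * ip f (v i) *: v i) h; last by ring.
  apply: eq_bigr => i _.
  by rewrite (nrm_eq0_eq ipH h (eig i)) !(ipZl ipH) mul1r; ring.
pose M := [set g : H | forall k, (k < N)%N -> ip g (v k) = 0].
have Mr : M r by move=> k kN; rewrite (ipBl ipH) ip_psum kN mul1r subrr.
have MC g : M g -> M (C g).
  by move=> Mg k kN; rewrite (eigen_ip ipH Cl Cp g (eig k)) Mg // mulr0.
have h := positive_norm_le ipH Cl Cp (lam_ge0 N) MC (lamM (n := N)) Mr.
have h2 : nrm (C r) <= lam N * nrm f.
  rewrite -(@ler_pXn2r _ 2) ?nnegrE ?mulr_ge0 ?nrm_ge0 //; apply: le_trans h _.
  apply: le_trans (ler_wpM2l (lam_ge0 N) (lamM Mr)) _; rewrite mulrA -expr2 exprMn.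
  rewrite ler_wpM2l ?sqr_ge0 // ler_pXn2r ?nnegrE ?nrm_ge0 //.
  exact: (eigen_bessel N f).2.
rewrite (nrmC ipH) -(nrm_eq0_nrm ipH Cr); apply: le_lt_trans h2 _.
have := hN0 N NN; rewrite subr0 ger0_norm // ltr_pdivlMr //; apply: le_lt_trans.
by rewrite ler_wpM2l // lerDl.
Qed.

Let b n := Num.sqrt (lam n).

Lemma root_eigenvalue_cvg : rcvg b 0.
Proof.
move=> e e0; have e2 : 0 < e ^+ 2 by rewrite exprn_gt0.
have [N hN] := lam_cvg e2; exists N => n /hN; rewrite !subr0 !ger0_norm ?sqrtr_ge0 // => h.
by rewrite -(@ltr_pXn2r _ 2) ?nnegrE ?sqrtr_ge0 ?(ltW e0) // sqr_sqrtr.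
Qed.

Section Root.
Variable A : H -> H.
Hypothesis hA : forall f, hcvg ip (fun N => psum b N f) (A f).

Lemma root_lin : hlin ip A.
Proof.
move=> a f g; apply: (hcvg_uniq ipH (hA (a *: f + g))).
have E : (fun N => a *: psum b N f + psum b N g) =
    (fun N => psum b N (a *: f + g)).
  apply/funext => N; rewrite /psum scaler_sumr -big_split; apply: eq_bigr => i _ /=.
  by rewrite scalerA -scalerDl (ip_lin ipH); congr (_ *: _); ring.
by rewrite -E; exact: hcvg_lin.
Qed.

Lemma root_bounded : hbounded ip A.
Proof.
have [N hN] := root_eigenvalue_cvg (@ltr01 R).
pose B := 1 + \sum_(i < N) b i.
have b0 n : 0 <= b n by exact: sqrtr_ge0.
have B0 : 0 <= B by rewrite addr_ge0 // sumr_ge0.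
have bB n : b n <= B.
  have [nN|Nn] := ltnP n N.
    rewrite /B (bigD1 (Ordinal nN)) //= addrCA lerDl addr_ge0 // sumr_ge0 //.
  have := hN n Nn; rewrite subr0 ger0_norm // => /ltW h; apply: le_trans h _.
  by rewrite lerDl sumr_ge0.
exists B => f; apply: (hcvg_nrm ipH (hA f)) => n.
have := psum_tail_le f B0 (leq0n n) b0 (fun k _ => bB k).
by rewrite [X in _ - X]/psum big_ord0 subr0.
Qed.

Lemma root_positive f : 0 <= ip (A f) f.
Proof.
apply: (hcvg_ip_ge0 (hA f)) => N; rewrite ip_psum_self; apply: sumr_ge0 => i _.
by rewrite mul_conjcE -rmorphM /= lecR mulr_ge0 ?sqrtr_ge0 ?sqr_ge0.
Qed.

Lemma root_coord f n : ip (A f) (v n) = (b n)%:C * ip f (v n).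
Proof.
apply/eqP; rewrite -subr_eq0 -normc_eq0 eq_le normc_ge0 andbT.
apply/ler_addgt0Pr => e e0; have [N hN] := hcvg_ip ipH (v n) (hA f) e0.
have := hN _ (leq_maxl N n.+1); rewrite ip_psum leq_maxr normc_distC add0r.
exact: ltW.
Qed.

Lemma root_sqr f : nrm (A (A f) - C f) = 0.
Proof.
apply: (hcvg_uniq ipH _ (compact_positive_expansion f)).
have E : (fun N => psum b N (A f)) = (fun N => psum lam N f).
  apply/funext => N; apply: eq_bigr => i _; rewrite root_coord mulrA -rmorphM /=.
  by rewrite -expr2 sqr_sqrtr.
by rewrite -E.
Qed.

(** Since [b] tends to zero, only finitely many [n] satisfy [b n = l]. Comparing coordinates, an
    eigenvector [f] for [l] has nonzero coordinates only there, so that [A f] is [l] times a finite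
    combination of the corresponding [v n], and so is [l *: f] up to a null vector. *)
Lemma root_eigen_listing : eigen_listing ip A b.
Proof.
move=> l l0; have [N hN] := root_eigenvalue_cvg l0.
have bN n : b n = l -> (n < N)%N.
  move=> bl; rewrite ltnNge; apply/negP => /hN.
  by rewrite bl subr0 gtr0_norm // ltxx.
pose F := [seq n <- index_iota 0 N | b n == l].
have uF : uniq F by rewrite filter_uniq // iota_uniq.
have inF n : (n \in F) = (b n == l).
  rewrite mem_filter mem_index_iota; case: eqP => //= /bN ->.
  by [].
have lp n : b n = l -> 0 < lam n by move=> bl; rewrite -sqrtr_gt0 -/(b n) bl.
pose e (i : 'I_(size F)) := v (nth 0%N F i).
have be i : b (nth 0%N F (i : 'I_(size F))) = l.
  by apply/eqP; rewrite -inF mem_nth.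
exists (size F); last first.
  apply/card_set_bijP; exists (index^~ F); split.
  - by move=> n /= /eqP; rewrite -inF -index_mem.
  - move=> m n; rewrite !inE /= => /eqP hm /eqP hn h.
    by rewrite -(nth_index 0%N (s := F) (x := m)) ?inF // h nth_index // inF.
  - move=> i /= iF; exists (nth 0%N F i); last exact: index_uniq.
    exact: (be (Ordinal iF)).
exists e; split.
- move=> i; apply: (hcvg_uniq ipH (hA _)); rewrite /e -(be i).
  set n := nth _ _ _; have ln := lp n (be i) => d d0; exists n.+1 => m nm.
  rewrite (_ : psum b m (v n) = (b n)%:C *: v n) ?subrr ?(nrm0 ipH) //.
  rewrite /psum (bigD1 (Ordinal nm)) //= orth eqxx ln mulr1 big1 ?addr0 // => j.
  by rewrite -val_eqE /= eq_sym => /negPf jn; rewrite orth jn mulr0 scale0r.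
- move=> c c0 i; have := ip_null ipH (e i) c0.
  rewrite (ip_suml ipH) (bigD1 i) //= big1 => [|j]; last first.
    rewrite -val_eqE /= => ji; rewrite (ipZl ipH) orth nth_uniq //.
    by rewrite (negPf ji) mulr0.
  by rewrite addr0 (ipZl ipH) orth eqxx (lp _ (be i)) mulr1.
- move=> f hf; exists (fun i => ip f (e i)).
  have f0 n : b n != l -> ip f (v n) = 0.
    move=> bl; have := root_coord f n; rewrite (nrm_eq0_eq ipH _ hf) (ipZl ipH) => /eqP.
    rewrite -subr_eq0 -mulrBl mulf_eq0 -rmorphB -[0]/((0 : R)%:C) eqCR subr_eq0.
    by rewrite eq_sym (negPf bl) => /eqP.
  set g := \sum_(i < _) _.
  have Afg : nrm (A f - l%:C *: g) = 0.
    apply: (hcvg_uniq ipH (hA f)) => d d0; exists N => m Nm.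
    rewrite (_ : psum b m f = l%:C *: g) ?subrr ?(nrm0 ipH) //.
    rewrite /psum -(big_mkord xpredT (fun i => ((b i)%:C * ip f (v i)) *: v i)).
    rewrite (bigID (fun i => b i == l)) /= [X in _ + X]big1 ?addr0; last first.
      by move=> i /f0 ->; rewrite mulr0 scale0r.
    rewrite (big_cat_nat (leq0n N) Nm) //= [X in _ + X]big_nat_cond [X in _ + X]big1 ?addr0.
      rewrite -big_filter -/F /g scaler_sumr (big_nth 0%N) big_mkord.
      by apply: eq_bigr => i _; rewrite scalerA be.
    move=> i /andP[/andP[Ni _] /eqP /bN]; by rewrite ltnNge Ni.
  have : nrm (l%:C *: (f - g)) = 0.
    apply/eqP; rewrite eq_le nrm_ge0 andbT scalerBr.
    by apply: le_trans (nrm_tri ipH (A f) _ _) _; rewrite Afg (nrmC ipH) hf addr0.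
  rewrite (nrmZ ipH) normc_real gtr0_norm // => /eqP.
  by rewrite mulf_eq0 gt_eqF //= => /eqP.
Qed.

End Root.

End CompactPositiveRoot.

Lemma compact_abs_op_ex (R : realType) (H : lmodType R[i]) (ip : H -> H -> R[i])
    (T S : H -> H) : semi_ip ip -> hcomplete ip -> hlin ip T -> hbounded ip T ->
  hcompact ip T -> hlin ip S -> hbounded ip S ->
  (forall f g, ip (T f) g = ip f (S g)) ->
  exists (A : H -> H) (s : nat -> R), [/\ hlin ip A, hbounded ip A,
    forall f, 0 <= ip (A f) f, forall f, hnorm ip (A (A f) - S (T f)) = 0 &
    (forall n, 0 <= s n) /\ eigen_listing ip A s].
Proof.
move=> ipH Hc Tl Tb Tc Sl Sb TS; pose C f := S (T f).
have Cl : hlin ip C.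
  move=> a f g; apply/eqP; rewrite eq_le nrm_ge0 andbT.
  apply: le_trans (nrm_tri ipH (S (a *: T f + T g)) _ _) _.
  by rewrite Sl addr0 (hlin_eqv ipH Sl Sb (Tl a f g)).
have Cb : hbounded ip C.
  have [M1 h1] := Tb; have [M2 h2] := Sb; exists (`|M2| * `|M1|) => f.
  apply: le_trans (h2 _) _; rewrite -mulrA.
  apply: le_trans (_ : `|M2| * hnorm ip (T f) <= _).
    by rewrite ler_wpM2r ?nrm_ge0 // ler_norm.
  rewrite ler_wpM2l //; apply: le_trans (h1 f) _.
  by rewrite ler_wpM2r ?nrm_ge0 // ler_norm.
have Cp f : 0 <= ip (C f) f.
  by rewrite (ip_conj ipH) -TS (ip_self ipH) conjc_real lecR sqr_ge0.
have Cc : hcompact ip C.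
  move=> f fM; have [k [g [kh kg]]] := Tc f fM; exists k, (S g); split => //.
  exact: (hbounded_cvg ipH Sl Sb kg).
have [v [lam [h1 h2 h3 h4 h5]]] := greedy_eigenvectors ipH Cl Cb Cp Cc.
pose b n := Num.sqrt (lam n).
have b0 n : 0 <= b n by exact: sqrtr_ge0.
have /choice[A hA] := fun f => Hc _ (psum_cauchy ipH h1 f b0 (root_eigenvalue_cvg h3 h5)).
exists A, b; split.
- exact: (root_lin ipH hA).
- exact: (root_bounded ipH h1 h3 h5 hA).
- exact: (root_positive ipH hA).
- exact: (root_sqr ipH Cl Cp h1 h2 h3 h4 h5 hA).
- by split => //; exact: (root_eigen_listing ipH h1 h3 h5 hA).
Qed.

(** * Truncated Toeplitz operators *)

Section SubspaceOperators.
Variables (R : realType) (K : set (R -> R[i])) (hK : subspace K).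
Hypothesis KL : K `<=` @L2 R.
Local Notation H := (subspace_type hK).
Local Notation ip := (subspace_ip (hK := hK) (@inner R)).
Local Notation nrm := (hnorm ip).
Let ipH : semi_ip ip := semi_ip_inner hK KL.

(** The link between operators on functions, as in the statement, and operators on the space of
    elements of [K], where the general theory applies. *)
Definition represents (T : (R -> R[i]) -> R -> R[i]) (T' : H -> H) :=
  forall x : H, subspace_val (T' x) = T (subspace_val x).

Lemma aeeq_norm2 f g : K f -> K g ->
  aeeq f g <-> norm2 (fun t => f t - g t) = 0.
Proof.
move=> Kf Kg; have Lfg := L2B (KL Kf) (KL Kg); split=> [fg|/(norm2_eq0 Lfg)].
  by apply/(norm2_eq0 Lfg); apply: ae_on_circleS fg => t ->; rewrite subrr.
by apply: ae_on_circleS => t /eqP; rewrite subr_eq0 => /eqP.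
Qed.

Lemma aeeq_val (x y : H) : aeeq (subspace_val x) (subspace_val y) <-> nrm (x - y) = 0.
Proof. by apply: aeeq_norm2; exact: subspace_valP. Qed.

Lemma represents_ex T : (forall f, K f -> K (T f)) -> exists T', represents T T'.
Proof.
move=> KT; exists (fun x => exist _ (T (subspace_val x)) (KT _ (subspace_valP x))).
by move=> x.
Qed.

(** Outside [K] the operator may take any value; the argument itself is returned. *)
Lemma represented_ex T' : exists T, represents T T' /\ forall f, K f -> K (T f).
Proof.
exists (fun f => if pselect (K f) is left p then subspace_val (T' (exist _ f p)) else f).
split=> [x|f Kf].
  case: pselect => [p|]; last by case; exact: subspace_valP.
  by congr (subspace_val (T' _)); exact: subspace_val_inj.
case: pselect => // p; exact: subspace_valP.
Qed.

Lemma subspace_val_lin (a : R[i]) (x y : H) : subspace_val (a *: x + y) =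
  fun t => a * subspace_val x t + subspace_val y t.
Proof. by rewrite subspace_valD subspace_valZ. Qed.

Lemma bounded_op_represents T T' : represents T T' -> (forall f, K f -> K (T f)) ->
  bounded_op K T <-> hlin ip T' /\ hbounded ip T'.
Proof.
move=> TT' KT; split=> [[_ Tl [M hM]]|[Tl [M hM]]].
  split; last by exists M => x; have := hM _ (subspace_valP x); rewrite -TT'.
  move=> a x y; apply/aeeq_val; rewrite TT' !subspace_val_lin (TT' x) (TT' y).
  exact: (Tl a _ _ (subspace_valP x) (subspace_valP y)).
split => //; last first.
  by exists M => f Kf; have := hM (exist _ f Kf); rewrite /hnorm /subspace_ip !TT'.
move=> a f g Kf Kg.
have /aeeq_val := Tl a (exist _ f Kf) (exist _ g Kg).
by rewrite TT' !subspace_val_lin !TT'.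
Qed.

Lemma compact_op_represents T T' : represents T T' -> bounded_op K T ->
  compact_op K T <-> hcompact ip T'.
Proof.
move=> TT' Tb; split=> [[_ Tc]|Tc].
  move=> f [M hM].
  have [|k [g [kh Kg kg]]] := Tc (fun n => subspace_val (f n)) _ (ex_intro _ M hM).
    by move=> n; exact: subspace_valP.
  exists k, (exist _ g Kg); split => // e e0; move/rcvgP: kg => /(_ e e0)[N hN].
  exists N => n /hN; rewrite subr0 ger0_norm ?norm2_ge0 //.
  by rewrite -TT'.
split=> // f Kf [M hM].
have [|k [g [kh kg]]] := Tc (fun n => exist _ (f n) (Kf n)); first by exists M.
exists k, (subspace_val g); split => //; first exact: subspace_valP.
apply/rcvgP => e e0; have [N hN] := kg e e0; exists N => n /hN.
have E : nrm (T' (exist _ (f (k n)) (Kf (k n)) : H) - g) =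
  norm2 (fun t => subspace_val (T' (exist _ (f (k n)) (Kf (k n)) : H)) t - subspace_val g t) by [].
by rewrite E TT' subr0 ger0_norm ?norm2_ge0.
Qed.

Lemma subspace_val_sum d (c : 'I_d -> R[i]) (e : 'I_d -> H) :
  subspace_val (\sum_(i < d) c i *: e i) =
  fun t => \sum_(i < d) c i * subspace_val (e i) t.
Proof.
apply/funext => t.
by elim/big_rec2: _ => [//|i x y _ <-]; rewrite subspace_valD subspace_valZ.
Qed.

Lemma has_dim_hdim (V : set (R -> R[i])) (V' : set H) d : V `<=` K ->
  (forall x : H, V' x <-> V (subspace_val x)) -> has_dim V d <-> hdim ip V' d.
Proof.
move=> VK VV'; split=> [[e [e1 e2 e3]]|[e [e1 e2 e3]]].
  pose e' i : H := exist _ (e i) (VK _ (e1 i)).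
  have val0 : subspace_val (0 : H) = fun=> 0 by [].
  exists e'; split=> [i|c c0|x /VV'/e3[c hc]]; first by apply/VV'; exact: e1.
    apply: e2; rewrite -[X in aeeq X _](subspace_val_sum c e') -val0.
    by apply/aeeq_val; rewrite subr0.
  by exists c; apply/aeeq_val; rewrite subspace_val_sum.
exists (fun i => subspace_val (e i)); split=> [i|c c0|f Vf]; first exact/VV'.
  apply: e2; rewrite -[X in nrm X]subr0; apply/aeeq_val.
  by rewrite subspace_val_sum.
have /e3[c hc] : V' (exist _ f (VK _ Vf) : H) by apply/VV'.
by exists c; rewrite -subspace_val_sum; exact/(aeeq_val (exist _ f (VK _ Vf)) _).
Qed.

Lemma op_eigenspace_heigen A A' l : represents A A' -> (forall f, K f -> K (A f)) ->
  forall x : H, heigen ip A' l x <-> op_eigenspace K A l (subspace_val x).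
Proof.
move=> AA' KA x; have E := aeeq_val (A' x) (l *: x).
rewrite subspace_valZ AA' in E; split=> [/E h|[_ /E //]].
by split => //; exact: subspace_valP.
Qed.

Lemma eigenspace_dim A A' l d : represents A A' -> (forall f, K f -> K (A f)) ->
  has_dim (op_eigenspace K A l) d <-> hdim ip (heigen ip A' l) d.
Proof.
by move=> AA' KA; apply: has_dim_hdim (op_eigenspace_heigen l AA' KA) => f [].
Qed.

Lemma singular_values_abs T T' s : represents T T' ->
  singular_values K T s -> exists A' S' : H -> H,
  [/\ hlin ip A' /\ hbounded ip A', forall f, 0 <= ip (A' f) f,
    forall f g, ip (T' f) g = ip f (S' g),
    forall f, nrm (A' (A' f) - S' (T' f)) = 0 &
    (forall n, 0 <= s n) /\ eigen_listing ip A' s].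
Proof.
move=> TT' [s0 [A [Ab Ap [S [Sb TS] AS]] hs]].
have KA : forall f, K f -> K (A f) by case: Ab.
have KS : forall f, K f -> K (S f) by case: Sb.
have [A' AA'] := represents_ex KA; have [S' SS'] := represents_ex KS.
exists A', S'; split => //.
- by apply/(bounded_op_represents AA' KA).
- by move=> f; rewrite /subspace_ip AA'; apply: Ap; exact: subspace_valP.
- move=> f g; rewrite /subspace_ip TT' SS'; apply: TS; exact: subspace_valP.
- move=> f; apply/aeeq_val; rewrite !AA' SS' TT'; apply: AS; exact: subspace_valP.
split=> // l l0; have [d hd1 hd2] := hs l l0; exists d => //.
exact/(eigenspace_dim l%:C d AA' KA).
Qed.

Lemma abs_singular_values T T' S' A' s : represents T T' ->
  hlin ip A' -> hbounded ip A' -> (forall f, 0 <= ip (A' f) f) ->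
  hlin ip S' -> hbounded ip S' -> (forall f g, ip (T' f) g = ip f (S' g)) ->
  (forall f, nrm (A' (A' f) - S' (T' f)) = 0) ->
  (forall n, 0 <= s n) -> eigen_listing ip A' s -> singular_values K T s.
Proof.
move=> TT' Al Ab Ap Sl Sb TS AS s0 hs; split => //.
have [A [AA' KA]] := represented_ex A'; have [S [SS' KS]] := represented_ex S'.
exists A.
  split.
  - by apply/(bounded_op_represents AA' KA).
  - move=> f Kf; have := Ap (exist _ f Kf); by rewrite /subspace_ip AA'.
  - exists S.
      split; first by apply/(bounded_op_represents SS' KS).
      move=> f g Kf Kg; have := TS (exist _ f Kf) (exist _ g Kg).
      by rewrite /subspace_ip TT' SS'.
    move=> f Kf; have /aeeq_val := AS (exist _ f Kf).
    by rewrite !AA' SS' TT'.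
move=> l l0; have [d hd1 hd2] := hs l l0; exists d => //.
exact/(eigenspace_dim l%:C d AA' KA).
Qed.

End SubspaceOperators.

Lemma ccvg_bounded (R : realType) (d : nat -> R[i]) : ccvg d 0 ->
  exists M : R, forall n, normc (d n) <= M.
Proof.
move=> /(_ 1 ltr01)[N hN]; exists (1 + \sum_(i < N) normc (d i)) => n.
have s0 (P : pred 'I_N) : 0 <= \sum_(i < N | P i) normc (d i).
  by apply: sumr_ge0 => i _; exact: normc_ge0.
have [nN|Nn] := ltnP n N.
  rewrite (bigD1 (Ordinal nN)) //= addrCA lerDl addr_ge0 //.
by have := hN n Nn; rewrite subr0 => /ltW h; apply: le_trans h _; rewrite lerDl.
Qed.

Section TruncatedToeplitz.
Variables (R : realType) (u : R -> R[i]) (z : nat -> R[i]) (phi : R -> R[i]).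
Local Notation K := (model_space u).
Variable hK : subspace K.
Local Notation H := (subspace_type hK).
Local Notation ip := (subspace_ip (hK := hK) (@inner R)).
Local Notation nrm := (hnorm ip).
Hypothesis hphi : H2 phi.
Hypothesis KH2 : forall f, K f -> H2 f.
Hypothesis Hc : hcomplete ip.
Hypothesis hz : forall n, normc (z n) < 1.
Variable Kk : forall n, K (kernel (z n)).
Local Notation e := (unit_kernel hK Kk).
Variable C : R.
Hypothesis C0 : 0 < C.
Hypothesis coord_le : forall f N,
  \sum_(i < N) normc (ip f (e i)) ^+ 2 <= C ^+ 2 * nrm f ^+ 2.
Hypothesis coord_ge : forall f (B : R), 0 <= B ->
  (forall N, \sum_(i < N) normc (ip f (e i)) ^+ 2 <= B ^+ 2) -> nrm f <= C * B.
Hypothesis coord_ex : forall (c : nat -> R[i]) (B : R), 0 <= B ->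
  (forall N, \sum_(i < N) normc (c i) ^+ 2 <= B ^+ 2) ->
  exists g, forall n, ip g (e n) = c n.
Hypothesis dense : forall f, exists p : nat -> {poly R[i]},
  hcvg ip (fun n => lincomb e (p n)) f.
Let KL f (Kf : K f) : L2 f := proj1 (KH2 Kf).
Let ipH : semi_ip ip := semi_ip_model hK KH2.
Let d n := disk_ext phi (z n).

(** The bounded factor [f], replaced by a representative bounded everywhere, acts as the multiplier
    on [phi], which is only in [H^2]. *)
Lemma disk_ext_mul_Hinfty f a : Hinfty f -> normc a < 1 ->
  H2 (fun t => phi t * f t) /\
  disk_ext (fun t => phi t * f t) a = disk_ext phi a * disk_ext f a.
Proof.
move=> Hf a1; have mf : cmeas f by case: Hf => [[/L2_cmeas]].
have mphi : cmeas phi by case: hphi => /L2_cmeas.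
have [g [M [Hg gM fg]]] := Hinfty_bounded Hf.
have mg : cmeas g by case: Hg => /L2_cmeas.
have ae : aeeq (fun t => phi t * f t) (fun t => g t * phi t).
  by apply: ae_on_circleS fg => t ->; rewrite mulrC.
have mpf : cmeas (fun t => phi t * f t) by exact: cmeasM.
have mgp : cmeas (fun t => g t * phi t) by exact: cmeasM.
split; first by apply: H2_ae mpf ae _; exact: (H2_mulb Hg gM hphi).
by rewrite (disk_ext_ae mpf mgp ae) (disk_ext_mulb Hg gM hphi a1) (disk_ext_ae mf mg fg) mulrC.
Qed.

Lemma disk_extB (f g : R -> R[i]) a : L2 f -> L2 g -> normc a < 1 ->
  disk_ext (fun t => f t - g t) a = disk_ext f a - disk_ext g a.
Proof.
move=> Lf Lg a1; rewrite (disk_extE a1 (L2B Lf Lg)) (disk_extE a1 Lf) (disk_extE a1 Lg).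
by apply: innerB => //; exact: L2_kernel.
Qed.

(** The kernels are bounded, so [extends_tto] applies to them: [phi k - T k] is orthogonal to the
    kernel at [z n], that is, its value there is zero. Linearity, density of the span of the kernels
    and boundedness of [T] give the rest. *)
Lemma tto_multiplier (T : (R -> R[i]) -> R -> R[i]) (T' : H -> H) :
  represents T T' -> bounded_op K T ->
  extends_tto u phi T -> forall x n, ip (T' x) (e n) = d n * ip x (e n).
Proof.
move=> TT' Tb Tphi; have KT : forall f, K f -> K (T f) by case: Tb.
have [Tl Tbd] := (bounded_op_represents KL TT' KT).1 Tb.
have hk m n : ip (T' (e m)) (e n) = d n * ip (e m) (e n).
  pose k : H := exist _ (kernel (z m)) (Kk m).
  have Hk := Hinfty_kernel (hz m); have [KTk orth] := Tphi _ (Kk m) Hk.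
  have [HphiK dE] := disk_ext_mul_Hinfty Hk (hz n); have LphiK : L2 _ := proj1 HphiK.
  have := orth _ (Kk n); rewrite -(disk_extE (hz n) (L2B LphiK (KL KTk))).
  rewrite (disk_extB LphiK (KL KTk) (hz n)) dE => /eqP.
  rewrite subr_eq0 => /eqP h.
  have {}h : ip (T' k) (e n) = d n * ip k (e n).
    rewrite !(ip_unit_kernel KH2 hz) TT' -[subspace_val k]/(kernel (z m)) -h.
    by rewrite mulrCA.
  pose c : R[i] := ((kernel_norm z m)^-1)%:C.
  have -> : e m = c *: k + 0 by rewrite addr0.
  rewrite (hlin_ip ipH Tl c k 0) (ip_null ipH (e n) (hlin0 ipH Tl)).
  by rewrite (ip_lin ipH c k 0) (ip0l ipH) h !addr0 mulrCA.
move=> x n; have [p hp] := dense x.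
(* With [d n] moved to the second argument, both sides are inner products with fixed vectors and
   pass to the limit. *)
have E j : ip (T' (lincomb e (p j))) (e n) = ip (lincomb e (p j)) (conjc (d n) *: e n).
  rewrite (hlin_sum ipH Tl) (ip_suml ipH); apply: eq_bigr => i _.
  by rewrite hk (ipZl ipH _ (e i)) (ipZr ipH _ (e n)) conjcK.
rewrite -[d n]conjcK -(ipZr ipH _ (e n)).
apply: (@ccvg_uniq _ (fun j => ip (T' (lincomb e (p j))) (e n))).
  by move=> eps eps0; exact: (hcvg_ip ipH (e n) (hbounded_cvg ipH Tl Tbd hp) eps0).
move=> eps eps0; have [N hN] := hcvg_ip ipH (conjc (d n) *: e n) hp eps0.
by exists N => j /hN; rewrite E.
Qed.

(** The difference [q] of [phi f] and [T f] vanishes at each [z n], hence is orthogonal to every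
    kernel, to their finite combinations and, by density, to all of [K]. *)
Lemma multiplier_tto (T : (R -> R[i]) -> R -> R[i]) (T' : H -> H) :
  represents T T' -> (forall f, K f -> K (T f)) ->
  (forall x n, ip (T' x) (e n) = d n * ip x (e n)) -> extends_tto u phi T.
Proof.
move=> TT' KT hT f Kf Hf; have KTf := KT f Kf; split => // h Kh.
have Lpf : L2 (fun t => phi t * f t).
  by have [[]] := disk_ext_mul_Hinfty Hf (hz 0).
pose q t := phi t * f t - T f t; have Lq : L2 q by exact: L2B Lpf (KL KTf).
have q0 n : inner q (subspace_val (e n)) = 0.
  rewrite (inner_unit_kernel hK hz Kk n Lq) (disk_extB Lpf (KL KTf) (hz n)).
  have [_ ->] := disk_ext_mul_Hinfty Hf (hz n).
  have := hT (exist _ f Kf) n; rewrite !(ip_unit_kernel KH2 hz) TT' /= mulrBr => ->.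
  by rewrite mulrCA subrr.
have [p hp] := dense (exist _ h Kh).
have qp j : inner q (subspace_val (lincomb e (p j))) = 0.
  rewrite (inner_val_sum KH2 e (size (p j)) (fun i => (p j)`_i) Lq).
  by rewrite big1 // => i _; rewrite q0 mulr0.
apply/eqP; rewrite -normc_eq0 eq_le normc_ge0 andbT; apply/ler_addgt0Pr => eps eps0.
have q1 : 0 < norm2 q + 1 by rewrite ltr_wpDl ?norm2_ge0.
have [N hN] := hp _ (divr_gt0 eps0 q1); have {}hN := hN N (leqnn N).
set l := lincomb e (p N) in hN; have Ll : L2 (subspace_val l) := KL (subspace_valP l).
have -> : inner q h = inner q (fun t => h t - subspace_val l t).
  by rewrite (innerBr (KL Kh) Ll Lq) qp subr0.
rewrite add0r; apply: le_trans (inner_CS Lq (L2B (KL Kh) Ll)) _.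
rewrite (norm2C (KL Kh) Ll); move: hN; rewrite ltr_pdivlMr // => hN.
apply: le_trans (ltW hN); rewrite mulrC.
apply: ler_wpM2l; last by rewrite lerDl.
exact: (norm2_ge0 (fun t => subspace_val l t - h t)).
Qed.

Lemma bounded_symbol_tto (M : R) : (forall n, normc (d n) <= M) ->
  exists T (T' : H -> H), [/\ extends_tto u phi T, bounded_op K T, represents T T' &
    forall x n, ip (T' x) (e n) = d n * ip x (e n)].
Proof.
move=> dM; have M0 : 0 <= M := le_trans (normc_ge0 _) (dM 0%N).
have [T' hT'] := multiplier_ex C0 coord_le coord_ex dM.
have [T [TT' KT]] := represented_ex T'; exists T, T'; split => //.
  exact: multiplier_tto TT' KT hT'.
apply/(bounded_op_represents KL TT' KT); split.
  exact: (multiplier_lin ipH coord_ge hT').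
exists (C * M * C) => f; exact: (multiplier_bounded C0 coord_le coord_ge hT' M0 dM f).
Qed.

Lemma tto_in_schatten_oo :
  tto_in_schatten +oo%E u phi <-> ellp +oo%E (fun n => normc (d n)).
Proof.
split=> [[T Tphi Tb]|[M dM]].
  have KT : forall f, K f -> K (T f) by case: Tb.
  have [T' TT'] := represents_ex hK KT.
  have [Tl [M hM]] := (bounded_op_represents KL TT' KT).1 Tb.
  have [B hB] := bounded_multiplier C0 coord_le coord_ge coord_ex
    (tto_multiplier TT' Tb Tphi) hM.
  by exists B => n; rewrite ger0_norm ?normc_ge0.
have [|T [T' [h1 h2 _ _]]] := @bounded_symbol_tto M; last by exists T.
by move=> n; have := dM n; rewrite ger0_norm ?normc_ge0.
Qed.

Lemma compact_symbol_tto : ccvg d 0 -> exists T (T' : H -> H), [/\ extends_tto u phi T,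
  compact_op K T, represents T T', forall x n, ip (T' x) (e n) = d n * ip x (e n) &
  hcompact ip T'].
Proof.
move=> d0; have [M dM] := ccvg_bounded d0.
have [T [T' [h1 h2 h3 h4]]] := bounded_symbol_tto dM.
have Tc : hcompact ip T' by move=> f; exact: (multiplier_compact ipH Hc C0 coord_le coord_ge h4 d0).
have Tc' := (compact_op_represents h3 h2).2 Tc.
by exists T, T'.
Qed.

Lemma tto_compactP : tto_compact u phi <-> ccvg d 0.
Proof.
split=> [[T Tphi Tc]|/compact_symbol_tto[T [T' [h1 h2 _ _ _]]]]; last by exists T.
have Tb := proj1 Tc; have KT : forall f, K f -> K (T f) by case: Tb.
have [T' TT'] := represents_ex hK KT.
apply: (compact_multiplier ipH C0 coord_le coord_ge coord_ex (tto_multiplier TT' Tb Tphi)).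
exact/(compact_op_represents TT' Tb).
Qed.

Lemma ellp_cvg0 (r : R) : 0 < r -> ellp r%:E (fun n => normc (d n)) -> ccvg d 0.
Proof.
move=> r0 hd eps eps0; have er : 0 < eps `^ r by rewrite powR_gt0.
have u0 n : 0 <= `|normc (d n)| `^ r by exact: powR_ge0.
have [N hN] := nneseries_tail u0 hd er; exists N => n Nn; rewrite subr0.
have := hN n.+1 (leqW Nn); rewrite big_nat_recr //= => h.
have {h} : normc (d n) `^ r < eps `^ r.
  rewrite -[X in X `^ r]ger0_norm ?normc_ge0 //; apply: le_lt_trans h.
  by rewrite lerDr sumr_ge0.
rewrite !ltNge; apply: contra => h; apply: ge0_ler_powR; rewrite ?nnegrE ?normc_ge0 //.
- exact: ltW.
- exact: ltW.
Qed.

Lemma tto_in_schatten_fin (r : R) : 0 < r ->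
  tto_in_schatten r%:E u phi <-> ellp r%:E (fun n => normc (d n)).
Proof.
move=> r0; have c0 : 0 < (2 * C ^+ 2)^-1.
  by rewrite invr_gt0 mulr_gt0 // exprn_gt0.
have dn0 n : 0 <= normc (d n) by exact: normc_ge0.
split=> [[T Tphi [Tc [s hs sr]]]|dr].
  have Tb := proj1 Tc; have KT : forall f, K f -> K (T f) by case: Tb.
  have [T' TT'] := represents_ex hK KT.
  have Tc' := (compact_op_represents TT' Tb).1 Tc.
  have [Tl _] := (bounded_op_represents KL TT' KT).1 Tb.
  have [A [S [[Al Ab] Ap TS AS [s0 hE]]]] := singular_values_abs KL TT' hs.
  have TA := abs_op_norm ipH Al Ap TS AS.
  have Ac : hcompact ip A by move=> f; exact: (same_norm_compact ipH Hc Tl Al TA Tc').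
  have [E [E1 E2 E3]] := eigen_listing_vectors hE.
  apply: (ellp_comparison r0 c0 dn0 s0 _ sr) => l F G l0 uF Fl GF.
  exact: (singular_value_count ipH Al Ab Ap E3 C0 coord_le coord_ge coord_ex
    (tto_multiplier TT' Tb Tphi) TA Ac l0 uF Fl GF).
have [T [T' [Tphi Tc TT' hT Tc']]] := compact_symbol_tto (ellp_cvg0 r0 dr).
have Tb := proj1 Tc; have KT : forall f, K f -> K (T f) by case: Tb.
have [Tl Tbd] := (bounded_op_represents KL TT' KT).1 Tb.
have [S [Sl Sb TS]] := adjoint_ex ipH Hc Tl Tbd.
have [A [s [Al Ab Ap AS [s0 hE]]]] := compact_abs_op_ex ipH Hc Tl Tbd Tc' Sl Sb TS.
exists T => //; split => //; exists s.
  exact: (abs_singular_values KL TT' Al Ab Ap Sl Sb TS AS s0 hE).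
have TA := abs_op_norm ipH Al Ap TS AS.
have [E [E1 E2 E3]] := eigen_listing_vectors hE.
apply: (ellp_comparison r0 c0 s0 dn0 _ dr) => l F G l0 uF Fl GF.
exact: (multiplier_count ipH Al Ap E1 E2 C0 coord_le coord_ge hT TA l0 uF Fl GF).
Qed.

End TruncatedToeplitz.

Lemma blaschke_product_unimodular (R : realType) (u : R -> R[i]) z :
  is_blaschke_product u z -> ae_on_circle (fun t => normc (u t) = 1).
Proof.
move=> [hz hsum Hu hprod].
apply: (limit_unimodular (f := bprod z 0)) => [n|||e e0].
- exact: (L2_bprod hz 0 n).
- by case: Hu.
- by move=> n t; exact: normc_bprod.
by apply: (bprod_cvg hz hsum Hu _ e0) => w w1; apply/ccvgP; exact: hprod.
Qed.

Lemma blaschke_product_zero (R : realType) (u : R -> R[i]) z n :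
  is_blaschke_product u z -> disk_ext u (z n) = 0.
Proof.
move=> [hz _ _ /(_ _ (hz n))/ccvgP hprod]; apply: (ccvg_uniq hprod) => e e0.
exists n.+1 => m nm; rewrite subr0 big_mkord (bigD1 (Ordinal nm)) //=.
by rewrite blaschke_factor_root mul0r normc0.
Qed.

(** The proofs [hK] and [Kk] are quantified existentially because the form and the kernels [e]
    depend on them. The representative of [u] bounded everywhere, available once [u] is known to be
    unimodular, is confined to this proof. *)
Lemma interpolating_riesz_basis (R : realType) (u : R -> R[i]) z :
  interpolating_blaschke u z ->
  exists hK : subspace (model_space u),
  exists Kk : forall n, model_space u (kernel (z n)),
  hcomplete (subspace_ip (hK := hK) (@inner R)) /\
  let ip := subspace_ip (hK := hK) (@inner R) in
  let e := unit_kernel hK Kk in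
  exists2 C : R, 0 < C &
  [/\ forall f N, \sum_(i < N) normc (ip f (e i)) ^+ 2 <= C ^+ 2 * hnorm ip f ^+ 2,
    forall f (B : R), 0 <= B ->
      (forall N, \sum_(i < N) normc (ip f (e i)) ^+ 2 <= B ^+ 2) ->
      hnorm ip f <= C * B,
    forall (c : nat -> R[i]) (B : R), 0 <= B ->
      (forall N, \sum_(i < N) normc (c i) ^+ 2 <= B ^+ 2) ->
      exists g, forall n, ip g (e n) = c n &
    forall f, exists p : nat -> {poly R[i]}, hcvg ip (fun n => lincomb e (p n)) f].
Proof.
move=> [hB zinj [_ interp]]; have [hz hsum Hu hprod] := hB.
have u1 := blaschke_product_unimodular hB.
have [|v [M [Hv vM uv]]] := @Hinfty_bounded R u.
  by split => //; exists 1; apply: ae_on_circleS u1 => t ->.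
have Lu : L2 u := proj1 Hu; have Lv : L2 v := proj1 Hv.
have v1 : ae_on_circle (fun t => normc (v t) = 1).
  by apply: ae_on_circleS (ae_on_circleI u1 uv) => t [<- ->].
pose hK := subspace_model Hu Hv vM uv.
have Kk n : model_space u (kernel (z n)).
  exact: (model_kernel Hu Hv vM uv (hz n) (blaschke_product_zero n hB)).
exists hK, Kk; have Hc := @hcomplete_model R u v M Hu Hv vM uv; split => //.
have KH2 f : model_space u f -> H2 f by case.
apply: (unit_kernel_riesz_basis KH2 Hc hz Kk).
- apply: (model_space_zeros Hu Hv vM uv hz zinj v1) => e e0.
  have [|N hN] := bprod_cvg hz hsum Hu _ e0.
    by move=> w w1; apply/ccvgP; exact: hprod.
  exists N => n /hN; have Lb := L2_bprod hz 0 n.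
  rewrite (@norm2_ae R _ (fun t => bprod z 0 n t - v t)) //.
  + exact: L2_cmeas (L2B Lb Lu).
  + exact: L2_cmeas (L2B Lb Lv).
  + by apply: (ae_on_circleS _ uv) => t ->.
move=> w /interp[f Hf fw]; have [g [B [Hg gB fg]]] := Hinfty_bounded Hf.
exists g, B; split => // n.
by rewrite -fw (disk_ext_ae _ _ fg) //; [case: Hf => [[/L2_cmeas]]|case: Hg => /L2_cmeas].
Qed.

Theorem theorem3 (R : realType) (u : R -> R[i]) (z : nat -> R[i])
    (phi : R -> R[i]) (hu : interpolating_blaschke u z) (hphi : H2 phi) :
  (forall p : \bar R, (1 <= p)%E ->
     (tto_in_schatten p u phi <-> ellp p (fun n => normc (disk_ext phi (z n))))) /\
  (tto_compact u phi <->
     (fun n => disk_ext phi (z n) : (R[i])^o) @ \oo --> (0 : (R[i])^o)).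
Proof.
have [hK [Kk [Hc [C C0 [coord_le coord_ge coord_ex dense]]]]] := interpolating_riesz_basis hu.
have hz : forall n, normc (z n) < 1 by case: hu => [[]].
have KH2 f : model_space u f -> H2 f by case.
split=> [[r| |] // p1|].
- have r0 : 0 < r by apply: lt_le_trans ltr01 _; rewrite -lee_fin.
  exact: (tto_in_schatten_fin hphi KH2 Hc hz C0 coord_le coord_ge coord_ex dense r0).
- exact: (tto_in_schatten_oo hphi KH2 hz C0 coord_le coord_ge coord_ex dense).
split=> [h|/ccvgP h].
  by apply/ccvgP/(tto_compactP hphi KH2 Hc hz C0 coord_le coord_ge coord_ex dense).
by apply/(tto_compactP hphi KH2 Hc hz C0 coord_le coord_ge coord_ex dense).
Qed.
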